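(* Let $N\geq 7$ be large enough, $U_-=\Lambda^2\mathbb{C}^N$, and let $h$ be generic. For every $k$, the action of $B_k$ on (the quantization of) $U_-^{\otimes k}$ factorizes through $Q_k\otimes \mathbb{C}$. Moreover, the resulting morphism $Q_3\otimes\mathbb{C} \to \mathrm{End}(U_-^{\otimes 3})$ is injective and not surjective.
   Context: Let $\mathfrak{g}=\mathfrak{sl}_N(\mathbb{C})$ with invariant form the trace form, $(e_i)$, $(e^i)$ dual bases of $\mathfrak g$, and $\tau\in \mathrm{End}(U_-^{\otimes 2})$ the action of $\sum_i e_i\otimes e^i$. Let $\tau_{ij}$ be $\tau$ acting on the $i$-th and $j$-th factors of $U_-^{\otimes k}$. The braid group $B_k$ (Artin generators $s_1,\dots,s_{k-1}$) acts on $U_-^{\otimes k}$ by the monodromy of the KZ system $\frac{h}{\mathrm{i}\pi}\sum_{i<j}\tau_{ij}\,\mathrm{d}\log(z_i-z_j)$ together with the permutation action of $\mathfrak{S}_k$; equivalently (Drinfeld–Kohno) it acts by $R$-matrices on the corresponding quantized $\mathsf{U}_q\mathfrak{g}$-module, $q=e^h$. ''Generic'' means outside some countable set of values of $h\in\mathbb{C}$. The eigenvalues of $s_1$ are $$a=-e^{-4h/N},\quad b=e^{2(N-2)h/N},\quad c=e^{-4(N+1)h/N}.$$ For these $a,b,c$, let $H_k\otimes\mathbb{C}$ be the quotient of $\mathbb{C}B_k$ by $(s_1-a)(s_1-b)(s_1-c)=0$. For generic $h$, $H_3\otimes\mathbb{C}$ is semisimple of dimension 24. Let $U_{b,c}$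 be its 2-dimensional irreducible representation in which $s_1$ has eigenvalues $b,c$. For $k\ge3$, $Q_k\otimes\mathbb{C}$ is the quotient of $H_k\otimes\mathbb{C}$ by the two-sided ideal generated by the image of the simple ideal of $H_3\otimes\mathbb{C}$ corresponding to $U_{b,c}$; for $k\leq 2$, $Q_k\otimes \mathbb{C}=H_k\otimes \mathbb{C}$. *)

(* Defs.v *)
From HB Require Import structures.
From mathcomp Require Import all_boot all_order all_algebra.
From mathcomp Require Import all_classical all_reals all_analysis.
From mathcomp Require Import complex.

Set Implicit Arguments.
Unset Strict Implicit.
Unset Printing Implicit Defensive.

Import Order.TTheory GRing.Theory Num.Theory.

Local Open Scope ring_scope.
Local Open Scope complex_scope.
Local Open Scope classical_set_scope.

(** * Unital associative algebras given by generators and relators *)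

Inductive ncpoly (K X : Type) : Type :=
| Gen of X
| Cst of K
| Add of ncpoly K X & ncpoly K X
| Mul of ncpoly K X & ncpoly K X.

Arguments Gen {K X}.
Arguments Cst {K X}.
Arguments Add {K X}.
Arguments Mul {K X}.

HB.instance Definition _ (K X : Type) := gen_eqMixin (ncpoly K X).
HB.instance Definition _ (K X : Type) := gen_choiceMixin (ncpoly K X).

Fixpoint ncmap (K X Y : Type) (f : X -> Y) (t : ncpoly K X) : ncpoly K Y :=
  match t with
  | Gen x => Gen (f x)
  | Cst a => Cst a
  | Add t u => Add (ncmap f t) (ncmap f u)
  | Mul t u => Mul (ncmap f t) (ncmap f u)
  end.

Section PresentedAlgebra.
Variables (K : comPzRingType) (X : Type) (rel : set (ncpoly K X)).
Implicit Types t u v : ncpoly K X.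

Definition Sub t u := Add t (Mul (Cst (- 1)) u).

(* Two expressions are congruent when the axioms of associative unital
   K-algebras, together with r = 0 for r in rel, force them to be equal. *)
Inductive ncong : ncpoly K X -> ncpoly K X -> Prop :=
| ncong_rel r : rel r -> ncong r (Cst 0)
| ncong_refl t : ncong t t
| ncong_sym t u : ncong t u -> ncong u t
| ncong_trans t u v : ncong t u -> ncong u v -> ncong t v
| ncong_add t t' u u' : ncong t t' -> ncong u u' -> ncong (Add t u) (Add t' u')
| ncong_mul t t' u u' : ncong t t' -> ncong u u' -> ncong (Mul t u) (Mul t' u')
| ncong_addA t u v : ncong (Add t (Add u v)) (Add (Add t u) v)
| ncong_addC t u : ncong (Add t u) (Add u t)
| ncong_add0 t : ncong (Add (Cst 0) t) t
| ncong_addN t : ncong (Add (Mul (Cst (- 1)) t) t) (Cst 0)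
| ncong_mulA t u v : ncong (Mul t (Mul u v)) (Mul (Mul t u) v)
| ncong_mul1l t : ncong (Mul (Cst 1) t) t
| ncong_mul1r t : ncong (Mul t (Cst 1)) t
| ncong_mulDl t u v : ncong (Mul (Add t u) v) (Add (Mul t v) (Mul u v))
| ncong_mulDr t u v : ncong (Mul t (Add u v)) (Add (Mul t u) (Mul t v))
| ncong_cstD a b : ncong (Cst (a + b)) (Add (Cst a) (Cst b))
| ncong_cstM a b : ncong (Cst (a * b)) (Mul (Cst a) (Cst b))
| ncong_cstC a t : ncong (Mul (Cst a) t) (Mul t (Cst a)).

Definition ncongb t u : bool := `[< ncong t u >].

Lemma ncongb_refl : reflexive ncongb.
Proof. by move=> t; apply/asboolP; exact: ncong_refl. Qed.

Lemma ncongb_sym : symmetric ncongb.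
Proof.
by move=> t u; apply/asboolP/asboolP => ?; exact: ncong_sym.
Qed.

Lemma ncongb_trans : transitive ncongb.
Proof.
move=> u t v /asboolP tu /asboolP uv; apply/asboolP; exact: ncong_trans uv.
Qed.

Canonical ncong_equiv := EquivRel ncongb ncongb_refl ncongb_sym ncongb_trans.

Definition palg : Type := {eq_quot ncong_equiv}%qT.

HB.instance Definition _ := Choice.on palg.
HB.instance Definition _ : Quotient (ncpoly K X) palg := Quotient.on palg.

(* The class of an expression in the presented algebra. *)
Definition cls t : palg := (\pi_palg t)%qT.

Lemma clsP t u : cls t = cls u <-> ncong t u.
Proof.
split=> [/(@eqmodP _ ncong_equiv)/asboolP //|tu].
exact/(@eqmodP _ ncong_equiv)/asboolP.
Qed.

Lemma ncong_repr t : ncong (repr (cls t)) t.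
Proof. by apply/clsP; rewrite /cls reprK. Qed.

Lemma cls_surj (x : palg) : exists t, x = cls t.
Proof. by exists (repr x); rewrite /cls reprK. Qed.

Definition palg_add (x y : palg) : palg := cls (Add (repr x) (repr y)).
Definition palg_opp (x : palg) : palg := cls (Mul (Cst (- 1)) (repr x)).
Definition palg_mul (x y : palg) : palg := cls (Mul (repr x) (repr y)).
Definition palg_scale (a : K) (x : palg) : palg := cls (Mul (Cst a) (repr x)).

Lemma palg_addE t u : palg_add (cls t) (cls u) = cls (Add t u).
Proof. by apply/clsP/ncong_add; exact: ncong_repr. Qed.

Lemma palg_mulE t u : palg_mul (cls t) (cls u) = cls (Mul t u).
Proof. by apply/clsP/ncong_mul; exact: ncong_repr. Qed.

Lemma palg_scaleE a t : palg_scale a (cls t) = cls (Mul (Cst a) t).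
Proof. by apply/clsP/ncong_mul; [exact: ncong_refl|exact: ncong_repr]. Qed.

Lemma palg_oppE t : palg_opp (cls t) = cls (Mul (Cst (- 1)) t).
Proof. exact: palg_scaleE. Qed.

Lemma palg_addA : associative palg_add.
Proof.
move=> x y z; have [[[t ->] [u ->]] [v ->]] := (cls_surj x, cls_surj y, cls_surj z).
by rewrite !palg_addE; apply/clsP/ncong_addA.
Qed.

Lemma palg_addC : commutative palg_add.
Proof.
move=> x y; have [[t ->] [u ->]] := (cls_surj x, cls_surj y).
by rewrite !palg_addE; apply/clsP/ncong_addC.
Qed.

Lemma palg_add0 : left_id (cls (Cst 0)) palg_add.
Proof.
by move=> x; have [t ->] := cls_surj x; rewrite palg_addE; apply/clsP/ncong_add0.
Qed.

Lemma palg_addN : left_inverse (cls (Cst 0)) palg_opp palg_add.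
Proof.
move=> x; have [t ->] := cls_surj x.
by rewrite palg_oppE palg_addE; apply/clsP/ncong_addN.
Qed.

Lemma palg_mulA : associative palg_mul.
Proof.
move=> x y z; have [[[t ->] [u ->]] [v ->]] := (cls_surj x, cls_surj y, cls_surj z).
by rewrite !palg_mulE; apply/clsP/ncong_mulA.
Qed.

Lemma palg_mul1l : left_id (cls (Cst 1)) palg_mul.
Proof.
by move=> x; have [t ->] := cls_surj x; rewrite palg_mulE; apply/clsP/ncong_mul1l.
Qed.

Lemma palg_mul1r : right_id (cls (Cst 1)) palg_mul.
Proof.
by move=> x; have [t ->] := cls_surj x; rewrite palg_mulE; apply/clsP/ncong_mul1r.
Qed.

Lemma palg_mulDl : left_distributive palg_mul palg_add.
Proof.
move=> x y z; have [[[t ->] [u ->]] [v ->]] := (cls_surj x, cls_surj y, cls_surj z).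
by rewrite palg_addE !palg_mulE palg_addE; apply/clsP/ncong_mulDl.
Qed.

Lemma palg_mulDr : right_distributive palg_mul palg_add.
Proof.
move=> x y z; have [[[t ->] [u ->]] [v ->]] := (cls_surj x, cls_surj y, cls_surj z).
by rewrite palg_addE !palg_mulE palg_addE; apply/clsP/ncong_mulDr.
Qed.

HB.instance Definition _ :=
  GRing.isZmodule.Build palg palg_addA palg_addC palg_add0 palg_addN.

HB.instance Definition _ := GRing.Zmodule_isPzRing.Build palg
  palg_mulA palg_mul1l palg_mul1r palg_mulDl palg_mulDr.

Lemma palg_scaleA a b x :
  palg_scale a (palg_scale b x) = palg_scale (a * b) x.
Proof.
have [t ->] := cls_surj x; rewrite !palg_scaleE; apply/clsP.
apply: ncong_trans (ncong_mulA _ _ _) _; apply: ncong_mul; last exact: ncong_refl.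
exact/ncong_sym/ncong_cstM.
Qed.

Lemma palg_scale1 : left_id 1 palg_scale.
Proof.
by move=> x; have [t ->] := cls_surj x; rewrite palg_scaleE; apply/clsP/ncong_mul1l.
Qed.

Lemma palg_scaleDr : right_distributive palg_scale +%R.
Proof.
move=> a x y; have [[t ->] [u ->]] := (cls_surj x, cls_surj y).
by rewrite /GRing.add/= palg_addE !palg_scaleE palg_addE; apply/clsP/ncong_mulDr.
Qed.

Lemma palg_scaleDl x : {morph palg_scale^~ x : a b / a + b}.
Proof.
move=> a b; have [t ->] := cls_surj x.
rewrite !palg_scaleE [RHS]palg_addE; apply/clsP.
apply: ncong_trans (ncong_mulDl _ _ _); apply: ncong_mul; last exact: ncong_refl.
exact: ncong_cstD.
Qed.

HB.instance Definition _ := GRing.Zmodule_isLmodule.Build K palg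
  palg_scaleA palg_scale1 palg_scaleDr palg_scaleDl.

End PresentedAlgebra.

(** * Ideals and representations *)

(* Closure under opposites and scalars is automatic, because
   a *: x = (a *: 1) * x in an algebra. *)
Definition two_sided_ideal (A : pzRingType) (I : set A) : Prop :=
  [/\ I 0,
      forall x y, I x -> I y -> I (x + y)
    & forall x y, I y -> I (x * y) /\ I (y * x)].

Definition simple_ideal (A : pzRingType) (I : set A) : Prop :=
  [/\ two_sided_ideal I, I <> [set 0]
    & forall J : set A, two_sided_ideal J -> J `<=` I -> J = [set 0] \/ J = I].

(* K^n is the space of column vectors; V encodes the subspace of K^n spanned by
   the transposes of its rows. *)
Definition irreducible_rep (K : fieldType) (A : pzRingType) (n : nat)
    (phi : A -> 'M[K]_n) : Prop :=
  (0 < n)%N /\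
  forall V : 'M[K]_n, (forall x : A, (V *m (phi x)^T <= V)%MS) ->
    \rank V = 0%N \/ \rank V = n.

(** * The braid group algebra and its quotients *)

Section CubicQuotients.
Variable K : fieldType.

Lemma pred_leq3 (k : nat) : (3 <= k)%N -> (3.-1 <= k.-1)%N.
Proof. by case: k. Qed.

(* (i, false) is the Artin generator s_(i+1), and (i, true) its inverse. *)
Definition letter (k : nat) : Type := ('I_k.-1 * bool)%type.

Definition sg (k : nat) (i : 'I_k.-1) : ncpoly K (letter k) := Gen (i, false).
Definition sgV (k : nat) (i : 'I_k.-1) : ncpoly K (letter k) := Gen (i, true).

(* The algebra presented by these relators is the group algebra K B_k. *)
Inductive braid_relator (k : nat) : ncpoly K (letter k) -> Prop :=
| braid_invr i : braid_relator (Sub (Mul (sg i) (sgV i)) (Cst 1))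
| braid_invl i : braid_relator (Sub (Mul (sgV i) (sg i)) (Cst 1))
| braid_far (i j : 'I_k.-1) : (i.+1 < j)%N ->
    braid_relator (Sub (Mul (sg i) (sg j)) (Mul (sg j) (sg i)))
| braid_near (i j : 'I_k.-1) : i.+1 = j ->
    braid_relator (Sub (Mul (sg i) (Mul (sg j) (sg i)))
                       (Mul (sg j) (Mul (sg i) (sg j)))).

Variables a b c : K.

Inductive H_relator (k : nat) : ncpoly K (letter k) -> Prop :=
| H_braid r : braid_relator r -> H_relator r
| H_cubic (i : 'I_k.-1) : nat_of_ord i = 0%N ->
    H_relator (Mul (Mul (Sub (sg i) (Cst a)) (Sub (sg i) (Cst b)))
                   (Sub (sg i) (Cst c))).

Definition Halg (k : nat) := palg (@H_relator k).

Definition H3_s1 : Halg 3 := cls _ (@sg 3 ord0).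

(* phi is the two-dimensional irreducible representation U_{b,c}: it is
   determined up to isomorphism by the eigenvalues of s_1. *)
Definition is_Ubc (phi : {rmorphism Halg 3 -> 'M[K]_2}) : Prop :=
  [/\ scalable phi, irreducible_rep phi
    & char_poly (phi H3_s1) = ('X - b%:P) * ('X - c%:P)].

(* The simple ideal of H_3 corresponding to U_{b,c}, i.e. the one which does not
   act by zero on U_{b,c}. The union over I ranges over a single ideal when H_3
   is semisimple of dimension 24. *)
Definition Ubc_ideal : set (Halg 3) :=
  [set x | exists I : set (Halg 3), [/\ simple_ideal I, I x
     & exists2 phi : {rmorphism Halg 3 -> 'M[K]_2}, is_Ubc phi
         & exists2 y, I y & phi y != 0]].

Definition widen_letter (k : nat) (le3k : (3 <= k)%N) (l : letter 3) :
  letter k := (widen_ord (pred_leq3 le3k) l.1, l.2).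

(* Q_k is H_k modulo the image of Ubc_ideal under s_i |-> s_i, which is only
   defined for k >= 3; for k <= 2 no relator is added to those of H_k. *)
Inductive Q_relator (k : nat) : ncpoly K (letter k) -> Prop :=
| Q_H r : H_relator r -> Q_relator r
| Q_Ubc (le3k : (3 <= k)%N) (t : ncpoly K (letter 3)) :
    Ubc_ideal (cls _ t) -> Q_relator (ncmap (widen_letter le3k) t).

Definition Qalg (k : nat) := palg (@Q_relator k).

Definition Q_s (k : nat) (i : 'I_k.-1) : Qalg k := cls _ (sg i).

End CubicQuotients.

(** * R-matrices *)

Definition cexp (R : realType) (z : R[i]) : R[i] :=
  let: x +i* y := z in (expR x * cos y) +i* (expR x * sin y).

Section LocalOperators.
Variables (K : fieldType) (T : finType).

(* E (K^T ^ (x) k) in the basis (e_x), x : 'I_k -> T; an operator acts on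
   column vectors, and its (y, x) entry is the coefficient of e_y in the image
   of e_x. *)
Definition Endt (k : nat) : Type := 'M[K]_#|{ffun 'I_k -> T}|.

Definition entry (k : nat) (M : Endt k) (y x : {ffun 'I_k -> T}) : K :=
  M (enum_rank y) (enum_rank x).

(* The operator of K^T (x) K^T whose ((y1, y2), (x1, x2)) entry is
   M (y1, y2) (x1, x2), acting on the factors i and i + 1. *)
Definition local (M : T * T -> T * T -> K) (k : nat) (i : 'I_k.-1) : Endt k :=
  \matrix_(r, s)
    let y := enum_val r : {ffun 'I_k -> T} in
    let x := enum_val s : {ffun 'I_k -> T} in
    \sum_(p : 'I_k * 'I_k | (p.1 == i :> nat) && (p.2 == i.+1 :> nat))
      M (y p.1, y p.2) (x p.1, x p.2)
      * [forall j : 'I_k, (j != p.1) && (j != p.2) ==> (y j == x j)]%:R.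

End LocalOperators.

(* The quantization of Lambda^2 C^N is realised inside V (x) V, where V = C^N is
   the vector representation of U_q(sl_N), and its R-matrix follows from the one
   of V by the axioms (D (x) 1)(R) = R13 R23 and (1 (x) D)(R) = R13 R12 of a
   universal R-matrix, where D is the coproduct. The braidings below are R
   composed with the flip of the two factors. *)
Section QuantumExteriorSquare.
Variables (R : realType) (N : nat) (h : R[i]).

Let q : R[i] := cexp h.

(* Braiding of V (x) V: with v_1, ..., v_N the standard basis,
   q^(1/N) Rvec (v_i (x) v_j) is
     q v_i (x) v_i                                 if i = j,
     v_j (x) v_i                                   if i < j,
     v_j (x) v_i + (q - q^-1) v_i (x) v_j          if i > j.
   Its eigenvalues q^(1 - 1/N) and - q^(- 1 - 1/N) are those of the flip composed
   with exp (h tau) for the trace form. *)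
Definition Rvec (y x : 'I_N * 'I_N) : R[i] :=
  cexp (- h / N%:R) *
  (if x.1 == x.2 then q *+ (y == x)
   else (y == (x.2, x.1))%:R + (q - q^-1) *+ ((x.2 < x.1)%N && (y == x))).

(* The braiding of (V (x) V) (x) (V (x) V). *)
Definition Rvec4 (i : 'I_3) : Endt R[i] 'I_N 4 := @local _ _ Rvec 4 i.

Definition Rfused : Endt R[i] 'I_N 4 :=
  Rvec4 (inord 1) *m Rvec4 (inord 0) *m Rvec4 (inord 2) *m Rvec4 (inord 1).

(* The quantum exterior square is the eigenspace of Rvec for - q^(- 1 - 1/N).
   Its basis is v_i (x) v_j - q^-1 v_j (x) v_i for i < j, and
   wedge (i, j) is the family of coordinates of this vector in V (x) V. *)
Definition wedge_index : finType := {p : 'I_N * 'I_N | (p.1 < p.2)%N}.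

Definition wedge (p : wedge_index) (ij : 'I_N * 'I_N) : R[i] :=
  (ij == val p)%:R - q^-1 *+ (ij == ((val p).2, (val p).1)).

Definition cat4 (u v : 'I_N * 'I_N) : {ffun 'I_4 -> 'I_N} :=
  [ffun j : 'I_4 => tnth [tuple u.1; u.2; v.1; v.2] j].

(* Rfused preserves the tensor square of the quantum exterior square, and a
   vector of the latter is read in the basis above by taking its coefficients on
   the v_i (x) v_j (x) v_k (x) v_l with i < j and k < l. *)
Definition Rwedge (y x : wedge_index * wedge_index) : R[i] :=
  \sum_(u : 'I_N * 'I_N) \sum_(v : 'I_N * 'I_N)
    entry Rfused (cat4 (val y.1) (val y.2)) (cat4 u v)
    * (wedge x.1 u * wedge x.2 v).

(* EndU k is End (U_-^(x)k), and braid_action i is the action of s_(i+1). *)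
Definition EndU (k : nat) : Type := Endt R[i] wedge_index k.

Definition braid_action (k : nat) (i : 'I_k.-1) : EndU k := local Rwedge i.

End QuantumExteriorSquare.

(* Main.v *)
(* On the tensor powers of the vector representation V the braidings T_i satisfy
   a quadratic relation, U_- (x) U_- is a common eigenspace of T_1 and T_3 in
   V^(4), and F = T_2 T_1 T_3 T_2 restricts to the braiding of U_- (x) U_-. The
   braid relation and the cubic relation of the latter are thus consequences of
   identities in Hecke algebras.

   Factorization. In the two-dimensional representation U_(b,c) the full twist
   (s_1 s_2)^3 is the scalar -(bc)^3, while for q = 1 the group B_3 acts on the
   third tensor power of U_- through a symmetric group and bc = 1. Hence the
   central element (s_1 s_2)^3 + (bc)^3 kills U_(b,c) but acts as 2 for q = 1, and
   therefore invertibly for generic h. By simplicity it annihilates the simple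
   ideal attached to U_(b,c), so this ideal acts by zero.

   Injectivity. H_3 is spanned by 24 words, and 20 braids act by linearly
   independent operators on the third tensor power of U_- (for q = 2, some matrix
   of their coordinates is triangular), so that the kernel of the action of H_3 has
   dimension at most 4. A polynomial in the full twist lies in this kernel and
   acts as the identity on U_(b,c). Hence the kernel is mapped isomorphically onto
   the algebra of 2 x 2 matrices: it is the simple ideal attached to U_(b,c).

   The action is not surjective because it preserves weights. Genericity amounts
   to the non-vanishing of finitely many Laurent polynomials in exp (h / N). *)

Require Import Defs.
From HB Require Import structures.
From mathcomp Require Import all_boot all_order all_algebra.
From mathcomp Require Import all_classical all_reals all_analysis.
From mathcomp Require Import complex.
From mathcomp Require Import perm ring zify ssrZ.
From Stdlib Require BinInt.

Import Order.TTheory GRing.Theory Num.Theory.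

Local Open Scope ring_scope.
Local Open Scope classical_set_scope.

Set Implicit Arguments.
Unset Strict Implicit.
Unset Printing Implicit Defensive.

(** * Presented algebras *)

(** Two obstacles shape the proof. Since N is arbitrary, the operators [Rwedge] are out of reach of
    direct computation: their identities are proved on the even tensor powers of V, where they rest
    on braid and Hecke relations only, and are pulled back through the injective inclusion [winc] of
    the tensor powers of U_-. Likewise the coordinates that separate the twenty braids involve six
    distinct letters only, so that the determinant reduces to an integer computation in which N does
    not occur. The parameter h enters through t = exp (h / N) alone, with l = t^-1 and q = t^N. Four
    Laurent polynomials in t must not vanish: q + q^-1, b^2 - b c + c^2, the determinant of the
    twist and that of the twenty braids. One good value of t is enough for each. At t = 1 the
    generators act by involutions; this settles the first three, but an inverse generator then acts
    like the generator itself. The last one is therefore evaluated at q = 2, where q - q^-1 = 3/2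
    brings in only powers of two as denominators. *)

Section PresentedAlgebraTheory.
Variables (K : comPzRingType) (X : Type) (rel : set (ncpoly K X)).
Local Notation A := (palg rel).
Local Notation cl := (cls rel).

Lemma cls_add t u : cl (Add t u) = cl t + cl u.
Proof. by rewrite -palg_addE. Qed.

Lemma cls_mul t u : cl (Mul t u) = cl t * cl u.
Proof. by rewrite -palg_mulE. Qed.

Lemma cls_cst a : cl (Cst a) = a *: (1 : A).
Proof.
rewrite [RHS](palg_scaleE rel a (Cst 1)); apply/clsP/ncong_sym.
exact: ncong_mul1r.
Qed.

Lemma cls_sub t u : cl (Defs.Sub t u) = cl t - cl u.
Proof.
by rewrite cls_add; congr (_ + _); rewrite [RHS](palg_oppE rel u).
Qed.

Lemma palg_scalerAl a (x y : A) : a *: (x * y) = (a *: x) * y.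
Proof.
have [[t ->] [u ->]] := (cls_surj x, cls_surj y).
rewrite -cls_mul [LHS](palg_scaleE rel) [a *: _](palg_scaleE rel) -cls_mul.
exact/clsP/ncong_mulA.
Qed.

Lemma palg_scalerAr a (x y : A) : a *: (x * y) = x * (a *: y).
Proof.
have [[t ->] [u ->]] := (cls_surj x, cls_surj y).
rewrite -cls_mul [LHS](palg_scaleE rel) [a *: _](palg_scaleE rel) -cls_mul.
apply/clsP; apply: ncong_trans (ncong_mulA _ _ _ _) _.
apply: ncong_trans (ncong_sym (ncong_mulA _ _ _ _)).
apply: ncong_mul; [exact: ncong_cstC|exact: ncong_refl].
Qed.

Lemma cls_rel r : rel r -> cl r = 0.
Proof. by move=> rr; exact/clsP/ncong_rel. Qed.

End PresentedAlgebraTheory.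

Section Evaluation.
Variables (K : fieldType) (X : Type) (n : nat).
Implicit Type g : X -> 'M[K]_n.

Fixpoint nceval g (t : ncpoly K X) : 'M[K]_n :=
  match t with
  | Gen x => g x
  | Cst a => a%:M
  | Add t u => nceval g t + nceval g u
  | Mul t u => nceval g t *m nceval g u
  end.

Lemma nceval_ncong (rel : set (ncpoly K X)) g t u :
    (forall r, rel r -> nceval g r = 0) ->
  ncong rel t u -> nceval g t = nceval g u.
Proof.
move=> grel; elim=> {t u} /=.
- by move=> r /grel ->; rewrite raddf0.
- by [].
- by move=> t u _ ->.
- by move=> t u v _ -> _ ->.
- by move=> t t' u u' _ -> _ ->.
- by move=> t t' u u' _ -> _ ->.
- by move=> t u v; rewrite addrA.
- by move=> t u; rewrite addrC.
- by move=> t; rewrite raddf0 add0r.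
- by move=> t; rewrite raddfN mulNmx mul1mx addNr raddf0.
- by move=> t u v; rewrite mulmxA.
- by move=> t; rewrite mul1mx.
- by move=> t; rewrite mulmx1.
- by move=> t u v; rewrite mulmxDl.
- by move=> t u v; rewrite mulmxDr.
- by move=> a b; rewrite raddfD.
- by move=> a b; rewrite scalar_mxM.
- by move=> a t; rewrite scalar_mxC.
Qed.

(** Universal property, for matrix algebras: [nceval] is constant on congruence classes, so that it
    may be computed on the chosen representative of a class. *)
Lemma palg_lift (rel : set (ncpoly K X)) g :
    (forall r, rel r -> nceval g r = 0) ->
  exists f : {rmorphism palg rel -> 'M[K]_n},
    scalable f /\ forall t, f (cls rel t) = nceval g t.
Proof.
move=> grel; pose f (x : palg rel) := nceval g (repr x).
have fE t : f (cls rel t) = nceval g t by apply/(nceval_ncong grel)/ncong_repr.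
have fB : zmod_morphism f.
  move=> x y; have [[t ->] [u ->]] := (cls_surj x, cls_surj y).
  by rewrite -cls_sub !fE /= raddfN mulNmx mul1mx.
have fM : monoid_morphism f.
  split; first by rewrite [1]/(cls rel (Cst 1)) fE.
  move=> x y; have [[t ->] [u ->]] := (cls_surj x, cls_surj y).
  by rewrite -cls_mul !fE.
pose f1 := GRing.isZmodMorphism.Build _ _ f fB.
pose f2 := GRing.isMonoidMorphism.Build _ _ f fM.
pose F : {rmorphism palg rel -> 'M[K]_n} := HB.pack f f1 f2.
exists F; split=> // a x /=; have [t ->] := cls_surj x.
by rewrite [a *: _](palg_scaleE rel) !fE /= mul_scalar_mx.
Qed.

Lemma rmorph_cls (rel : set (ncpoly K X))
    (f : {rmorphism palg rel -> 'M[K]_n}) :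
    scalable f ->
  forall t, f (cls rel t) = nceval (fun x => f (cls rel (Gen x))) t.
Proof.
move=> fZ; elim=> [x|a|t IHt u IHu|t IHt u IHu] //=.
- by rewrite cls_cst fZ rmorph1 scalemx1.
- by rewrite cls_add rmorphD IHt IHu.
- by rewrite cls_mul rmorphM IHt IHu.
Qed.

Lemma eq_nceval g g' : g =1 g' -> nceval g =1 nceval g'.
Proof. by move=> e; elim=> //= t -> u ->. Qed.

End Evaluation.

(** * Operators on tensor powers *)

(* A matrix whose rows and columns are indexed by I and J is made to act on
   functions, i.e. on coordinates: this turns products of local operators into
   substitutions. *)
Section Action.
Variables (K : fieldType) (I J : finType).

Definition act (M : 'M[K]_(#|I|, #|J|)) (g : J -> K) (y : I) : K :=
  \sum_x M (enum_rank y) (enum_rank x) * g x.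

Lemma eq_act M g g' : g =1 g' -> act M g =1 act M g'.
Proof. by move=> e y; apply: eq_bigr => x _; rewrite e. Qed.

Lemma act_delta M x y :
  act M (fun x' => (x' == x)%:R) y = M (enum_rank y) (enum_rank x).
Proof.
rewrite /act (bigD1 x)//= eqxx mulr1 big1 ?addr0// => i /negPf ->.
by rewrite mulr0.
Qed.

Lemma act_inj M M' : (forall g, act M g =1 act M' g) -> M = M'.
Proof.
move=> e; apply/matrixP => r s.
by have := e (fun x => (x == enum_val s)%:R) (enum_val r);
  rewrite !act_delta !enum_valK.
Qed.

Lemma actD M M' g y : act (M + M') g y = act M g y + act M' g y.
Proof.
by rewrite /act -big_split; apply: eq_bigr => x _; rewrite mxE mulrDl.
Qed.

Lemma actZ a M g y : act (a *: M) g y = a * act M g y.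
Proof.
by rewrite /act mulr_sumr; apply: eq_bigr => x _; rewrite mxE mulrA.
Qed.

Lemma act_scale M a g y : act M (fun x => a * g x) y = a * act M g y.
Proof.
by rewrite /act mulr_sumr; apply: eq_bigr => x _; rewrite mulrCA.
Qed.

Lemma act_sum (L : finType) M (g : L -> J -> K) y :
  act M (fun x => \sum_j g j x) y = \sum_j act M (g j) y.
Proof.
rewrite /act exchange_big; apply: eq_bigr => x _.
by rewrite mulr_sumr.
Qed.

Lemma act0 g y : act 0 g y = 0.
Proof. by rewrite /act big1// => x _; rewrite mxE mul0r. Qed.

End Action.

Section ActionComposition.
Variables (K : fieldType) (I J L : finType).

Lemma act_mul (M : 'M[K]_(#|I|, #|J|)) (M' : 'M[K]_(#|J|, #|L|)) g :
  act (M *m M') g =1 act M (act M' g).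
Proof.
move=> y; rewrite /act; under eq_bigr do rewrite mxE mulr_suml.
rewrite exchange_big /= (reindex_onto enum_rank enum_val) /=; last first.
  by move=> x _; rewrite enum_valK.
apply: eq_big => [x|x _]; first by rewrite enum_rankK eqxx.
by rewrite mulr_sumr; apply: eq_bigr => x' _; rewrite mulrA.
Qed.

Lemma act_scalar a (g : I -> K) y : act (a%:M : 'M[K]_#|I| ) g y = a * g y.
Proof.
rewrite /act (bigD1 y)//= big1 ?addr0; last first.
  by move=> x /negPf xy; rewrite mxE (inj_eq enum_rank_inj) eq_sym xy mul0r.
by rewrite mxE eqxx.
Qed.

End ActionComposition.

(** * Operators acting on a few tensor factors *)

Section Locality.
Variables (K : fieldType) (T : finType).

Definition fst_pos (k : nat) (i : 'I_k.-1) : 'I_k := widen_ord (leq_pred k) i.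

Lemma snd_pos_subproof (k : nat) (i : 'I_k.-1) : (i.+1 < k)%N.
Proof. by case: k i => [[]|k i] //=; rewrite ltnS. Qed.

Definition snd_pos (k : nat) (i : 'I_k.-1) : 'I_k :=
  Ordinal (snd_pos_subproof i).

Lemma fst_snd_neq (k : nat) (i : 'I_k.-1) : (snd_pos i == fst_pos i) = false.
Proof. by rewrite -val_eqE /= gtn_eqF. Qed.

Definition put2 (k : nat) (i : 'I_k.-1) (y : {ffun 'I_k -> T}) (u : T * T) :
    {ffun 'I_k -> T} :=
  [ffun j => if j == fst_pos i then u.1 else if j == snd_pos i then u.2
             else y j].

(** The Boolean factor in [local] leaves only the words that agree with y away from the two
    positions, and these are the [put2 i y u]. *)
Lemma act_local (M : T * T -> T * T -> K) (k : nat) (i : 'I_k.-1) g y :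
  act (local M i) g y =
  \sum_u M (y (fst_pos i), y (snd_pos i)) u * g (put2 i y u).
Proof.
rewrite /act; under eq_bigr => x _.
  rewrite mxE /= !enum_rankK (big_pred1 (fst_pos i, snd_pos i)) /=; last first.
    by move=> [p1 p2]; rewrite /= xpair_eqE -!val_eqE.
  over.
pose pr (x : {ffun 'I_k -> T}) := (x (fst_pos i), x (snd_pos i)).
rewrite (bigID (fun x => x == put2 i y (pr x))) /= [X in _ + X]big1 ?addr0.
  rewrite (reindex_onto (put2 i y) pr) /=; last by move=> x /eqP.
  apply: eq_big => [u|u _].
    have -> : pr (put2 i y u) = u.
      by rewrite /pr !ffunE !eqxx fst_snd_neq -surjective_pairing.
    by rewrite !eqxx.
  rewrite !ffunE !eqxx fst_snd_neq -surjective_pairing.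
  case: (boolP [forall j, _]) => [_|/negP[]]; first by rewrite mulr1.
  apply/forallP => j; apply/implyP => /andP[/negPf j1 /negPf j2].
  by rewrite ffunE j1 j2.
move=> x xy; case: forallP => [xj|_]; last by rewrite mulr0 mul0r.
case/negP: xy; apply/eqP/ffunP => j; rewrite ffunE.
case: (j =P _) => [->//|/eqP j1]; case: (j =P _) => [->//|/eqP j2].
by have /implyP := xj j; rewrite j1 j2 => /(_ isT)/eqP.
Qed.

Lemma put2_fst (k : nat) (i : 'I_k.-1) y u : put2 i y u (fst_pos i) = u.1.
Proof. by rewrite ffunE eqxx. Qed.

Lemma put2_snd (k : nat) (i : 'I_k.-1) y u : put2 i y u (snd_pos i) = u.2.
Proof. by rewrite ffunE fst_snd_neq eqxx. Qed.

(** Substitutions at disjoint pairs of positions commute, and the coefficients of one operator do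
    not see the letters changed by the other. *)
Lemma local_far (M M' : T * T -> T * T -> K) (k : nat) (i j : 'I_k.-1) :
  (i.+1 < j)%N -> local M i *m local M' j = local M' j *m local M i.
Proof.
move=> ij; apply: act_inj => g y; rewrite !act_mul.
have ne : [/\ (fst_pos j == fst_pos i) = false, (fst_pos j == snd_pos i) = false,
    (snd_pos j == fst_pos i) = false & (snd_pos j == snd_pos i) = false].
  by split; rewrite -val_eqE /=; lia.
case: ne => ne1 ne2 ne3 ne4.
rewrite !act_local.
under eq_bigr do rewrite act_local mulr_sumr.
under [RHS]eq_bigr do rewrite act_local mulr_sumr.
rewrite exchange_big; apply: eq_bigr => u _; apply: eq_bigr => v _.
rewrite mulrCA; congr (_ * (_ * _)); rewrite ?ffunE.
- by rewrite ne1 ne2 ne3 ne4.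
- by rewrite ![fst_pos i == _]eq_sym ![snd_pos i == _]eq_sym ne1 ne2 ne3 ne4.
congr g; apply/ffunP => x; rewrite !ffunE.
case: (x =P fst_pos j) => [->|_]; first by rewrite ne1 ne2.
by case: (x =P snd_pos j) => [->|_]; first by rewrite ne3 ne4.
Qed.

Section Embedding.
Variables (m k : nat) (p : 'I_m -> 'I_k).

Definition pullback (y : {ffun 'I_k -> T}) : {ffun 'I_m -> T} :=
  [ffun i => y (p i)].

Definition overwrite (y : {ffun 'I_k -> T}) (w : {ffun 'I_m -> T}) :
    {ffun 'I_k -> T} :=
  [ffun j => if [pick i | p i == j] is Some i then w i else y j].

(* The operator A acting on the factors p 0, ..., p (m - 1). *)
Definition embed (A : Endt K T m) : Endt K T k :=
  \matrix_(r, s)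
    let y := enum_val r : {ffun 'I_k -> T} in
    let x := enum_val s : {ffun 'I_k -> T} in
    entry A (pullback y) (pullback x)
    * [forall j, (j \notin codom p) ==> (y j == x j)]%:R.

Hypothesis p_inj : injective p.

Lemma overwrite_in y w i : overwrite y w (p i) = w i.
Proof.
rewrite ffunE; case: pickP => [j /eqP/p_inj -> //|/(_ i)].
by rewrite eqxx.
Qed.

Lemma overwrite_out y w j : j \notin codom p -> overwrite y w j = y j.
Proof.
rewrite ffunE; case: pickP => [i /eqP <-|//].
by rewrite codom_f.
Qed.

Lemma overwriteK y w : pullback (overwrite y w) = w.
Proof. by apply/ffunP => i; rewrite ffunE overwrite_in. Qed.

Lemma eq_overwrite (y x : {ffun 'I_k -> T}) (w : {ffun 'I_m -> T}) :
    (forall i, x (p i) = w i) -> (forall j, j \notin codom p -> x j = y j) ->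
  x = overwrite y w.
Proof.
move=> xi xj; apply/ffunP => j.
case: (boolP (j \in codom p)) => [/codomP[i ->]|jp].
  by rewrite overwrite_in xi.
by rewrite overwrite_out// xj.
Qed.

Lemma act_embed A g y :
  act (embed A) g y = act A (fun w => g (overwrite y w)) (pullback y).
Proof.
rewrite /act; under eq_bigr => x _ do rewrite mxE !enum_rankK.
rewrite (bigID (fun x => x == overwrite y (pullback x))) /=.
rewrite [X in _ + X]big1 ?addr0.
  rewrite (reindex_onto (overwrite y) pullback) /=; last by move=> x /eqP.
  apply: eq_big => [w|w _]; first by rewrite overwriteK !eqxx.
  rewrite overwriteK /entry.
  case: (boolP [forall j, _]) => [_|/negP[]]; first by rewrite mulr1.
  by apply/forallP => j; apply/implyP => /overwrite_out ->.
move=> x xy; case: forallP => [xj|_]; last by rewrite mulr0 mul0r.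
case/negP: xy; apply/eqP/eq_overwrite => [i|j]; first by rewrite ffunE.
by move=> jp; have /implyP/(_ jp)/eqP := xj j.
Qed.

(** Overwriting twice through p amounts to overwriting once, so the factors outside the image of p
    stay untouched by the composite. *)
Lemma embedM A B : embed (A *m B) = embed A *m embed B.
Proof.
apply: act_inj => g y; rewrite act_mul !act_embed act_mul.
apply: eq_act => w; rewrite act_embed overwriteK; apply: eq_act => w'.
congr g; apply: eq_overwrite => [i|j jp]; first by rewrite overwrite_in.
by rewrite !overwrite_out.
Qed.

Lemma embedD A B : embed (A + B) = embed A + embed B.
Proof. by apply: act_inj => g y; rewrite actD !act_embed actD. Qed.

Lemma embed_scalar a : embed a%:M = a%:M.
Proof.
apply: act_inj => g y; rewrite act_embed !act_scalar; congr (_ * g _).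
by apply/esym/eq_overwrite => // i; rewrite ffunE.
Qed.

Lemma embed_local (M : T * T -> T * T -> K) (i : 'I_m.-1) (i' : 'I_k.-1) :
    p (fst_pos i) = fst_pos i' -> p (snd_pos i) = snd_pos i' ->
  embed (local M i) = local M i'.
Proof.
move=> p1 p2; apply: act_inj => g y; rewrite act_embed !act_local.
apply: eq_bigr => u _; rewrite !ffunE p1 p2; congr (_ * g _).
apply/esym/eq_overwrite => [j|j jp].
  rewrite ffunE -p1 -p2 !(inj_eq p_inj) ffunE; do 2 case: eqP => // _.
  by rewrite ffunE.
rewrite ffunE -p1 -p2; case: eqP => [e|_]; first by rewrite e codom_f in jp.
by case: eqP => [e|_] //; rewrite e codom_f in jp.
Qed.

End Embedding.

End Locality.

(** * The braiding of the vector representation *)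

Section VectorBraiding.
Variables (K : fieldType) (N : nat) (l q : K).
Hypothesis q_neq0 : q != 0.

(* Rvec of the statement, with l and q in place of exp (-h/N) and exp h. *)
Definition vbraid (y x : 'I_N * 'I_N) : K :=
  l *
  (if x.1 == x.2 then q *+ (y == x)
   else (y == (x.2, x.1))%:R + (q - q^-1) *+ ((x.2 < x.1)%N && (y == x))).

(** Row (a, b) has at most two non-zero entries, in the columns (a, b) and (b, a). *)
Lemma vbraid_sum (G : 'I_N * 'I_N -> K) a b :
  \sum_u vbraid (a, b) u * G u =
  l * (if a == b then q * G (a, b)
       else G (b, a) + (q - q^-1) *+ (b < a)%N * G (a, b)).
Proof.
rewrite (bigD1 (a, b)) //= /vbraid /= eqxx andbT mulr1n.
case: (eqVneq a b) => [<-|ab].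
  rewrite big1 ?addr0 ?mulrA// => -[u1 u2] u_ne /=.
  have e1 : ((a, a) == (u1, u2)) = false by rewrite eq_sym; apply/negbTE.
  have e2 : ((a, a) == (u2, u1)) = false.
    by rewrite -e1 !xpair_eqE andbC.
  by rewrite e1 e2 andbF !mulr0n addr0 if_same mulr0 mul0r.
rewrite (bigD1 (b, a)) /=; last by rewrite xpair_eqE eq_sym (negPf ab).
rewrite [b == a]eq_sym (negPf ab) eqxx !xpair_eqE (negPf ab) /= !andbF.
rewrite add0r mulr0n addr0 big1 ?addr0; last first.
  move=> [u1 u2]; rewrite !xpair_eqE /= => /andP[n1 n2].
  rewrite ![a == _]eq_sym ![b == _]eq_sym.
  rewrite (negPf n1) andbC (negPf n2) andbF !mulr0n addr0 if_same.
  by rewrite mulr0 mul0r.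
by rewrite mulr1; ring.
Qed.

Lemma act_vbraid (k : nat) (i : 'I_k.-1) g y :
  act (local vbraid i) g y =
  l * (if y (fst_pos i) == y (snd_pos i) then q * g y
       else g (put2 i y (y (snd_pos i), y (fst_pos i)))
            + (q - q^-1) *+ (y (snd_pos i) < y (fst_pos i))%N * g y).
Proof.
rewrite act_local (vbraid_sum (fun u => g (put2 i y u))).
suff -> : put2 i y (y (fst_pos i), y (snd_pos i)) = y by [].
apply/ffunP => j; rewrite ffunE /=.
by case: eqP => [->|_] //; case: eqP => [->|].
Qed.

Lemma vbraid_hecke (k : nat) (i : 'I_k.-1) :
  local vbraid i *m local vbraid i =
  (l * (q - q^-1)) *: local vbraid i + (l ^+ 2)%:M.
Proof.
apply: act_inj => g y; rewrite act_mul actD actZ act_scalar.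

rewrite !act_vbraid !put2_fst !put2_snd /=.
set y' := put2 i _ _; have -> : put2 i y' (y (fst_pos i), y (snd_pos i)) = y.
  apply/ffunP => j; rewrite !ffunE /=.
  by case: eqP => [->|_] //; case: eqP => [->|].
rewrite [y (snd_pos i) == _]eq_sym -!val_eqE /=.
by case: ltngtP => _; rewrite ?mulr0n ?mulr1n; field.
Qed.

Definition word3 (T : finType) (a b c : T) : {ffun 'I_3 -> T} :=
  [ffun j : 'I_3 => tnth [tuple a; b; c] j].

Lemma word3E (T : finType) (y : {ffun 'I_3 -> T}) :
  y = word3 (y ord0) (y (inord 1)) (y ord_max).
Proof.
by apply/ffunP => -[[|[|[|]]]] //= j; rewrite ffunE (tnth_nth (y ord0)) /=;
  congr (y _); apply/val_inj; rewrite /= ?inordK.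
Qed.

Lemma put2_word3_0 (T : finType) (a b c : T) u :
  @put2 T 3 ord0 (word3 a b c) u = word3 u.1 u.2 c.
Proof.
by apply/ffunP => -[[|[|[|]]]] //= j; rewrite !ffunE -!val_eqE ?ffunE /=
  !(tnth_nth a).
Qed.

Lemma put2_word3_1 (T : finType) (a b c : T) u :
  @put2 T 3 ord_max (word3 a b c) u = word3 a u.1 u.2.
Proof.
by apply/ffunP => -[[|[|[|]]]] //= j; rewrite !ffunE -!val_eqE ?ffunE /=
  !(tnth_nth a).
Qed.

Lemma word3_0 (T : finType) (a b c : T) :
  ((word3 a b c (@fst_pos 3 ord0) = a) * (word3 a b c (@snd_pos 3 ord0) = b)
  * (word3 a b c (@fst_pos 3 ord_max) = b)
  * (word3 a b c (@snd_pos 3 ord_max) = c))%type.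
Proof. by rewrite !ffunE !(tnth_nth a). Qed.

Lemma vbraid_yang_baxter :
  let T0 : Endt K 'I_N 3 := @local _ _ vbraid 3 ord0 in
  let T1 : Endt K 'I_N 3 := @local _ _ vbraid 3 ord_max in
  T0 *m T1 *m T0 = T1 *m T0 *m T1.
Proof.
move=> T0 T1; apply: act_inj => g y; rewrite !act_mul (word3E y).
have E0 f a b c : act T0 f (word3 a b c) =
    l * (if a == b then q * f (word3 a b c)
         else f (word3 b a c) + (q - q^-1) *+ (b < a)%N * f (word3 a b c)).
  by rewrite act_vbraid put2_word3_0 !word3_0.
have E1 f a b c : act T1 f (word3 a b c) =
    l * (if b == c then q * f (word3 a b c)
         else f (word3 a c b) + (q - q^-1) *+ (c < b)%N * f (word3 a b c)).
  by rewrite act_vbraid put2_word3_1 !word3_0.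
move: (y _) (y _) (y _) => a b c.
rewrite !(E0, E1) -!val_eqE /=.
(* The coefficients see only the relative order of a, b and c. Inconsistent orders are discarded; an
   identity of rational functions in q remains for each of the others. *)
case: (ltngtP a b) => [ab|ab|/val_inj ab];
case: (ltngtP b c) => [bc|bc|/val_inj bc];
case: (ltngtP a c) => [ac|ac|/val_inj ac]; subst; rewrite ?ltnn ?eqxx //;
  try lia;
  rewrite ?(gtn_eqF ab) ?(ltn_eqF ab) ?(gtn_eqF bc) ?(ltn_eqF bc);
  rewrite ?(gtn_eqF ac) ?(ltn_eqF ac) ?ab ?bc ?ac; rewrite ?mulr0n ?mulr1n;
  try by field.
Qed.

End VectorBraiding.

(** * The braid relation at arbitrary positions *)

Section GeneralPosition.
Variables (K : fieldType) (N : nat) (l q : K).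
Hypothesis q_neq0 : q != 0.

Lemma consecutive_subproof (m k d : nat) (le_k : (d + m <= k)%N) (s : 'I_m) :
  (d + s < k)%N.
Proof. by rewrite (leq_trans _ le_k)// ltn_add2l. Qed.

Definition consecutive (m k d : nat) (le_k : (d + m <= k)%N) (s : 'I_m) : 'I_k :=
  Ordinal (consecutive_subproof le_k s).

Lemma consecutive_inj m k d (le_k : (d + m <= k)%N) : injective (consecutive le_k).
Proof. by move=> s s' /(congr1 val) /= /addnI /val_inj. Qed.

Lemma embed_consecutive (T : finType) (M : T * T -> T * T -> K) m k d
    (le_k : (d + m <= k)%N) (i : 'I_m.-1) (i' : 'I_k.-1) :
  (d + i)%N = i' -> embed (consecutive le_k) (local M i) = local M i'.
Proof.
move=> e; apply: embed_local; first exact: consecutive_inj.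
- exact/val_inj.
- by apply/val_inj; rewrite /= addnS e.
Qed.

(** Three consecutive factors are the image of an embedding and [embed] is multiplicative, so the
    case k = 3 implies all others. *)
Lemma local_braid (T : finType) (M : T * T -> T * T -> K) :
    (let M0 : Endt K T 3 := @local _ _ M 3 ord0 in
     let M1 : Endt K T 3 := @local _ _ M 3 ord_max in
     M0 *m M1 *m M0 = M1 *m M0 *m M1) ->
  forall (k : nat) (i j : 'I_k.-1), i.+1 = j ->
  local M i *m (local M j *m local M i) = local M j *m (local M i *m local M j).
Proof.
move=> /= yb k i j ij.
have le_k : (i + 3 <= k)%N by rewrite addn3 -ltn_predRL ij.
have e0 := @embed_consecutive T M 3 k i le_k ord0 i (addn0 i).
have e1 : embed (consecutive le_k) (@local _ _ M 3 ord_max) = local M j.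
  by apply: embed_consecutive; rewrite /= addn1.
by rewrite -e0 -e1 -!(embedM (@consecutive_inj _ _ _ _)) !mulmxA yb.
Qed.

Lemma vbraid_braid (k : nat) (i j : 'I_k.-1) : i.+1 = j ->
  local (@vbraid K N l q) i *m (local (@vbraid K N l q) j *m local (@vbraid K N l q) i)
  = local (@vbraid K N l q) j
    *m (local (@vbraid K N l q) i *m local (@vbraid K N l q) j).
Proof. by apply: local_braid; exact: vbraid_yang_baxter. Qed.

End GeneralPosition.

(** * Fusion in the Hecke algebra *)

Section Fusion.
Variables (K : fieldType) (n m : nat).
Local Notation V := 'M[K]_(n, m).
Variables t1 t2 t3 t4 t5 : {linear V -> V}.

Hypothesis b12 : forall x, t1 (t2 (t1 x)) = t2 (t1 (t2 x)).
Hypothesis b23 : forall x, t2 (t3 (t2 x)) = t3 (t2 (t3 x)).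
Hypothesis c13 : forall x, t1 (t3 x) = t3 (t1 x).

(** The crossing of two cables of two strands each. The maps act on rectangular matrices because
    they will be left multiplications applied to [winc]. *)
Definition fused (x : V) : V := t2 (t1 (t3 (t2 x))).

(** A crossing inside one cable slides through the crossing of the cables and comes out in the other
    one. *)
Lemma fused1 x : fused (t1 x) = t3 (fused x).
Proof. by rewrite /fused c13 b12 b23 -c13. Qed.

Lemma fused3 x : fused (t3 x) = t1 (fused x).
Proof. by rewrite /fused -b23 -b12. Qed.

Section Cubic.
Variables (al be : K) (x : V).
Hypothesis hecke : forall y : V,
  [/\ t1 (t1 y) = (al + be) *: t1 y - (al * be) *: y,
      t2 (t2 y) = (al + be) *: t2 y - (al * be) *: y
    & t3 (t3 y) = (al + be) *: t3 y - (al * be) *: y].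
Hypothesis x1 : t1 x = be *: x.
Hypothesis x3 : t3 x = be *: x.

Let fusedD y z : fused (y + z) = fused y + fused z.
Proof. by rewrite /fused !linearD. Qed.

Let fusedZ c y : fused (c *: y) = c *: fused y.
Proof. by rewrite /fused !linearZ. Qed.

Let fused_t1 : t1 (fused x) = be *: fused x.
Proof. by rewrite -fused3 x3 fusedZ. Qed.

Let fused_t3 : t3 (fused x) = be *: fused x.
Proof. by rewrite -fused1 x1 fusedZ. Qed.

(** This is (t1 - al)(t3 - al) t2 x, the vector t2 x pushed into the common eigenspace of t1 and t3
    for be. Together with x and [fused x] it spans a space stable under [fused]. *)
Let Y := t3 (t1 (t2 x)) - al *: (t1 (t2 x) + t3 (t2 x)) + al ^+ 2 *: t2 x.

Let fused_t2 :
  fused (t2 x) = (al + be) *: fused x - (al * be ^+ 3) *: t2 x.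
Proof.
rewrite {1}/fused; have [_ -> _] := hecke x.
rewrite !(linearB, linearZ) /= x3 !linearZ /= x1 !linearZ /= !scalerA.
rewrite /fused.
by apply/matrixP => i j; rewrite !mxE; ring.
Qed.

Lemma fused_sqr :
  fused (fused x) = (al * be) ^+ 4 *: x
    + (be * (be - al) * (al + be) ^+ 2) *: fused x
    - (al * be ^+ 3 * (al + be)) *: Y.
Proof.
have e1 : fused (t1 (t3 (t2 x))) = (al + be) *: (be ^+ 2 *: fused x)
    - (al * be ^+ 3) *: t3 (t1 (t2 x)).
  rewrite fused1 fused3 fused_t2 !(linearB, linearZ) /= fused_t1 linearZ /=.
  by rewrite fused_t3; apply/matrixP => i j; rewrite !mxE; ring.
have e2 : t2 (t1 (t2 x)) = be *: t1 (t2 x) by rewrite -b12 x1 !linearZ.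
have e3 : t2 (t3 (t2 x)) = be *: t3 (t2 x) by rewrite b23 x3 !linearZ.
have [_ h2 _] := hecke x.
rewrite {1}/fused; have [_ -> _] := hecke (t1 (t3 (t2 x))).
rewrite -[t2 (t1 (t3 (t2 x)))]/(fused x).
have e4 : t2 (t1 (t3 (t1 (t3 (t2 x))))) = (al + be) ^+ 2 *: fused x
    - (al + be) * (al * be) * be *: (t1 (t2 x) + t3 (t2 x))
    + (al * be) ^+ 2 *: ((al + be) *: t2 x - (al * be) *: x).
  rewrite -c13; have [-> _ _] := hecke (t3 (t3 (t2 x))).
  have [_ _ ->] := hecke (t2 x).
  rewrite !(linearB, linearZ, linearD) /= e2 e3 h2.
  rewrite -[t2 (t1 (t3 (t2 x)))]/(fused x).
  by apply/matrixP => i j; rewrite !mxE; ring.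
rewrite !(linearB, linearZ) /= e4.
rewrite -[t2 (t1 (t3 (t2 _)))]/(fused _) e1 /Y.
by apply/matrixP => i j; rewrite !mxE; ring.
Qed.

Lemma fused_Y :
  fused Y = ((al + be) * (al - be) ^+ 2) *: fused x - (al * be ^+ 3) *: Y.
Proof.
have e1 : fused (t1 (t2 x)) = t3 (fused (t2 x)) by rewrite fused1.
have e3 : fused (t3 (t2 x)) = t1 (fused (t2 x)) by rewrite fused3.
have e13 : fused (t3 (t1 (t2 x))) = t1 (t3 (fused (t2 x))).
  by rewrite fused3 fused1.
rewrite /Y fusedD -scaleN1r fusedD 3!fusedZ fusedD e1 e3 e13 fused_t2.
rewrite !(linearB, linearZ) /= fused_t3 !linearZ /= fused_t1.
rewrite [t1 (t3 (t2 x))]c13.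
by apply/matrixP => i j; rewrite !mxE; ring.
Qed.

(** Y is eliminated between [fused_sqr] and [fused_Y]. For al = l q and be = - l / q, the roots e,
    e' and be^4 are b, a and c. *)
Lemma fused_cubic :
  let e := - (al ^+ 3 * be) in let e' := - (al ^+ 2 * be ^+ 2) in
  fused (fused (fused x)) =
    (e + e' + be ^+ 4) *: fused (fused x)
    - (e * e' + e * be ^+ 4 + e' * be ^+ 4) *: fused x
    + (e * e' * be ^+ 4) *: x.
Proof.
move=> e e'; rewrite [in LHS]fused_sqr !fusedD -scaleN1r !fusedZ fused_Y.
rewrite fused_sqr.
by apply/matrixP => i j; rewrite !mxE /e /e'; ring.
Qed.

End Cubic.

Section Braid.
Hypothesis b34 : forall x, t3 (t4 (t3 x)) = t4 (t3 (t4 x)).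
Hypothesis b45 : forall x, t4 (t5 (t4 x)) = t5 (t4 (t5 x)).
Hypothesis c14 : forall x, t1 (t4 x) = t4 (t1 x).
Hypothesis c15 : forall x, t1 (t5 x) = t5 (t1 x).
Hypothesis c24 : forall x, t2 (t4 x) = t4 (t2 x).
Hypothesis c25 : forall x, t2 (t5 x) = t5 (t2 x).
Hypothesis c35 : forall x, t3 (t5 x) = t5 (t3 x).

Definition fused' (x : V) : V := t4 (t3 (t5 (t4 x))).

Let comm1 x : fused' (t1 x) = t1 (fused' x).
Proof. by rewrite /fused' -c14 -c15 -c13 -c14. Qed.

Let comm5 x : fused (t5 x) = t5 (fused x).
Proof. by rewrite /fused c25 c35 c15 c25. Qed.

Let fused'3 x : fused' (t3 x) = t5 (fused' x).
Proof. by rewrite /fused' c35 b34 b45 -c35. Qed.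

Lemma fused_fused'_t2 x : fused (fused' (t2 x)) = t4 (fused (fused' x)).
Proof.
rewrite /fused /fused' -c24 -c25 (c24 (t3 _)) b23 b34 c14 (c24 (t1 _)).
by rewrite -(c24 (t3 _)).
Qed.

(** Moving t_i from the right to the left of [fused] after [fused'] turns it into t_(i+2), for i =
    1, 2, 3. This turns the rightmost [fused] into a leftmost [fused']. *)
Lemma fused_braid x : fused (fused' (fused x)) = fused' (fused (fused' x)).
Proof.
by rewrite {2}/fused fused_fused'_t2 comm1 fused1 fused'3 comm5 fused_fused'_t2.
Qed.

End Braid.
End Fusion.

(** * The braiding of the exterior square *)

Section ExteriorSquare.
Variables (K : fieldType) (N : nat) (l q : K).
Hypothesis q_neq0 : q != 0.
Hypothesis l_neq0 : l != 0.
Hypothesis qV_neq : q + q^-1 != 0.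

Local Notation U := (wedge_index N).
Local Notation V2 := ('I_N * 'I_N)%type.
Local Notation T i := (local (@vbraid K N l q) i).

Definition fbraid : Endt K 'I_N 4 :=
  let T4 (i : 'I_3) := @local _ _ (@vbraid K N l q) 4 i in
  T4 (inord 1) *m T4 (inord 0) *m T4 (inord 2) *m T4 (inord 1).

Definition wvec (p : U) (ij : V2) : K :=
  (ij == val p)%:R - q^-1 *+ (ij == ((val p).2, (val p).1)).

(* Rwedge of the statement, with the same parameters as vbraid. *)
Definition wbraid (y x : U * U) : K :=
  \sum_(u : V2) \sum_(v : V2)
    entry fbraid (cat4 (val y.1) (val y.2)) (cat4 u v)
    * (wvec x.1 u * wvec x.2 v).

(** The q-analogue of antisymmetry: these are the coordinate families of the vectors of the quantum
    exterior square. *)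
Definition qalt (f : V2 -> K) : Prop :=
  (forall a, f (a, a) = 0) /\
  (forall a b : 'I_N, (a < b)%N -> f (b, a) = - q^-1 * f (a, b)).

Lemma wvec_qalt p : qalt (wvec p).
Proof.
case: p => -[c d] /= cd; split=> [a|a b ab]; rewrite /wvec /= !xpair_eqE.
  have -> : (a == c) && (a == d) = false.
    apply/negP => /andP[/eqP e1 /eqP e2]; move: cd.
    by rewrite /= -e1 -e2 ltnn.
  have -> : (a == d) && (a == c) = false.
    apply/negP => /andP[/eqP e1 /eqP e2]; move: cd.
    by rewrite /= -e1 -e2 ltnn.
  by rewrite subrr.
have -> : (b == c) && (a == d) = false.
  apply/negP => /andP[/eqP e1 /eqP e2]; move: cd; rewrite /= -e1 -e2.
  by rewrite ltnNge (ltnW ab).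
have -> : (a == d) && (b == c) = false.
  apply/negP => /andP[/eqP e1 /eqP e2]; move: cd; rewrite /= -e1 -e2.
  by rewrite ltnNge (ltnW ab).
by rewrite andbC; case: (_ && _) => /=; rewrite ?mulr0n ?mulr1n; ring.
Qed.

Lemma wvec_val (p p' : U) : wvec p (val p') = (p' == p)%:R.
Proof.
rewrite /wvec (inj_eq val_inj).
have -> : (val p' == ((val p).2, (val p).1)) = false.
  apply/eqP => e; have := valP p'.
  by rewrite e /= ltnNge (ltnW (valP p)).
by rewrite mulr0n subr0.
Qed.

Lemma qalt_expand f ij : qalt f -> f ij = \sum_p f (val p) * wvec p ij.
Proof.
move=> [f0 fV]; have wlt (g : V2 -> K) (a b : 'I_N) : (a < b)%N ->
    \sum_p g (val p) * wvec p (a, b) = g (a, b).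
  move=> ab; rewrite (bigD1 (exist _ (a, b) ab : U)) //=.
  rewrite -[(a, b)]/(val (exist _ (a, b) ab : U)) wvec_val eqxx mulr1.
  by rewrite big1 ?addr0// => p pn; rewrite wvec_val eq_sym (negPf pn) mulr0.
case: ij => a b; case: (ltngtP a b) => [ab|ba|/val_inj <-].
- by rewrite wlt.
- rewrite fV// -(wlt f)// mulr_sumr; apply: eq_bigr => p _.
  by rewrite ((wvec_qalt p).2 _ _ ba) mulrCA.
- by rewrite f0 big1// => p _; rewrite (wvec_qalt p).1 mulr0.
Qed.

Lemma put2_put2 (X : finType) (k : nat) (i : 'I_k.-1) (y : {ffun 'I_k -> X}) u v :
  put2 i (put2 i y u) v = put2 i y v.
Proof. by apply/ffunP => j; rewrite !ffunE; do 2 case: eqP => //. Qed.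

Lemma put2_id (X : finType) (k : nat) (i : 'I_k.-1) (y : {ffun 'I_k -> X}) :
  put2 i y (y (fst_pos i), y (snd_pos i)) = y.
Proof.
apply/ffunP => j; rewrite ffunE /=.
by case: eqP => [->|_] //; case: eqP => [->|].
Qed.

(** On equal letters the operator multiplies by l q, and [qV_neq] separates this value from - l / q,
    so the diagonal vanishes. On distinct letters the eigenvalue equation is the q-antisymmetry. *)
Lemma vbraid_qalt (k : nat) (i : 'I_k.-1) g :
  (forall y, act (T i) g y = - (l / q) * g y) <->
  (forall y, qalt (fun u => g (put2 i y u))).
Proof.
split=> [gT y|gA y]; first split=> [a|a b ab].
- have := gT (put2 i y (a, a)).
  rewrite act_vbraid put2_fst put2_snd eqxx.
  move=> /eqP; rewrite -subr_eq0 mulNr opprK -mulrA -mulrDr -mulrDl.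
  by rewrite !mulf_eq0 (negPf l_neq0) (negPf qV_neq) => /eqP.
- have := gT (put2 i y (a, b)).
  rewrite act_vbraid put2_fst put2_snd -val_eqE /= (ltn_eqF ab).
  rewrite [(b < a)%N]ltnNge (ltnW ab) /= mulr0n mul0r addr0 put2_put2.
  by move=> /(congr1 ( *%R l^-1)); rewrite mulKf// => ->; field; apply/andP.
rewrite act_vbraid.
have [g0 gV] := gA y; have := put2_id i y.
move: (y (fst_pos i)) (y (snd_pos i)) => a b <-; rewrite put2_put2.
rewrite -val_eqE /=; case: ltngtP => [ab|ba|/val_inj <-].
- by rewrite (gV _ _ ab) mulr1n; field.
- by rewrite (gV _ _ ba) mulr0n; field.
- by rewrite g0 !mulr0.
Qed.

Section Pairs.
Variable k : nat.

Lemma even_pos_subproof (j : 'I_k) : (j.*2 < k.*2)%N.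
Proof. by rewrite ltn_double. Qed.

Lemma odd_pos_subproof (j : 'I_k) : (j.*2.+1 < k.*2)%N.
Proof. by rewrite ltn_Sdouble. Qed.

Definition even_pos (j : 'I_k) : 'I_k.*2 := Ordinal (even_pos_subproof j).
Definition odd_pos (j : 'I_k) : 'I_k.*2 := Ordinal (odd_pos_subproof j).

Definition pair_at (y : {ffun 'I_k.*2 -> 'I_N}) (j : 'I_k) : V2 :=
  (y (even_pos j), y (odd_pos j)).

Lemma half_pos_subproof (j : 'I_k.*2) : (j./2 < k)%N.
Proof. by case: j => j /=; rewrite ltn_half_double. Qed.

Definition half_pos (j : 'I_k.*2) : 'I_k := Ordinal (half_pos_subproof j).

Definition of_pairs (u : 'I_k -> V2) : {ffun 'I_k.*2 -> 'I_N} :=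
  [ffun j : 'I_k.*2 => if odd j then (u (half_pos j)).2 else (u (half_pos j)).1].

Lemma pair_at_of_pairs u j : pair_at (of_pairs u) j = u j.
Proof.
rewrite /pair_at !ffunE /= odd_double /=.
have -> : half_pos (even_pos j) = j by apply/val_inj; rewrite /= doubleK.
have -> : half_pos (odd_pos j) = j by apply/val_inj; rewrite /= uphalf_double.
by case: (u j).
Qed.

(* The inclusion of the k-th tensor power of the exterior square in V^(2k). *)
Definition winc : 'M[K]_(#|{ffun 'I_k.*2 -> 'I_N}|, #|{ffun 'I_k -> U}|) :=
  \matrix_(r, s) \prod_j wvec ((enum_val s : {ffun 'I_k -> U}) j)
                              (pair_at (enum_val r) j).

Lemma act_winc h y :
  act winc h y =
  \sum_(x : {ffun 'I_k -> U}) \prod_j wvec (x j) (pair_at y j) * h x.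
Proof. by apply: eq_bigr => x _; rewrite mxE !enum_rankK. Qed.

(** A word made of increasing pairs occurs in exactly one tensor product of basis vectors, with
    coefficient 1. Reading coordinates on such words is thus a left inverse of [winc]. *)
Lemma act_winc_val h (x : {ffun 'I_k -> U}) :
  act winc h (of_pairs (fun j => val (x j))) = h x.
Proof.
rewrite act_winc (bigD1 x) //= [X in _ + X]big1 ?addr0.
  rewrite big1 ?mul1r// => j _.
  by rewrite pair_at_of_pairs wvec_val eqxx.
move=> x' x'x; have [j xj] : exists j, x j != x' j.
  apply/existsP; apply: contraNT x'x; rewrite negb_exists => /forallP e.
  by apply/eqP/ffunP => j; have := e j; rewrite negbK => /eqP ->.
rewrite (bigD1 j) //= pair_at_of_pairs wvec_val (negPf xj).
by rewrite !mul0r.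
Qed.

Lemma winc_inj n (A B : 'M[K]_(#|{ffun 'I_k -> U}|, n)) :
  winc *m A = winc *m B -> A = B.
Proof.
move=> e; apply/matrixP => r s.
have := congr1 (fun M : 'M[K]_(_, n) =>
  M (enum_rank (of_pairs (fun j => val ((enum_val r : {ffun 'I_k -> U}) j)))) s) e.
rewrite !mxE /=.
have E (C : 'M[K]_(#|{ffun 'I_k -> U}|, n)) :
    \sum_j winc (enum_rank (of_pairs (fun j => val ((enum_val r : {ffun 'I_k -> U}) j)))) j * C j s = C r s.
  rewrite -[in RHS](enum_valK r) -[in RHS](act_winc_val (fun x => C (enum_rank x) s)).
  rewrite /act (reindex_onto enum_rank enum_val) /=; last first.
    by move=> x _; rewrite enum_valK.
  by apply: eq_bigl => x; rewrite enum_rankK eqxx.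
by rewrite !E.
Qed.

Lemma even_pos_pred_subproof (j : 'I_k) : (j.*2 < k.*2.-1)%N.
Proof. by have := odd_pos_subproof j; case: k.*2. Qed.

Definition pair_pos (j : 'I_k) : 'I_(k.*2).-1 :=
  Ordinal (even_pos_pred_subproof j).

Lemma pair_at_put2 (j : 'I_k) y u j' :
  pair_at (put2 (pair_pos j) y u) j' = if j' == j then u else pair_at y j'.
Proof.
rewrite /pair_at !ffunE -!val_eqE /= !eqSS.
have -> : (j'.*2 == j.*2.+1) = false by lia.
have -> : (j'.*2.+1 == j.*2) = false by lia.
rewrite (inj_eq double_inj); case: eqP => // _.
by case: u.
Qed.

Lemma vbraid_winc (j : 'I_k) : T (pair_pos j) *m winc = - (l / q) *: winc.
Proof.
apply: act_inj => h y; rewrite act_mul actZ; apply: (vbraid_qalt _ _).2 => {}y.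
have E u : act winc h (put2 (pair_pos j) y u) =
    \sum_(x : {ffun 'I_k -> U}) wvec (x j) u *
      (\prod_(j' | j' != j) wvec (x j') (pair_at y j') * h x).
  rewrite act_winc; apply: eq_bigr => x _.
  rewrite (bigD1 j) //= pair_at_put2 eqxx -!mulrA; congr (_ * (_ * _)).
  by apply: eq_bigr => j' /negPf j'j; rewrite pair_at_put2 j'j.
split=> [a|a b ab]; rewrite !E.
  by rewrite big1// => x _; rewrite (wvec_qalt _).1 mul0r.
rewrite mulr_sumr; apply: eq_bigr => x _.
by rewrite (wvec_qalt _).2// !mulrA.
Qed.

End Pairs.

End ExteriorSquare.

(** * Restriction of the fused braiding to the exterior square *)

Lemma double_pos_subproof (k : nat) (i : 'I_k.-1) : (i.*2 + 4 <= k.*2)%N.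
Proof. by case: i => i /=; lia. Qed.

Section Intertwining.
Variables (K : fieldType) (N : nat) (l q : K).
Hypothesis q_neq0 : q != 0.
Hypothesis l_neq0 : l != 0.
Hypothesis qV_neq : q + q^-1 != 0.

Local Notation U := (wedge_index N).
Local Notation W4 := {ffun 'I_4 -> 'I_N}.
Local Notation T i := (local (@vbraid K N l q) i).
Local Notation T4 i := (@local K _ (@vbraid K N l q) 4 i).

Let b01 : T4 (inord 0) *m (T4 (inord 1) *m T4 (inord 0)) =
          T4 (inord 1) *m (T4 (inord 0) *m T4 (inord 1)).
Proof. by apply: vbraid_braid => //=; rewrite !inordK. Qed.

Let b12 : T4 (inord 1) *m (T4 (inord 2) *m T4 (inord 1)) =
          T4 (inord 2) *m (T4 (inord 1) *m T4 (inord 2)).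
Proof. by apply: vbraid_braid => //=; rewrite !inordK. Qed.

Let c02 : T4 (inord 0) *m T4 (inord 2) = T4 (inord 2) *m T4 (inord 0).
Proof. by apply: local_far => //=; rewrite !inordK. Qed.

Let fbraidE : @fbraid K N l q =
  T4 (inord 1) *m (T4 (inord 0) *m (T4 (inord 2) *m T4 (inord 1))).
Proof. by rewrite /fbraid -!mulmxA. Qed.

Let b01x (x : 'M[K]_#|W4| ) :
  T4 (inord 0) *m (T4 (inord 1) *m (T4 (inord 0) *m x)) =
  T4 (inord 1) *m (T4 (inord 0) *m (T4 (inord 1) *m x)).
Proof. by rewrite !mulmxA -(mulmxA (T4 (inord 0))) b01 !mulmxA. Qed.

Let b12x (x : 'M[K]_#|W4| ) :
  T4 (inord 1) *m (T4 (inord 2) *m (T4 (inord 1) *m x)) =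
  T4 (inord 2) *m (T4 (inord 1) *m (T4 (inord 2) *m x)).
Proof. by rewrite !mulmxA -(mulmxA (T4 (inord 1))) b12 !mulmxA. Qed.

Let c02x (x : 'M[K]_#|W4| ) :
  T4 (inord 0) *m (T4 (inord 2) *m x) = T4 (inord 2) *m (T4 (inord 0) *m x).
Proof. by rewrite !mulmxA c02. Qed.

Let fE (x : 'M[K]_#|W4| ) :
  fused (mulmx (T4 (inord 0))) (mulmx (T4 (inord 1))) (mulmx (T4 (inord 2))) x
  = fbraid N l q *m x.
Proof. by rewrite /fused fbraidE /= -!mulmxA. Qed.

Lemma fbraid_comm0 :
  T4 (inord 0) *m fbraid N l q = fbraid N l q *m T4 (inord 2).
Proof.
have := fused3 (t1 := mulmx (T4 (inord 0))) (t2 := mulmx (T4 (inord 1)))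
  (t3 := mulmx (T4 (inord 2))) b01x b12x 1%:M.
by rewrite !fE /= !mulmx1.
Qed.

Lemma fbraid_comm2 :
  T4 (inord 2) *m fbraid N l q = fbraid N l q *m T4 (inord 0).
Proof.
have := fused1 (t1 := mulmx (T4 (inord 0))) (t2 := mulmx (T4 (inord 1)))
  (t3 := mulmx (T4 (inord 2))) b01x b12x c02x 1%:M.
by rewrite !fE /= !mulmx1.
Qed.

Definition left_pair (w : W4) : 'I_N * 'I_N :=
  (w (fst_pos (inord 0 : 'I_4.-1)), w (snd_pos (inord 0 : 'I_4.-1))).

Definition right_pair (w : W4) : 'I_N * 'I_N :=
  (w (fst_pos (inord 2 : 'I_4.-1)), w (snd_pos (inord 2 : 'I_4.-1))).

Definition winc2 (x : U * U) (w : W4) : K :=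
  wvec q x.1 (left_pair w) * wvec q x.2 (right_pair w).

Lemma left_pair_put2 (w : W4) u :
  (left_pair (put2 (inord 0 : 'I_4.-1) w u) = u) *
  (left_pair (put2 (inord 2 : 'I_4.-1) w u) = left_pair w).
Proof.
split; first by rewrite /left_pair put2_fst put2_snd; case: u.
by rewrite /left_pair !ffunE -!val_eqE /= !inordK.
Qed.

Lemma right_pair_put2 (w : W4) u :
  (right_pair (put2 (inord 2 : 'I_4.-1) w u) = u) *
  (right_pair (put2 (inord 0 : 'I_4.-1) w u) = right_pair w).
Proof.
split; first by rewrite /right_pair put2_fst put2_snd; case: u.
by rewrite /right_pair !ffunE -!val_eqE /= !inordK.
Qed.

Lemma cat4E (w : W4) : w = cat4 (left_pair w) (right_pair w).
Proof.
by apply/ffunP => -[[|[|[|[|]]]]] //= j; rewrite ffunE (tnth_nth (w ord0)) /=;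
  congr (w _); apply/val_inj; rewrite /= ?inordK.
Qed.

Lemma left_pair_cat4 u v : left_pair (cat4 u v : W4) = u.
Proof.
case: u => a b; rewrite /left_pair !ffunE !(tnth_nth a) /=.
by rewrite !inordK.
Qed.

Lemma right_pair_cat4 u v : right_pair (cat4 u v : W4) = v.
Proof.
case: v => a b; rewrite /right_pair !ffunE !(tnth_nth a) /=.
by rewrite !inordK.
Qed.

Lemma winc2_eigen x w :
  (act (T4 (inord 0)) (winc2 x) w = - (l / q) * winc2 x w) *
  (act (T4 (inord 2)) (winc2 x) w = - (l / q) * winc2 x w).
Proof.
split; apply: (vbraid_qalt q_neq0 l_neq0 qV_neq _ _).2 => {}w; split=> [a|a b ab].
- by rewrite /winc2 left_pair_put2 (wvec_qalt _ _).1 mul0r.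
- by rewrite /winc2 !left_pair_put2 !right_pair_put2 (wvec_qalt _ _).2// mulrA.
- by rewrite /winc2 right_pair_put2 (wvec_qalt _ _).1 mulr0.
- rewrite /winc2 !left_pair_put2 !right_pair_put2 (wvec_qalt _ _).2//.
  by rewrite mulrCA.
Qed.

(** As [fbraid] exchanges the crossings inside the two pairs, the image G stays q-antisymmetric in
    both. It is then recovered from its values on increasing pairs, which are the entries of
    [wbraid]. *)
Lemma act_fbraid x w :
  act (fbraid N l q) (winc2 x) w = \sum_u wbraid l q u x * winc2 u w.
Proof.
set G := act _ _.
have G0 y : qalt q (fun u => G (put2 (inord 0 : 'I_4.-1) y u)).
  apply: (vbraid_qalt q_neq0 l_neq0 qV_neq _ _).1 => {}y.
  rewrite /G -act_mul fbraid_comm0 act_mul -act_scale.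
  by apply: eq_act => {}y; rewrite winc2_eigen.
have G2 y : qalt q (fun u => G (put2 (inord 2 : 'I_4.-1) y u)).
  apply: (vbraid_qalt q_neq0 l_neq0 qV_neq _ _).1 => {}y.
  rewrite /G -act_mul fbraid_comm2 act_mul -act_scale.
  by apply: eq_act => {}y; rewrite winc2_eigen.
have E0 y : G y = \sum_p G (put2 (inord 0 : 'I_4.-1) y (val p)) *
    wvec q p (left_pair y).
  by rewrite -{1}(put2_id (inord 0 : 'I_4.-1) y) (qalt_expand _ (G0 y)).
have E2 y : G y = \sum_p G (put2 (inord 2 : 'I_4.-1) y (val p)) *
    wvec q p (right_pair y).
  by rewrite -{1}(put2_id (inord 2 : 'I_4.-1) y) (qalt_expand _ (G2 y)).
rewrite E0; under eq_bigr do rewrite E2 mulr_suml.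
rewrite pair_bigA; apply: eq_bigr => -[p r] _ /=.
rewrite right_pair_put2 -mulrA [wvec q r _ * _]mulrC.
have -> : put2 (inord 2 : 'I_4.-1) (put2 (inord 0 : 'I_4.-1) w (val p)) (val r)
    = cat4 (val p) (val r).
  by rewrite [LHS]cat4E !(left_pair_put2, right_pair_put2).
congr (_ * _); rewrite /G /act /wbraid pair_bigA /=.
rewrite (reindex_onto (fun uv => cat4 uv.1 uv.2) (fun w => (left_pair w, right_pair w))) /=.
  apply: eq_big => [[u v]|[u v] _] /=.
    by rewrite left_pair_cat4 right_pair_cat4 eqxx.
  by rewrite /winc2 left_pair_cat4 right_pair_cat4.
by move=> {}w _; rewrite -cat4E.
Qed.

(* The fused braiding of the factors i and i + 1 of (V (x) V)^k. *)
Definition fbraid_at (k : nat) (i : 'I_k.-1) : Endt K 'I_N k.*2 :=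
  embed (consecutive (double_pos_subproof i)) (fbraid N l q).

Lemma fbraid_winc (k : nat) (i : 'I_k.-1) :
  fbraid_at i *m winc N q k = winc N q k *m local (@wbraid K N l q) i.
Proof.
apply: act_inj => h y; rewrite !act_mul.
rewrite act_embed; last exact: consecutive_inj.
set c := consecutive _.
pose R (x : {ffun 'I_k -> U}) :=
  \prod_(j | (j != fst_pos i) && (j != snd_pos i)) wvec q (x j) (pair_at y j).
have cE z x : \prod_j wvec q ((x : {ffun 'I_k -> U}) j) (pair_at (overwrite c y z) j) =
    winc2 (x (fst_pos i), x (snd_pos i)) z * R x.
  rewrite (bigD1 (fst_pos i)) //= (bigD1 (snd_pos i)) ?fst_snd_neq//= mulrA.
  have c_in (s : 'I_4) (s' : 'I_k.*2) : val s' = (i.*2 + s)%N -> overwrite c y z s' = z s.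
    move=> e; have -> : s' = c s by apply/val_inj.
    by rewrite overwrite_in//; exact: consecutive_inj.
  congr (_ * _ * _).
  - rewrite /winc2 /pair_at /left_pair; congr (wvec _ _ (_, _)); apply: c_in.
      by rewrite /= inordK ?addn0.
    by rewrite /= inordK ?addn1.
  - rewrite /winc2 /pair_at /right_pair; congr (wvec _ _ (_, _)); apply: c_in.
      by rewrite /= inordK ?doubleS ?addn2.
    by rewrite /= inordK ?doubleS ?addn3.
  apply: eq_bigr => j /andP[j1 j2]; congr (wvec _ _ _).
  rewrite /pair_at !overwrite_out //; apply/negP => /codomP[s] /(congr1 val) /=;
    move: j1 j2; rewrite -!val_eqE /=; have := ltn_ord s; lia.
rewrite (eq_act _ (g' := fun z => \sum_(x : {ffun 'I_k -> U})
   (R x * h x) * winc2 (x (fst_pos i), x (snd_pos i)) z)); last first.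
  move=> z; rewrite act_winc; apply: eq_bigr => x _.
  by rewrite cE; ring.
rewrite act_sum act_winc.
under eq_bigr => x _ do rewrite act_scale act_fbraid mulr_sumr.
under [RHS]eq_bigr => x _ do rewrite act_local mulr_sumr.
have yE : overwrite c y (pullback c y) = y.
  apply/esym/eq_overwrite => //; first exact: consecutive_inj.
  by move=> s; rewrite ffunE.
rewrite !pair_bigA /=.
(* [sw] exchanges the letters of x at i and i + 1 with the summation index u. Being an involution,
   it matches the double sums of the two sides. *)
pose sw (xu : {ffun 'I_k -> U} * (U * U)) :=
  (put2 i xu.1 xu.2, (xu.1 (fst_pos i), xu.1 (snd_pos i))).
rewrite (reindex_inj (h := sw)) /=; last first.
  apply: (can_inj (g := sw)) => -[x u]; rewrite /sw /= put2_fst put2_snd put2_put2.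
  by rewrite put2_id -surjective_pairing.
apply: eq_bigr => -[x u] _ /=.
rewrite put2_fst put2_snd -surjective_pairing.
have -> : R (put2 i x u) = R x.
  by apply: eq_bigr => j /andP[/negPf j1 /negPf j2]; rewrite ffunE j1 j2.
by rewrite -[X in pair_at X]yE cE; ring.
Qed.

End Intertwining.

(** * Braid and cubic relations on the powers of the exterior square *)

Lemma pred_double (k : nat) (i : 'I_k.-1) d : (d <= 2)%N -> (i.*2 + d < (k.*2).-1)%N.
Proof. by case: i => i /=; lia. Qed.

(** Crossing number i of the cables involves the elementary crossings 2 i, 2 i + 1 and 2 i + 2,
    counted from 0. *)
Definition strand (k : nat) (i : 'I_k.-1) d (d2 : (d <= 2)%N) : 'I_(k.*2).-1 :=
  Ordinal (pred_double i d2).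

Definition strand0 (k : nat) (i : 'I_k.-1) := @strand k i 0 isT.
Definition strand1 (k : nat) (i : 'I_k.-1) := @strand k i 1 isT.
Definition strand2 (k : nat) (i : 'I_k.-1) := @strand k i 2 isT.

Section WedgeBraiding.
Variables (K : fieldType) (N : nat) (l q : K).
Hypothesis q_neq0 : q != 0.
Hypothesis l_neq0 : l != 0.
Hypothesis qV_neq : q + q^-1 != 0.

Local Notation U := (wedge_index N).
Local Notation T i := (local (@vbraid K N l q) i).
Local Notation rho i := (local (@wbraid K N l q) i).

Lemma fbraid_atE (k : nat) (i : 'I_k.-1) (j0 j1 j2 : 'I_(k.*2).-1) :
    j0 = i.*2 :> nat -> j1 = i.*2.+1 :> nat -> j2 = i.*2.+2 :> nat ->
  fbraid_at N l q i = T j1 *m (T j0 *m (T j2 *m T j1)).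
Proof.
move=> e0 e1 e2; rewrite /fbraid_at /fbraid -!mulmxA.
have ci := @consecutive_inj 4 k.*2 i.*2 (double_pos_subproof i).
rewrite !(embedM ci).
have E (s : 'I_4.-1) (j : 'I_(k.*2).-1) : (i.*2 + s)%N = j ->
    embed (consecutive (double_pos_subproof i)) (local (@vbraid K N l q) s) = T j.
  exact: embed_consecutive.
have p0 : (i.*2 + (inord 0 : 'I_4.-1))%N = j0 by rewrite e0 inordK ?addn0.
have p1 : (i.*2 + (inord 1 : 'I_4.-1))%N = j1 by rewrite e1 inordK ?addn1.
have p2 : (i.*2 + (inord 2 : 'I_4.-1))%N = j2 by rewrite e2 inordK ?addn2.
by rewrite (E _ _ p0) (E _ _ p1) (E _ _ p2).
Qed.

Section Strand.
Variables (k : nat).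
Local Notation V := 'M[K]_(#|{ffun 'I_k.*2 -> 'I_N}|, #|{ffun 'I_k -> U}|).
Implicit Types x : V.

Lemma mul_vbraid_braid (i j : 'I_(k.*2).-1) x : i.+1 = j ->
  T i *m (T j *m (T i *m x)) = T j *m (T i *m (T j *m x)).
Proof.
move=> ij; have := @vbraid_braid K N l q q_neq0 _ _ _ ij.
by move=> /(congr1 (mulmx^~ x)); rewrite -!mulmxA.
Qed.

Lemma mul_vbraid_far (i j : 'I_(k.*2).-1) x : (i.+1 < j)%N ->
  T i *m (T j *m x) = T j *m (T i *m x).
Proof. by move=> ij; rewrite !mulmxA local_far. Qed.

Lemma mul_vbraid_hecke (i : 'I_(k.*2).-1) x :
  T i *m (T i *m x) =
  (l * q + - (l / q)) *: (T i *m x) - (l * q * - (l / q)) *: x.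
Proof.
rewrite mulmxA vbraid_hecke// mulmxDl -scalemxAl mul_scalar_mx -scaleNr.
by congr (_ *: _ + _ *: _); field.
Qed.

Lemma fused_fbraid (i : 'I_k.-1) x :
  fused (mulmx (T (strand0 i))) (mulmx (T (strand1 i))) (mulmx (T (strand2 i))) x
  = fbraid_at N l q i *m x.
Proof.
rewrite (@fbraid_atE k i (strand0 i) (strand1 i) (strand2 i)) /= ?addn0
  ?addn1 ?addn2 //.
by rewrite /fused /= -!mulmxA.
Qed.

Lemma strand0_winc (i : 'I_k.-1) :
  T (strand0 i) *m winc N q k = - (l / q) *: winc N q k.
Proof.
rewrite -(vbraid_winc N q_neq0 l_neq0 qV_neq (fst_pos i)).
by congr (local _ _ *m _); apply/val_inj; rewrite /= addn0.
Qed.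

Lemma strand2_winc (i : 'I_k.-1) :
  T (strand2 i) *m winc N q k = - (l / q) *: winc N q k.
Proof.
rewrite -(vbraid_winc N q_neq0 l_neq0 qV_neq (snd_pos i)).
by congr (local _ _ *m _); apply/val_inj; rewrite /= addn2.
Qed.

Lemma wbraid_braid (i j : 'I_k.-1) : i.+1 = j ->
  rho i *m (rho j *m rho i) = rho j *m (rho i *m rho j).
Proof.
move=> ij; apply: (@winc_inj K N q k).
rewrite !mulmxA -!fbraid_winc// -!(mulmxA (fbraid_at _ _ _ _)) -!fbraid_winc//.
rewrite -!(mulmxA (fbraid_at _ _ _ _)) -!fbraid_winc//.
(* Neighbouring cable crossings share the elementary crossing inside the middle cable, so five
   elementary crossings occur in all. *)
have e0 : strand2 i = strand0 j by apply/val_inj; rewrite /= -ij; lia.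
rewrite -!fused_fbraid.
rewrite -[fused (mulmx (T (strand0 j))) _ _ _]/(fused' _ _ _ _).
rewrite -e0; apply: fused_braid => x /=;
  by [apply: mul_vbraid_braid; rewrite /= -?ij; lia
     |apply: mul_vbraid_far; rewrite /= -?ij; lia].
Qed.

Let hecke i (x : V) : 
  [/\ T (strand0 i) *m (T (strand0 i) *m x) =
      (l * q + - (l / q)) *: (T (strand0 i) *m x) - (l * q * - (l / q)) *: x,
      T (strand1 i) *m (T (strand1 i) *m x) =
      (l * q + - (l / q)) *: (T (strand1 i) *m x) - (l * q * - (l / q)) *: x
    & T (strand2 i) *m (T (strand2 i) *m x) =
      (l * q + - (l / q)) *: (T (strand2 i) *m x) - (l * q * - (l / q)) *: x].
Proof. by split; exact: mul_vbraid_hecke. Qed.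

Let b01 i (x : V) : T (strand0 i) *m (T (strand1 i) *m (T (strand0 i) *m x)) =
  T (strand1 i) *m (T (strand0 i) *m (T (strand1 i) *m x)).
Proof. by apply: mul_vbraid_braid; rewrite /= addn0 addn1. Qed.

Let b12 i (x : V) : T (strand1 i) *m (T (strand2 i) *m (T (strand1 i) *m x)) =
  T (strand2 i) *m (T (strand1 i) *m (T (strand2 i) *m x)).
Proof. by apply: mul_vbraid_braid; rewrite /= addn1 addn2. Qed.

Let c02 i (x : V) : T (strand0 i) *m (T (strand2 i) *m x) =
  T (strand2 i) *m (T (strand0 i) *m x).
Proof. by apply: mul_vbraid_far; rewrite /= addn0 addn2. Qed.

Lemma wbraid_cubic (i : 'I_k.-1) :
  (rho i - (- l ^+ 4)%:M) *m (rho i - (l ^+ 4 * q ^+ 2)%:M)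
    *m (rho i - (l ^+ 4 / q ^+ 4)%:M) = 0.
Proof.
have W3 : winc N q k *m (rho i *m (rho i *m rho i)) =
    fbraid_at N l q i *m (fbraid_at N l q i *m (fbraid_at N l q i *m winc N q k)).
  by rewrite !mulmxA -fbraid_winc// -!(mulmxA (fbraid_at _ _ _ _)) -fbraid_winc//
    -!(mulmxA (fbraid_at _ _ _ _)) -fbraid_winc.
have W2 : winc N q k *m (rho i *m rho i) =
    fbraid_at N l q i *m (fbraid_at N l q i *m winc N q k).
  by rewrite !mulmxA -fbraid_winc// -!(mulmxA (fbraid_at _ _ _ _)) -fbraid_winc.
have := fused_cubic (t1 := mulmx (T (strand0 i))) (t2 := mulmx (T (strand1 i)))
  (t3 := mulmx (T (strand2 i))) (@b01 i) (@b12 i) (@c02 i) (@hecke i)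
  (strand0_winc i) (strand2_winc i).
rewrite !fused_fbraid -W3 -W2 fbraid_winc// => /= E.
apply: (@winc_inj K N q k); rewrite mulmx0.
set e1 := (X in _ = X *: _ - _ + _) in E; set e2 := (X in _ - X *: _ + _) in E.
set e3 := (X in _ + X *: winc _ _ _) in E.
have -> : (rho i - (- l ^+ 4)%:M) *m (rho i - (l ^+ 4 * q ^+ 2)%:M)
    *m (rho i - (l ^+ 4 / q ^+ 4)%:M) =
    rho i *m (rho i *m rho i) - e1 *: (rho i *m rho i) + e2 *: rho i - e3%:M.
  rewrite !(mulmxBl, mulmxBr) !(mul_scalar_mx, mul_mx_scalar).
  rewrite -?scalemxAl ?(mul_scalar_mx, mul_mx_scalar) -?mulmxA.
  rewrite /e1 /e2 /e3; move: (rho i) => r.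
  by apply/matrixP => s s'; rewrite !mxE; set b := (s == s'); case: b; rewrite ?mulr1n ?mulr0n; field.
rewrite !(mulmxDr, mulmxBr, mulmxN) -!scalemxAr mul_mx_scalar E.
by apply/matrixP => s s'; rewrite !mxE; ring.
Qed.

(** Here al and be are opposite, and every term of [fused_sqr] but the first has the factor al +
    be. *)
Lemma wbraid_involutive (i : 'I_k.-1) :
  l = 1 -> q = 1 -> rho i *m rho i = 1%:M.
Proof.
move=> l1 q1; apply: (@winc_inj K N q k).
rewrite !mulmxA -fbraid_winc// -!(mulmxA (fbraid_at _ _ _ _)) -fbraid_winc//.
have := fused_sqr (t1 := mulmx (T (strand0 i))) (t2 := mulmx (T (strand1 i)))
  (t3 := mulmx (T (strand2 i))) (@b01 i) (@b12 i) (@c02 i) (@hecke i)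
  (strand0_winc i) (strand2_winc i).
rewrite !fused_fbraid => ->; rewrite l1 q1 mulmx1 invr1.
by apply/matrixP => s s'; rewrite !mxE; ring.
Qed.

End Strand.

End WedgeBraiding.

(** * The cubic Hecke algebra on three strands *)

Section CubicSpan.
Variables (K : fieldType) (X : Type) (rel : set (ncpoly K X)).
Local Notation A := (palg rel).
Variables (s s' t t' : A) (e1 e2 e3 : K).
Hypothesis e3_neq0 : e3 != 0.
Hypotheses (ss' : s * s' = 1) (s's : s' * s = 1).
Hypotheses (tt' : t * t' = 1) (t't : t' * t = 1).
Hypothesis sts : s * t * s = t * s * t.
Hypothesis s2 : s * s = e1 *: s - e2 *: (1 : A) + e3 *: s'.

Let scaleAl (a : K) (x y : A) : (a *: x) * y = a *: (x * y).
Proof. by rewrite palg_scalerAl. Qed.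

Let scaleAr (a : K) (x y : A) : x * (a *: y) = a *: (x * y).
Proof. by rewrite palg_scalerAr. Qed.

Let sV : s' = e3^-1 *: (s * s - (e1 *: s - e2 *: (1 : A))).
Proof. by rewrite s2 addrC addKr scalerA mulVf// scale1r. Qed.

Let conj_quadratic (g g' : A) : g * g' = 1 -> g' * g = 1 -> t = g * s * g' ->
  t * t = e1 *: t - e2 *: (1 : A) + e3 *: t'.
Proof.
move=> gg' g'g tE.
have t'E : t' = g * s' * g'.
  have : t * (g * s' * g') = 1.
    by rewrite tE -!mulrA (mulrA g') g'g mul1r (mulrA s) ss' mul1r.
  by move=> /(congr1 ( *%R t')); rewrite mulrA t't mul1r mulr1.
have -> : t * t = g * (s * s) * g'.
  by rewrite tE -!mulrA (mulrA g') g'g mul1r.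
rewrite s2 mulrDr mulrBr mulrDl mulrBl !scaleAr !scaleAl mulr1 gg'.
by rewrite -tE -t'E.
Qed.

(* t is conjugate to s. *)
Let t2 : t * t = e1 *: t - e2 *: (1 : A) + e3 *: t'.
Proof.
apply: (@conj_quadratic (s * t) (t' * s')).
- by rewrite mulrA -(mulrA s) tt' mulr1.
- by rewrite mulrA -(mulrA t') s's mulr1.
- by rewrite sts !mulrA -(mulrA (t * s)) tt' mulr1 -mulrA ss' mulr1.
Qed.

Let tV : t' = e3^-1 *: (t * t - (e1 *: t - e2 *: (1 : A))).
Proof. by rewrite t2 addrC addKr scalerA mulVf// scale1r. Qed.

Let tst' : t * s * t' = s' * t * s.
Proof.
by rewrite -[LHS]mul1r -s's -!mulrA (mulrA s t) (mulrA (s * t)) sts -!mulrA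
  tt' mulr1.
Qed.

Let t'st : t' * s * t = s * t * s'.
Proof.
have -> : t' * s * t = t' * (s * t * s) * s'.
  by rewrite -!mulrA ss' mulr1.
by rewrite sts !mulrA t't mul1r.
Qed.

Let ts't' : t * s' * t' = s' * t' * s.
Proof.
have e : (t * s' * t') * (s' * t * s) = 1.
  by rewrite -tst' !mulrA -(mulrA (t * s')) t't mulr1 -(mulrA t) s's mulr1.
have e' : (s' * t * s) * (s' * t' * s) = 1.
  by rewrite !mulrA -(mulrA (s' * t)) ss' mulr1 -(mulrA s') tt' mulr1.
by rewrite -[LHS]mulr1 -e' mulrA e mul1r.
Qed.

Let t's't : t' * s' * t = s * t' * s'.
Proof.
have e : (t' * s' * t) * (s * t * s') = 1.
  by rewrite -t'st !mulrA -(mulrA (t' * s')) tt' mulr1 -(mulrA t') s's mulr1.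
have e' : (s * t * s') * (s * t' * s') = 1.
  by rewrite !mulrA -(mulrA (s * t)) s's mulr1 -(mulrA s) tt' mulr1.
by rewrite -[LHS]mulr1 -e' mulrA e mul1r.
Qed.

Definition small_power (i : 'I_3) : A :=
  match val i with 0%N => 1 | 1%N => s | _ => s' end.

Definition span_index : finType := ('I_3 + 'I_3 * 'I_3 + 'I_3 * 'I_3 + 'I_3)%type.

(** With u the span of 1, s, s', these words span u + u t u + u t' u + u t s' t, which accounts for
    3 + 9 + 9 + 3 = 24 words. *)
Definition spanning (i : span_index) : A :=
  match i with
  | inl (inl (inl i)) => small_power i
  | inl (inl (inr ij)) => small_power ij.1 * (t * small_power ij.2)
  | inl (inr ij) => small_power ij.1 * (t' * small_power ij.2)
  | inr i => small_power i * (t * (s' * t))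
  end.

Inductive spanned : A -> Prop :=
| spanned0 : spanned 0
| spannedD x y : spanned x -> spanned y -> spanned (x + y)
| spannedZ a x : spanned x -> spanned (a *: x)
| spanned_word i : spanned (spanning i).

Lemma spanned_sum x : spanned x ->
  exists c : span_index -> K, x = \sum_i c i *: spanning i.
Proof.
elim=> {x} [|x y _ [c ->] _ [d ->]|a x _ [c ->]|i].
- by exists (fun=> 0); rewrite big1// => i _; rewrite scale0r.
- exists (fun i => c i + d i); rewrite -big_split; apply: eq_bigr => i _.
  by rewrite scalerDl.
- exists (fun i => a * c i); rewrite scaler_sumr; apply: eq_bigr => i _.
  by rewrite scalerA.
exists (fun j => (j == i)%:R); rewrite (bigD1 i)//= eqxx scale1r big1 ?addr0//.
by move=> j /negPf ->; rewrite scale0r.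
Qed.

Lemma spannedB x y : spanned x -> spanned y -> spanned (x - y).
Proof. by move=> xX yX; rewrite -scaleN1r; apply/spannedD/spannedZ. Qed.

(** Among four consecutive powers of s inserted between x and y, from s' to s s, the two extreme
    ones determine each other modulo the middle ones. The next three lemmas are variants of this. *)
Let insert_s2 x y :
  spanned (x * (s * y)) -> spanned (x * y) -> spanned (x * (s' * y)) ->
  spanned (x * (s * (s * y))).
Proof.
move=> h1 h0 hV; rewrite (mulrA s) s2 mulrDl mulrBl !scaleAl mul1r.
rewrite mulrDr mulrBr !scaleAr.
by apply: spannedD; [apply: spannedB|]; exact: spannedZ.
Qed.

Let insert_sV x y :
  spanned (x * (s * y)) -> spanned (x * y) -> spanned (x * (s * (s * y))) ->
  spanned (x * (s' * y)).
Proof.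
move=> h1 h0 h2; rewrite sV scaleAl scaleAr; apply: spannedZ.
rewrite !mulrBl !scaleAl mul1r -(mulrA s) !mulrBr !scaleAr.
by apply: spannedB => //; apply: spannedB; exact: spannedZ.
Qed.

Let insert_t2 x y :
  spanned (x * (t * y)) -> spanned (x * y) -> spanned (x * (t' * y)) ->
  spanned (x * (t * (t * y))).
Proof.
move=> h1 h0 hV; rewrite (mulrA t) t2 mulrDl mulrBl !scaleAl mul1r.
rewrite mulrDr mulrBr !scaleAr.
by apply: spannedD; [apply: spannedB|]; exact: spannedZ.
Qed.

Let insert_tV x y :
  spanned (x * (t * y)) -> spanned (x * y) -> spanned (x * (t * (t * y))) ->
  spanned (x * (t' * y)).
Proof.
move=> h1 h0 h2; rewrite tV scaleAl scaleAr; apply: spannedZ.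
rewrite !mulrBl !scaleAl mul1r -(mulrA t) !mulrBr !scaleAr.
by apply: spannedB => //; apply: spannedB; exact: spannedZ.
Qed.

Let ind3 (P : 'I_3 -> Prop) :
  P (inord 0) -> P (inord 1) -> P (inord 2) -> forall i, P i.
Proof.
by move=> P0 P1 P2 [[|[|[|]]]] //= j; [move: P0|move: P1|move: P2];
  congr P; apply/val_inj; rewrite /= inordK.
Qed.

Let eE : (small_power (inord 0) = 1) * (small_power (inord 1) = s) * (small_power (inord 2) = s').
Proof. by rewrite /small_power /= !inordK. Qed.

Let mul_s_e m : (forall i, spanned (small_power i * m)) -> forall i, spanned (s * (small_power i * m)).
Proof.
move=> em; have := em (inord 0); have := em (inord 1); have := em (inord 2).
rewrite !eE mul1r => m2 m1 m0; apply: ind3; rewrite !eE.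
- by rewrite mul1r.
- by have := @insert_s2 1 m; rewrite !mul1r; apply.
- by rewrite mulrA ss' mul1r.
Qed.

Let spanned_s x : spanned x -> spanned (s * x).
Proof.
elim=> {x} [|x y _ xX _ yX|a x _ xX|].
- by rewrite mulr0; exact: spanned0.
- by rewrite mulrDr; exact: spannedD.
- by rewrite scaleAr; exact: spannedZ.
move=> [[[i|[i j]]|[i j]]|i] /=; last first.
- by apply: mul_s_e => {}i; exact: (spanned_word (inr i)).
- by apply: mul_s_e => {}i; exact: (spanned_word (inl (inr (i, j)))).
- by apply: mul_s_e => {}i; exact: (spanned_word (inl (inl (inr (i, j))))).
rewrite -[small_power i]mulr1; apply: mul_s_e => {}i.
by rewrite mulr1; exact: (spanned_word (inl (inl (inl i)))).
Qed.

Let spanned_s' x : spanned x -> spanned (s' * x).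
Proof.
move=> xX; have := @insert_sV 1 x; rewrite !mul1r; apply=> //.
  exact: spanned_s.
exact/spanned_s/spanned_s.
Qed.

Let spanned_e x i : spanned x -> spanned (small_power i * x).
Proof.
move=> xX; move: i; apply: ind3; rewrite !eE ?mul1r //.
  exact: spanned_s.
exact: spanned_s'.
Qed.

Let spanned_u i : spanned (small_power i).
Proof. exact: (spanned_word (inl (inl (inl i)))). Qed.

Let spanned_te i : spanned (t * small_power i).
Proof.
have := spanned_word (inl (inl (inr (inord 0, i)))).
by rewrite /= eE mul1r.
Qed.

Let spanned_t'e i : spanned (t' * small_power i).
Proof.
have := spanned_word (inl (inr (inord 0, i))).
by rewrite /= eE mul1r.
Qed.

Let spanned1 : spanned 1.
Proof. by have := spanned_u (inord 0); rewrite eE. Qed.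

Let spanned_t : spanned t.
Proof. by have := spanned_te (inord 0); rewrite eE mulr1. Qed.

Let spanned_t' : spanned t'.
Proof. by have := spanned_t'e (inord 0); rewrite eE mulr1. Qed.

Let spanned_ts't : spanned (t * (s' * t)).
Proof. by have := spanned_word (inr (inord 0)); rewrite /= eE mul1r. Qed.

Let s_e m : (forall i, spanned (m * small_power i)) -> forall i, spanned (m * (small_power i * s)).
Proof.
move=> em; have := em (inord 0); have := em (inord 1); have := em (inord 2).
rewrite !eE mulr1 => m2 m1 m0; apply: ind3; rewrite !eE.
- by rewrite mul1r.
- by have := @insert_s2 m 1; rewrite !mulr1; apply.
- by rewrite s's mulr1.
Qed.

Let tst : t * (s * t) = s * (t * s).
Proof. by rewrite !mulrA. Qed.

Let tstx x : t * (s * (t * x)) = s * (t * (s * x)).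
Proof. by rewrite !mulrA sts. Qed.

Let spanned_tst : spanned (t * (s * t)).
Proof.
by rewrite tst; apply: spanned_s; have := spanned_te (inord 1); rewrite eE.
Qed.

Let spanned_tt : spanned (t * t).
Proof.
by have := @insert_t2 1 1; rewrite !mul1r !mulr1; apply.
Qed.

Let spanned_tte i : spanned (t * (t * small_power i)).
Proof.
have := @insert_t2 1 (small_power i); rewrite !mul1r; apply.
- exact: spanned_te.
- exact: spanned_u.
- exact: spanned_t'e.
Qed.

Let spanned_ts't_s : spanned (t * (s' * (t * s))).
Proof.
apply: insert_sV.
- rewrite tstx; apply: spanned_s.
  by have := s_e spanned_te (inord 1); rewrite eE.
- by have := spanned_tte (inord 1); rewrite eE.
have -> : t * (s * (s * (t * s))) = s * (t * (s * (s * t))).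
  by rewrite -[s * (t * s)]tst tstx.
apply: spanned_s; apply: insert_s2.
- exact: spanned_tst.
- exact: spanned_tt.
- exact: spanned_ts't.
Qed.

(** Stability on the right is needed as well: the reductions of words starting with t leave letters
    s at their right end. *)
Let spanned_mul_s x : spanned x -> spanned (x * s).
Proof.
elim=> {x} [|x y _ xX _ yX|a x _ xX|].
- by rewrite mul0r; exact: spanned0.
- by rewrite mulrDl; exact: spannedD.
- by rewrite scaleAl; exact: spannedZ.
move=> [[[i|[i j]]|[i j]]|i] /=; rewrite -?mulrA.
- by rewrite -[small_power i * s]mul1r; apply: s_e => j; rewrite mul1r.
- by apply: spanned_e; apply: s_e => {}j; exact: spanned_te.
- by apply: spanned_e; apply: s_e => {}j; exact: spanned_t'e.
- exact: spanned_e.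
Qed.

Let spanned_tut i : spanned (t * (small_power i * t)).
Proof. by move: i; apply: ind3; rewrite !eE ?mul1r. Qed.

Let spanned_mul_s' x : spanned x -> spanned (x * s').
Proof.
move=> xX; have := @insert_sV x 1; rewrite !mulr1; apply=> //.
  exact: spanned_mul_s.
by rewrite mulrA; apply/spanned_mul_s/spanned_mul_s.
Qed.

Let spanned_mul_e x i : spanned x -> spanned (x * small_power i).
Proof.
move=> xX; move: i; apply: ind3; rewrite !eE ?mulr1 //.
  exact: spanned_mul_s.
exact: spanned_mul_s'.
Qed.

Let spanned_tss_t : spanned (t * (s * (s * t))).
Proof. exact: insert_s2. Qed.

Let spanned_tsss_t : spanned (t * (s * (s * (s * t)))).
Proof.
have := @insert_s2 t (s * t); apply=> //.
by rewrite (mulrA s') s's mul1r; exact: spanned_tt.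
Qed.

Let spanned_t's't : spanned (t' * (s' * t)).
Proof. by rewrite mulrA t's't -mulrA; apply/spanned_s/spanned_mul_s'. Qed.

Let spanned_t'st : spanned (t' * (s * t)).
Proof. by rewrite mulrA t'st -mulrA; apply/spanned_s/spanned_mul_s'. Qed.

Let tssts x : t * (s * (s * (t * (s * x)))) = s * (t * (s * (s * (t * x)))).
Proof. by rewrite -tstx tstx. Qed.

(** The hard word. Both letters s' are traded for non-negative powers of s by the cubic relation,
    after which the braid relation pushes letters s to the two ends. *)
Let spanned_ts'ts't : spanned (t * (s' * (t * (s' * t)))).
Proof.
have := @insert_sV (t * (s' * t)) t; rewrite -!mulrA; apply.
- by rewrite tst (mulrA s') s's mul1r mulrA; apply: spanned_mul_s.
- have := @insert_t2 (t * s') 1; rewrite !mulr1 -!mulrA; apply=> //.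
    by have := spanned_te (inord 2); rewrite eE.
  by rewrite mulrA ts't' -mulrA; apply/spanned_s'/spanned_mul_s.
apply: insert_sV.
- by rewrite tstx; apply: spanned_s.
- have := @insert_t2 1 (s * (s * t)); rewrite !mul1r; apply=> //.
    exact/spanned_s/spanned_s.
  by apply: insert_s2 => //; rewrite t't.
by rewrite tssts tst !mulrA; apply: spanned_mul_s; rewrite -!mulrA;
  apply: spanned_s.
Qed.

Lemma spanned_mul_t x : spanned x -> spanned (t * x).
Proof.
elim=> {x} [|x y _ xX _ yX|a x _ xX|].
- by rewrite mulr0; exact: spanned0.
- by rewrite mulrDr; exact: spannedD.
- by rewrite scaleAr; exact: spannedZ.
move=> [[[i|[i j]]|[i j]]|i] /=.
- exact: spanned_te.
- rewrite !mulrA; apply: spanned_mul_e; rewrite -mulrA.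
  exact: spanned_tut.
- rewrite !mulrA; apply: spanned_mul_e; move: i; apply: ind3; rewrite !eE.
  + by rewrite mulr1 tt'.
  + by rewrite tst' -mulrA; apply/spanned_s'/spanned_mul_s.
  + by rewrite ts't' -mulrA; apply/spanned_s'/spanned_mul_s.
- move: i; apply: ind3; rewrite !eE ?mul1r.
  + have := @insert_t2 1 (s' * t); rewrite !mul1r; apply=> //.
    exact: spanned_s'.
  + rewrite tstx (mulrA s s') ss' mul1r; exact: spanned_s.
  + exact: spanned_ts'ts't.
Qed.

Lemma spanned_closed x : spanned x ->
  [/\ spanned (s * x), spanned (s' * x), spanned (t * x) & spanned (t' * x)].
Proof.
move=> xX; split; [exact: spanned_s|exact: spanned_s'|exact: spanned_mul_t|].
have := @insert_tV 1 x; rewrite !mul1r; apply=> //; first exact: spanned_mul_t.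
exact/spanned_mul_t/spanned_mul_t.
Qed.

Lemma spanned_one : spanned 1.
Proof. exact: spanned1. Qed.

End CubicSpan.

Lemma card_span_index : #|{: span_index}| = 24.
Proof. by rewrite !card_sum !card_prod !card_ord. Qed.

(** * Matrices of size two *)

Section Mx2.
Variable K : fieldType.

Lemma det_mx2 (M : 'M[K]_2) :
  \det M = M ord0 ord0 * M ord_max ord_max - M ord0 ord_max * M ord_max ord0.
Proof.
rewrite (expand_det_row _ ord0) !big_ord_recl big_ord0 addr0 /cofactor.
rewrite !det_mx11 !mxE /= /bump /= !addn0 expr0 expr1 mul1r mulN1r mulrN.
by congr (_ * M _ _ - M _ _ * M _ _); apply/val_inj.
Qed.

Lemma big_ord2 (V : nmodType) (F : 'I_2 -> V) :
  \sum_i F i = F ord0 + F ord_max.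
Proof.
rewrite !big_ord_recl big_ord0 addr0; congr (_ + F _).
exact/val_inj.
Qed.

Lemma ord2_cases (P : 'I_2 -> Prop) : P ord0 -> P ord_max -> forall i, P i.
Proof.
move=> P0 P1 [[|[|//]]] i; [move: P0|move: P1]; congr P; exact/val_inj.
Qed.

Lemma mx2_sqr (M : 'M[K]_2) : M *m M = \tr M *: M - (\det M)%:M.
Proof.
rewrite det_mx2 /mxtrace big_ord2; apply/matrixP.
by apply: ord2_cases; apply: ord2_cases; rewrite !mxE big_ord2 /=; ring.
Qed.

Definition mat2 (x y z w : K) : 'M[K]_2 :=
  \matrix_(i, j) if i == ord0 then if j == ord0 then x else y
                 else if j == ord0 then z else w.

Lemma mat2E (M : 'M[K]_2) :
  M = mat2 (M ord0 ord0) (M ord0 ord_max) (M ord_max ord0) (M ord_max ord_max).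
Proof. by apply/matrixP; apply: ord2_cases; apply: ord2_cases; rewrite !mxE. Qed.

Lemma mat2M x y z w x' y' z' w' :
  mat2 x y z w *m mat2 x' y' z' w' =
  mat2 (x * x' + y * z') (x * y' + y * w') (z * x' + w * z') (z * y' + w * w').
Proof.
by apply/matrixP; apply: ord2_cases; apply: ord2_cases; rewrite !mxE big_ord2 !mxE.
Qed.

Lemma mat2D x y z w x' y' z' w' :
  mat2 x y z w + mat2 x' y' z' w' = mat2 (x + x') (y + y') (z + z') (w + w').
Proof. by apply/matrixP; apply: ord2_cases; apply: ord2_cases; rewrite !mxE. Qed.

Lemma mat2Z a x y z w : a *: mat2 x y z w = mat2 (a * x) (a * y) (a * z) (a * w).
Proof. by apply/matrixP; apply: ord2_cases; apply: ord2_cases; rewrite !mxE. Qed.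

Lemma scalar_mat2 a : a%:M = mat2 a 0 0 a.
Proof. by apply/matrixP; apply: ord2_cases; apply: ord2_cases; rewrite !mxE. Qed.

End Mx2.

(** * The full twist of H_3 and its action on U_(b,c) *)

Section H3.
Variables (K : fieldType) (a b c : K).
Hypotheses (b_neq0 : b != 0) (c_neq0 : c != 0).

Local Notation H := (Halg a b c 3).
Local Notation cl := (cls (@H_relator K a b c 3)).

Definition h_s : H := cl (@sg K 3 ord0).
Definition h_s' : H := cl (@sgV K 3 ord0).
Definition h_t : H := cl (@sg K 3 ord_max).
Definition h_t' : H := cl (@sgV K 3 ord_max).

Let ss' : h_s * h_s' = 1.
Proof.
apply/eqP; rewrite -subr_eq0 -cls_mul -cls_sub; apply/eqP/cls_rel.
exact/H_braid/braid_invr.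
Qed.

Let s's : h_s' * h_s = 1.
Proof.
apply/eqP; rewrite -subr_eq0 -cls_mul -cls_sub; apply/eqP/cls_rel.
exact/H_braid/braid_invl.
Qed.

Let tt' : h_t * h_t' = 1.
Proof.
apply/eqP; rewrite -subr_eq0 -cls_mul -cls_sub; apply/eqP/cls_rel.
exact/H_braid/braid_invr.
Qed.

Let t't : h_t' * h_t = 1.
Proof.
apply/eqP; rewrite -subr_eq0 -cls_mul -cls_sub; apply/eqP/cls_rel.
exact/H_braid/braid_invl.
Qed.

Let sts : h_s * h_t * h_s = h_t * h_s * h_t.
Proof.
have -> : h_s * h_t * h_s = cl (Mul (@sg K 3 ord0) (Mul (@sg K 3 ord_max) (@sg K 3 ord0))).
  by rewrite !cls_mul mulrA.
have -> : h_t * h_s * h_t = cl (Mul (@sg K 3 ord_max) (Mul (@sg K 3 ord0) (@sg K 3 ord_max))).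
  by rewrite !cls_mul mulrA.
apply/eqP; rewrite -subr_eq0 -cls_sub; apply/eqP/cls_rel/H_braid.
exact: braid_near.
Qed.

Lemma H3_ind (P : H -> Prop) :
    P 1 -> (forall x y, P x -> P y -> P (x + y)) -> (forall d x, P x -> P (d *: x)) ->
    (forall x y, P x -> P y -> P (x * y)) ->
    P h_s -> P h_s' -> P h_t -> P h_t' ->
  forall x, P x.
Proof.
move=> P1 PD PZ PM Ps Ps' Pt Pt' x; have [u ->] := cls_surj x; elim: u.
- case=> [[[|[|i]] lti] []] //; [move: Ps'|move: Ps|move: Pt'|move: Pt]; congr (P (cl (Gen (_, _)))); exact/val_inj.
- by move=> d; rewrite cls_cst; exact: PZ.
- by move=> u Pu v Pv; rewrite cls_add; exact: PD.
- by move=> u Pu v Pv; rewrite cls_mul; exact: PM.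
Qed.

Let s_cubic : (h_s - a *: (1 : H)) * (h_s - b *: (1 : H)) * (h_s - c *: (1 : H)) = 0.
Proof.
have := @cls_rel K _ (@H_relator K a b c 3) _ (@H_cubic K a b c 3 ord0 erefl).
by rewrite !cls_mul !cls_sub !cls_cst.
Qed.

(* h_twist vanishes on U_(b,c): the full twist acts there by -(bc)^3. *)
Definition h_twist : H :=
  (h_s * h_t * h_s) * (h_s * h_t * h_s) + (b * c) ^+ 3 *: (1 : H).

(** Conjugation by s t s exchanges s and t, so its square commutes with both. *)
Lemma h_twist_central x : h_twist * x = x * h_twist.
Proof.
have ds : h_s * h_t * h_s * h_s = h_t * (h_s * h_t * h_s).
  by rewrite {1}sts !mulrA.
have dt : h_s * h_t * h_s * h_t = h_s * (h_s * h_t * h_s).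
  by rewrite -!mulrA; congr (_ * _); rewrite !mulrA sts.
have cs : h_twist * h_s = h_s * h_twist.
  rewrite mulrDl mulrDr -!palg_scalerAl -!palg_scalerAr mul1r mulr1.
  by congr (_ + _); rewrite -mulrA ds !mulrA dt !mulrA.
have ct : h_twist * h_t = h_t * h_twist.
  rewrite mulrDl mulrDr -!palg_scalerAl -!palg_scalerAr mul1r mulr1.
  by congr (_ + _); rewrite -mulrA dt !mulrA ds !mulrA.
move: x; apply: H3_ind => //.
- by rewrite mulr1 mul1r.
- by move=> x y ex ey; rewrite [LHS]mulrDr [RHS]mulrDl ex ey.
- by move=> d x ex; rewrite -(palg_scalerAl d x) -(palg_scalerAr d _ x) ex.
- by move=> x y ex ey; rewrite mulrA ex -!mulrA ey.
- by rewrite -[RHS]mulr1 -ss' mulrA -(mulrA _ _ h_s) cs !mulrA s's mul1r.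
- by rewrite -[RHS]mulr1 -tt' mulrA -(mulrA _ _ h_t) ct !mulrA t't mul1r.
Qed.

Let mulmxE (x y : 'M[K]_2) : x * y = x *m y. Proof. by []. Qed.

(** Let C be the image of s t s. As det C = (b c)^3, the Cayley-Hamilton identity reduces the claim
    to tr C = 0. Otherwise C would be a combination of 1 and the central C^2, hence commute with A;
    then B = A, and an irreducible representation of dimension two cannot be generated by a single
    matrix with an eigenvalue in K. *)
Lemma Ubc_twist (phi : {rmorphism H -> 'M[K]_2}) :
  is_Ubc phi -> phi h_twist = 0.
Proof.
move=> [phiZ [_ irr] chi].
set A := phi h_s; set B := phi h_t; pose C := A *m B *m A.
have AA' : A *m phi h_s' = 1%:M by rewrite -mulmxE -rmorphM ss' rmorph1.
have BB' : B *m phi h_t' = 1%:M by rewrite -mulmxE -rmorphM tt' rmorph1.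
have ABA : A *m B *m A = B *m A *m B by rewrite -!mulmxE -!rmorphM sts.
have CA : C *m A = B *m C by rewrite /C ABA -!mulmxA [A *m (B *m A)]mulmxA ABA !mulmxA.
have CB : C *m B = A *m C by rewrite /C -!mulmxA [B *m (A *m B)]mulmxA -ABA !mulmxA.
have detA : \det A = b * c.
  have := char_poly_det A; rewrite [char_poly A]chi sqrrN expr1n mul1r => <-.
  by rewrite coefM !big_ord_recl big_ord0 /= !coefB !coefX !coefC /= addr0;
    rewrite !sub0r mulrNN.
have detB : \det B = b * c.
  have := congr1 determinant ABA; rewrite !det_mulmx detA.
  have bc : b * c != 0 by rewrite mulf_neq0.
  move/eqP; rewrite -subr_eq0.
  have nB : \det B != 0.
    by have := congr1 determinant BB'; rewrite det_mulmx det1;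
      apply: contra_eq_neq => ->; rewrite mul0r eq_sym oner_neq0.
  have -> : b * c * \det B * (b * c) - \det B * (b * c) * \det B =
    \det B * (b * c) * (b * c - \det B) by ring.
  by rewrite !mulf_eq0 (negPf nB) (negPf b_neq0) (negPf c_neq0) /= subr_eq0
    => /eqP.
have phit : phi h_twist = C *m C + ((b * c) ^+ 3)%:M.
  by rewrite rmorphD phiZ rmorph1 scalemx1 /C /A /B -!mulmxE -!rmorphM.
rewrite phit mx2_sqr !det_mulmx detA detB.
suff -> : \tr C = 0.
  by rewrite scale0r sub0r -raddfN -raddfD /= !exprS expr0 mulr1 mulrA addNr raddf0.
apply/eqP; apply: contraT => trC.
have C2A : C *m C *m A = A *m (C *m C) by rewrite -mulmxA CA mulmxA CB mulmxA.
have cAC : C *m A = A *m C.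
  move: C2A; rewrite mx2_sqr mulmxBl mulmxBr -scalemxAl -scalemxAr scalar_mxC.
  by move=> /addIr /(scalerI trC).
have AB : A = B.
  have Cu : C \in unitmx.
    by rewrite unitmxE !det_mulmx detA detB unitfE !mulf_neq0.
  have : (B - A) *m C = 0 by rewrite mulmxBl -CA cAC subrr.
  move=> /(congr1 (mulmx^~ (invmx C))); rewrite mulmxK// mul0mx => /eqP.
  by rewrite subr_eq0 => /eqP.
(* Since A = B, all generators act by A or its inverse, and each subspace of eigenvectors is
   stable. *)
have stable (V : 'M[K]_2) (d : K) : d != 0 -> V *m A^T = d *: V ->
    forall x, (V *m (phi x)^T <= V)%MS.
  move=> d0 VA.
  have VA' (Y : 'M[K]_2) : A *m Y = 1%:M -> V *m Y^T = d^-1 *: V.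
    move=> /mulmx1C YA; apply: (scalerI d0).
    rewrite scalerA divff// scale1r scalemxAl -VA -mulmxA -trmx_mul YA.
    by rewrite trmx1 mulmx1.
  apply: H3_ind.
  - by rewrite rmorph1 trmx1 mulmx1 submx_refl.
  - by move=> x y Vx Vy; rewrite rmorphD raddfD mulmxDr addmx_sub.
  - by move=> f x Vx; rewrite phiZ linearZ -scalemxAr scalemx_sub.
  - move=> x y Vx Vy; rewrite rmorphM trmx_mul mulmxA.
    by apply: submx_trans Vx; rewrite submxMr.
  - by rewrite -/A VA scalemx_sub.
  - by rewrite (VA' _ AA') scalemx_sub.
  - by rewrite -/B -AB VA scalemx_sub.
  - by rewrite AB in VA'; rewrite (VA' _ BB') scalemx_sub.
have nE : (A - b%:M)^T \notin unitmx.
  rewrite unitmx_tr unitmxE unitfE negbK.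
  have : eigenvalue A b by rewrite eigenvalue_root_char chi rootM !root_XsubC eqxx.
  rewrite /eigenvalue /eigenspace kermx_eq0 row_free_unit unitmxE unitfE.
  by rewrite negbK.
pose V := eigenspace A^T b.
have VA : V *m A^T = b *: V by apply/eigenspaceP; rewrite submx_refl.
have V0 : \rank V != 0%N.
  rewrite mxrank_eq0 /V /eigenspace kermx_eq0 row_free_unit.
  by move: nE; rewrite raddfB /= tr_scalar_mx.
have [/eqP|rV] := irr V (stable V b b_neq0 VA); first by rewrite (negPf V0).
(* An eigenspace of full rank makes A scalar. Then every line is stable, in particular the one
   encoded by W. *)
have Ab : A^T = b%:M.
  have Vu : V \in unitmx by rewrite -row_free_unit /row_free rV.
  have : V *m A^T = V *m b%:M by rewrite VA mul_mx_scalar.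
  by move=> /(congr1 (mulmx (invmx V))); rewrite !mulKmx.
pose W : 'M[K]_2 := mat2 1 0 0 0.
have WA : W *m A^T = b *: W by rewrite Ab mul_mx_scalar.
have [/eqP|rW] := irr W (stable W b b_neq0 WA).
  rewrite mxrank_eq0 => /eqP /(congr1 (fun M : 'M[K]_2 => M ord0 ord0)) /eqP.
  by rewrite !mxE eqxx oner_eq0.
have : W \in unitmx by rewrite -row_free_unit /row_free rW.
by rewrite unitmxE unitfE det_mx2 !mxE /= mulr0 mul0r subrr eqxx.
Qed.

Lemma h_relations :
  [/\ h_s * h_s' = 1, h_s' * h_s = 1, h_t * h_t' = 1, h_t' * h_t = 1
    & h_s * h_t * h_s = h_t * h_s * h_t].
Proof. by split; [exact: ss'|exact: s's|exact: tt'|exact: t't|exact: sts]. Qed.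

(** The cubic relation multiplied by the inverse of s, in the form assumed for the spanning
    words. *)
Lemma h_s_sqr :
  h_s * h_s = (a + b + c) *: h_s - (a * b + a * c + b * c) *: (1 : H)
              + (a * b * c) *: h_s'.
Proof.
have eV d : (h_s - d *: (1 : H)) * h_s' = (1 : H) - d *: h_s'.
  by rewrite mulrBl ss' -palg_scalerAl mul1r.
have e2 d d' : (h_s - d *: (1 : H)) * (1 - d' *: h_s')
    = h_s - d *: (1 : H) - d' *: ((1 : H) - d *: h_s').
  by rewrite mulrBr mulr1 -palg_scalerAr eV.
have := congr1 (fun x => x * h_s') s_cubic; rewrite mul0r -mulrA eV -mulrA e2.
rewrite mulrBr -palg_scalerAr e2 mulrBr -palg_scalerAr mulr1 mulrBl.
rewrite -palg_scalerAl mul1r => /eqP; rewrite !subr_eq0 => /eqP.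
move=> /eqP; rewrite !subr_eq => /eqP ->.
rewrite !scalerBr !scalerA !scalerDl opprB.
rewrite (mulrC c a) (mulrC c b) (mulrC b a) !opprD.
have -> : b * c * a = a * b * c by ring.
by rewrite [LHS](AC (2*2*2*1) ((7*5*1)*(6*2*4)*3)).
Qed.

End H3.

(** * Spanning words of H_3 and a model of U_(b,c) *)

Section H3Kernel.
Variables (K : fieldType) (a b c : K).
Hypotheses (a_neq0 : a != 0) (b_neq0 : b != 0) (c_neq0 : c != 0).
Hypothesis bc_generic : b ^+ 2 - b * c + c ^+ 2 != 0.

Local Notation H := (Halg a b c 3).
Local Notation s := (h_s a b c).
Local Notation s' := (h_s' a b c).
Local Notation t := (h_t a b c).
Local Notation t' := (h_t' a b c).
Local Notation w := (spanning s s' t t').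

Lemma H3_span (x : H) : exists d : span_index -> K, x = \sum_i d i *: w i.
Proof.
apply: spanned_sum.
have [ss' s's tt' t't sts] := h_relations a b c.
have e3 : a * b * c != 0 by rewrite !mulf_neq0.
have cl := spanned_closed e3 ss' s's tt' t't sts (h_s_sqr a b c).
(* The claim is strengthened to products x y with y spanned, so that the induction on x only asks
   for stability under left multiplication by the generators. *)
rewrite -[x]mulr1; have : spanned s s' t t' (1 : H) by exact: spanned_one.
move: (1 : H) => y.
move: x y; apply: H3_ind => [y|x x' IHx IHx' y yX|d x IHx y yX|x x' IHx IHx' y yX
  |y yX|y yX|y yX|y yX]; rewrite ?mul1r //.
- by rewrite mulrDl; apply: spannedD; [exact: IHx|exact: IHx'].
- by rewrite -palg_scalerAl; apply: spannedZ; exact: IHx.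
- by rewrite -mulrA; apply: IHx; exact: IHx'.
- by have [] := cl _ yX.
- by have [] := cl _ yX.
- by have [] := cl _ yX.
- by have [] := cl _ yX.
Qed.

(** A triangular model of U_(b,c): s is lower and t is upper triangular, both with diagonal entries
    b and c, and the image of s t s is antidiagonal. *)
Let g (x : letter 3) : 'M[K]_2 :=
  if val x.1 == 0%N then
    if x.2 then mat2 b^-1 0 (- (b * c)^-1) c^-1 else mat2 b 0 1 c
  else
    if x.2 then mat2 c^-1 1 0 b^-1 else mat2 c (- (b * c)) 0 b.

Let g_rel r : @H_relator K a b c 3 r -> nceval g r = 0.
Proof.
have one : (1%:M : 'M[K]_2) = mat2 1 0 0 1 by rewrite scalar_mat2.
case=> {r} [r [i|i|i j ij|i j ij]|i i0] /=.
- rewrite raddfN mulNmx mul1mx; apply/eqP; rewrite subr_eq0; apply/eqP.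
  by case: i => -[|[|//]] lti; rewrite /g /= mat2M one;
    congr mat2; field; rewrite ?b_neq0 ?c_neq0.
- rewrite raddfN mulNmx mul1mx; apply/eqP; rewrite subr_eq0; apply/eqP.
  by case: i => -[|[|//]] lti; rewrite /g /= mat2M one;
    congr mat2; field; rewrite ?b_neq0 ?c_neq0.
- by case: i j ij => -[|[|//]] ? [[|[|//]] ?].
- rewrite raddfN mulNmx mul1mx; apply/eqP; rewrite subr_eq0; apply/eqP.
  by case: i j ij => -[|[|//]] ? [[|[|//]] ?] //= _; rewrite /g /= !mat2M;
    congr mat2; ring.
- have D (d : K) : - 1%:M *m d%:M = mat2 (- d) 0 0 (- d).
    by rewrite mulNmx mul1mx -raddfN /= scalar_mat2.
  rewrite raddfN /= !D /g /= i0 /= !mat2D !mat2M -[RHS](raddf0 (@scalar_mx K 2)) /= scalar_mat2.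
  by congr mat2; ring.
Qed.

Lemma Ubc_exists : exists phi : {rmorphism H -> 'M[K]_2},
  is_Ubc phi /\ forall M, exists x, phi x = M.
Proof.
have [phi [phiZ phiE]] := palg_lift g_rel.
exists phi.
have ps : phi s = mat2 b 0 1 c by rewrite phiE.
have pt : phi t = mat2 c (- (b * c)) 0 b by rewrite phiE.
have surj (M : 'M[K]_2) : exists x, phi x = M.
  pose img M := exists x, phi x = M.
  have imD M1 M2 : img M1 -> img M2 -> img (M1 + M2).
    by move=> [x <-] [y <-]; exists (x + y); rewrite rmorphD.
  have imM M1 M2 : img M1 -> img M2 -> img (M1 *m M2).
    by move=> [x <-] [y <-]; exists (x * y); rewrite rmorphM.
  have imZ d M1 : img M1 -> img (d *: M1).
    by move=> [x <-]; exists (d *: x); rewrite phiZ.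
  have i1 : img 1%:M by exists 1; rewrite rmorph1.
  pose P : 'M[K]_2 := mat2 (b - c) 0 1 0.
  pose C : 'M[K]_2 := mat2 0 (- (b * c)) 1 0.
  have iP : img P.
    have -> : P = phi s + (- c) *: 1%:M.
      by rewrite ps scalar_mat2 mat2Z mat2D; congr mat2; ring.
    by apply: imD; [exists s|exact: imZ].
  have iC : img C.
    have -> : C = (b * c)^-1 *: (phi s *m phi t *m phi s).
      rewrite ps pt !mat2M mat2Z; congr mat2; field; by rewrite b_neq0 c_neq0.
    by apply/imZ/imM; [apply: imM; eexists|eexists].
  (* d is the determinant formed by the first columns of P and C P, whose second columns vanish. So
     P and C P span the matrices supported on the first column, and right multiplication by C
     reaches the second one. *)
  pose d := b ^+ 2 - b * c + c ^+ 2.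
  have iE00 : img (mat2 1 0 0 0).
    have -> : mat2 1 0 0 0 = ((b - c) / d) *: P + (- d^-1) *: (C *m P).
      by rewrite mat2M !mat2Z mat2D; congr mat2; rewrite /d; field.
    by apply: imD; apply: imZ => //; exact: imM.
  have iE10 : img (mat2 0 0 1 0).
    have -> : mat2 0 0 1 0 = (b * c / d) *: P + ((b - c) / d) *: (C *m P).
      by rewrite mat2M !mat2Z mat2D; congr mat2; rewrite /d; field.
    by apply: imD; apply: imZ => //; exact: imM.
  rewrite (mat2E M); move: (M _ _) (M _ _) (M _ _) (M _ _) => m11 m10 m01 m00.
  have -> : mat2 m00 m01 m10 m11 =
      m00 *: mat2 1 0 0 0 + (- (b * c)^-1 * m01) *: (mat2 1 0 0 0 *m C)
      + (m10 *: mat2 0 0 1 0 + (- (b * c)^-1 * m11) *: (mat2 0 0 1 0 *m C)).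
    by rewrite !mat2M !mat2Z !mat2D; congr mat2; field; rewrite b_neq0 c_neq0.
  by apply: (imD); apply: (imD); apply: imZ => //; exact: imM.
split=> //; split=> //; last first.
  rewrite [phi _]ps char_poly_trig.
    by rewrite !big_ord_recl big_ord0 mulr1 !mxE.
  by apply/is_trig_mxP; apply: ord2_cases; apply: ord2_cases; rewrite // mxE.
split=> // V stable; have [->|V0] := eqVneq V 0; first by left; rewrite mxrank0.
(* As phi is onto, matrix units carry the non-zero entry V i j to every basis row, which forces full
   rank. *)
right; have [i [j Vij]] : exists i j, V i j != 0.
  apply/not_existsP => n0; move/eqP: V0; apply; apply/matrixP => i j; rewrite mxE.
  by apply/eqP; apply: contraT => Vij; case: (n0 i); exists j.
apply/eqP; rewrite -/(row_full V) -sub1mx; apply/row_subP => k.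
have [x xE] := surj (delta_mx k j).
have := stable x; rewrite xE trmx_delta => /(submx_trans (row_sub i _)).
have -> : row i (V *m delta_mx j k) = V i j *: row k 1%:M.
  apply/rowP => k'; rewrite !mxE (bigD1 j)//= big1 ?addr0 => [|j' /negPf j'j].
    by rewrite !mxE eqxx /= eq_sym.
  by rewrite mxE j'j mulr0.
by rewrite -{2}[row k _](scalerK Vij) => h; apply: scalemx_sub.
Qed.

End H3Kernel.

(** * The ideal of U_(b,c) acts by zero *)

Section Kernel.
Variables (K : fieldType) (a b c : K) (n : nat).
Hypotheses (b_neq0 : b != 0) (c_neq0 : c != 0).
Local Notation H := (Halg a b c 3).
Variable rho : {rmorphism H -> 'M[K]_n}.
Hypothesis twist_unit : rho (h_twist a b c) \in unitmx.

(** Minimality is applied to z I, a two-sided ideal because z is central. If z I = I then phi kills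
    I, which is excluded; if z I = 0 then rho kills I, because rho z is invertible. *)
Lemma Ubc_ideal_vanishes x : Ubc_ideal x -> rho x = 0.
Proof.
move=> [I [[[I0 ID IM] In0 Imin] Ix [phi Uphi [y Iy phiy]]]].
pose z := h_twist a b c.
have zC u : z * u = u * z by exact: h_twist_central.
pose J : set H := [set z * u | u in I].
have JI : J `<=` I by move=> _ [u Iu <-]; have [] := IM z u Iu.
have Jideal : two_sided_ideal J.
  split.
  - by exists 0 => //; rewrite mulr0.
  - move=> _ _ [u Iu <-] [v Iv <-]; exists (u + v); first exact: ID.
    by rewrite mulrDr.
  - move=> u _ [v Iv <-]; have [uv vu] := IM u v Iv; split.
      by exists (u * v) => //; rewrite !mulrA zC.
    by exists (v * u) => //; rewrite mulrA.
have [J0|JeI] := Imin J Jideal JI.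
  have : J (z * x) by exists x.
  rewrite J0 => /= zx; have := congr1 rho zx.
  rewrite rmorphM rmorph0 => /(congr1 (mulmx (invmx (rho z)))).
  by rewrite mulmx0 mulKmx.
have : J y by rewrite JeI.
move=> [u Iu zu]; move: phiy; rewrite -zu rmorphM.
by rewrite (Ubc_twist b_neq0 c_neq0 Uphi) mul0r eqxx.
Qed.

End Kernel.

Lemma delta_mx_sandwich (K : fieldType) n (M : 'M[K]_n) (k i j k' : 'I_n) :
  delta_mx k i *m M *m delta_mx j k' = M i j *: delta_mx k k'.
Proof.
rewrite -(mul_delta_mx (0 : 'I_1) k i) -(mul_delta_mx (0 : 'I_1) j k').
rewrite -(mulmxA (delta_mx k 0)) -rowE mulmxA -(mulmxA (delta_mx k 0) _ (delta_mx j 0)) -colE.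
have -> : col j (row i M) = (M i j)%:M.
  by apply/matrixP => p p'; rewrite !mxE !ord1 eqxx.
by rewrite mul_mx_scalar -scalemxAl mul_delta_mx.
Qed.

(** * The kernel of the action is the ideal of U_(b,c) *)

Section KernelConverse.
Variables (K : fieldType) (a b c : K).
Hypotheses (a_neq0 : a != 0) (b_neq0 : b != 0) (c_neq0 : c != 0).
Local Notation H := (Halg a b c 3).

Variable rho_dim : nat.
Variable rho : {rmorphism H -> 'M[K]_rho_dim}.
Hypothesis rhoZ : scalable rho.
Hypothesis twist_unit : rho (h_twist a b c) \in unitmx.
Variable u : 'I_20 -> H.
Hypothesis rho_free :
  forall d : 'I_20 -> K, \sum_i d i *: rho (u i) = 0 -> forall i, d i = 0.
Variable phi : {rmorphism H -> 'M[K]_2}.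
Hypothesis phi_Ubc : is_Ubc phi.
Hypothesis phi_surj : forall M, exists x, phi x = M.

Let phiZ : scalable phi. Proof. by case: phi_Ubc. Qed.

(* The value at the twist of its characteristic polynomial under rho. *)
Lemma kernel_unit : exists2 e, rho e = 0 & phi e = 1%:M.
Proof.
move: rho rhoZ twist_unit; case: rho_dim => [|m] r rZ ru.
  by exists 1; rewrite ?rmorph1//; apply/matrixP => -[].
set M := r _ in ru.
have lift p : exists2 e, r e = horner_mx M p & phi e = (p.[0])%:M.
  elim/poly_ind: p => [|p d [e re phie]].
    by exists 0; rewrite rmorph0 ?horner0 ?raddf0.
  exists (e * h_twist a b c + d *: (1 : H)).
    by rewrite rmorphD rmorphM rZ rmorph1 re -/M rmorphD rmorphM /= horner_mx_X
      horner_mx_C scalemx1.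
  rewrite rmorphD rmorphM phiZ rmorph1 (Ubc_twist b_neq0 c_neq0 phi_Ubc).
  by rewrite mulr0 add0r hornerMXaddC mulr0 add0r scalemx1.
have [e re phie] := lift (char_poly M).
have p0 : (char_poly M).[0] != 0.
  rewrite horner_coef0 char_poly_det mulf_neq0 ?signr_eq0 //.
  by move: ru; rewrite unitmxE unitfE.
exists ((char_poly M).[0]^-1 *: e); first by rewrite rZ re Cayley_Hamilton scaler0.
by rewrite phiZ phie -scalemx1 scalerA mulVf// scale1r.
Qed.

Lemma kernel_lift (M : 'M[K]_2) : exists2 k, rho k = 0 & phi k = M.
Proof.
have [e re phie] := kernel_unit; have [x <-] := phi_surj M.
exists (e * x); first by rewrite rmorphM re mul0r.
by rewrite rmorphM phie mul1r.
Qed.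

Local Notation w := (spanning (h_s a b c) (h_s' a b c) (h_t a b c) (h_t' a b c)).
Local Notation n24 := #|{: span_index}|.

Let comb (d : 'rV[K]_n24) : H := \sum_i d 0 (enum_rank i) *: w i.

Let comb_surj x : exists d, x = comb d.
Proof.
have [d ->] := H3_span a_neq0 b_neq0 c_neq0 x.
exists (\row_r d (enum_val r)); apply: eq_bigr => i _.
by rewrite mxE enum_rankK.
Qed.

(** Row i is the flattened image of the i-th word, so the rank is the dimension of the image of
    r. *)
Let rows (m : nat) (r : H -> 'M[K]_m) : 'M[K]_(n24, m * m) :=
  \matrix_i mxvec (r (w (enum_val i))).

Let rowsE m (r : {rmorphism H -> 'M[K]_m}) (rZ : scalable r) d :
  mxvec (r (comb d)) = d *m rows r.
Proof.
rewrite mulmx_sum_row rmorph_sum linear_sum /=.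
rewrite [RHS](reindex_onto enum_rank enum_val) /=; last first.
  by move=> i _; rewrite enum_valK.
apply: eq_big => [i|i _]; first by rewrite enum_rankK eqxx.
by rewrite rZ linearZ /= rowK enum_rankK.
Qed.

Let rank_rows : (20 <= \rank (rows rho))%N.
Proof.
have [f fE] : exists f : 'I_20 -> 'rV[K]_n24, forall i, u i = comb (f i).
  exact: (fin_all_exists (fun i => comb_surj (u i))).
pose U : 'M[K]_(20, _) := \matrix_i mxvec (rho (u i)).
have UE : U = (\matrix_i f i) *m rows rho.
  by apply/row_matrixP => i; rewrite row_mul !rowK fE rowsE.
apply: leq_trans (mxrankM_maxr (\matrix_i f i) (rows rho)); rewrite -UE.
suff : row_free U by rewrite /row_free => /eqP ->.
rewrite -kermx_eq0; apply/eqP/row_matrixP => i; rewrite row0.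
set d := row i _; have dU : d *m U = 0.
  by apply/sub_kermxP; exact: row_sub.
suff dr : \sum_j d 0 j *: rho (u j) = 0.
  by apply/rowP => j; rewrite [RHS]mxE; exact: (rho_free dr j).
apply: (can_inj mxvecK); rewrite linear_sum linear0 /= -[RHS]dU mulmx_sum_row.
by apply: eq_bigr => k _; rewrite linearZ /= rowK.
Qed.

Let phi_lift_rows : exists C : 'M[K]_(2 * 2, n24),
  C *m rows phi = 1%:M /\ C *m rows rho = 0.
Proof.
have [f fE] : exists f : 'I_(2 * 2) -> 'rV[K]_n24, forall i,
    rho (comb (f i)) = 0 /\ phi (comb (f i)) = vec_mx (delta_mx 0 i).
  suff h i : exists d, rho (comb d) = 0 /\ phi (comb d) = vec_mx (delta_mx 0 i).
    exact: (fin_all_exists h).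
  have [k rk pk] := kernel_lift (vec_mx (delta_mx 0 i)).
  by have [d kd] := comb_surj k; exists d; rewrite -kd.
exists (\matrix_i f i); split; apply/row_matrixP => i.
  by rewrite row_mul rowK -rowsE// (fE i).2 vec_mxK row1.
by rewrite row_mul rowK -rowsE// (fE i).1 linear0 row0.
Qed.

(** The dimension count is made on coefficient vectors, the words being known only to span. Those
    sent to 0 by rho form a space of dimension at most 24 - 20 = 4, and the four rows of C lie in it
    and are sent by phi to a basis of the matrices. So they span it, and phi detects its
    elements. *)
Lemma kernel_phi_inj x : rho x = 0 -> phi x = 0 -> x = 0.
Proof.
have [C [Cphi Crho]] := phi_lift_rows; have [d ->] := comb_surj x.
move=> rd pd.
have {}rd : d *m rows rho = 0 by rewrite -rowsE// rd linear0.
have {}pd : d *m rows phi = 0 by rewrite -rowsE// pd linear0.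
have rC : \rank C = 4%N.
  by apply/eqP; rewrite -/(row_free C); apply/row_freeP; exists (rows phi).
have CK : (C <= kermx (rows rho))%MS by apply/sub_kermxP.
have : (d <= C)%MS.
  have dK : (d <= kermx (rows rho))%MS by apply/sub_kermxP.
  apply: submx_trans dK _; rewrite -(mxrank_leqif_sup CK).
  rewrite eqn_leq mxrankS//= rC mxrank_ker leq_subLR.
  apply: (@leq_trans (20 + 4)); first by rewrite card_span_index.
  by rewrite leq_add2r.
move=> /submxP[D dE]; move: pd; rewrite dE -mulmxA Cphi mulmx1 => ->.
rewrite mul0mx /comb big1// => i _.
by rewrite mxE scale0r.
Qed.

(** A non-zero ideal J inside the kernel has a non-zero image under phi, which is an ideal of a full
    matrix algebra and hence everything. Injectivity of phi on the kernel then gives J back. *)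
Lemma kernel_simple : simple_ideal [set x : H | rho x = 0].
Proof.
split.
- split=> /=.
  + exact: rmorph0.
  + by move=> x y rx ry; rewrite rmorphD rx ry addr0.
  + by move=> x y ry; rewrite !rmorphM ry mulr0 mul0r.
- have [e re pe] := kernel_unit; move=> k0.
  have : [set x : H | rho x = 0] e by [].
  rewrite k0 /= => e0; move: pe; rewrite e0 rmorph0 => /matrixP /(_ 0 0) /eqP.
  by rewrite !mxE eq_sym oner_eq0.
move=> J [J0 JD JM] JK; have [->|Jn0] := pselect (J = [set 0]); first by left.
right; have [x [Jx x0]] : exists x, J x /\ x <> 0.
  apply: contrapT => nx; apply: Jn0; rewrite eqEsubset; split=> y; last by move=> ->.
  by move=> Jy; apply: contrapT => y0; apply: nx; exists y.
have px : phi x != 0 by apply/eqP => px; apply: x0; exact: kernel_phi_inj (JK x Jx) px.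
have [i [j xij]] : exists i j, phi x i j != 0.
  apply/not_existsP => n0; move/eqP: px; apply; apply/matrixP => i j; rewrite mxE.
  by apply/eqP; apply: contraT => Vij; case: (n0 i); exists j.
have Jfull M : exists2 y, J y & phi y = M.
  have Jd k k' d : exists2 y, J y & phi y = d *: delta_mx k k'.
    have [v vE] := phi_surj ((d / phi x i j) *: delta_mx k i).
    have [v' v'E] := phi_surj (delta_mx j k').
    exists (v * x * v').
      by have [_] := JM v' (v * x) ((JM v x Jx).1).
    rewrite !rmorphM vE v'E -[_ * phi x]scalemxAl -[LHS]scalemxAl.
    by rewrite [X in _ *: X]delta_mx_sandwich scalerA divfK.
  rewrite (matrix_sum_delta M).
  elim/big_rec: _ => [|k M' _ [y Jy <-]]; first by exists 0 => //; rewrite rmorph0.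
  elim/big_rec: _ => [|k' M'' _ [y' Jy' y'E]]; first by exists y; rewrite ?add0r.
  have [y'' Jy'' yE] := Jd k k' (M k k'); exists (y'' + y'); first exact: JD.
  by rewrite rmorphD yE y'E addrA.
rewrite eqEsubset; split=> // y /= ry; have [z Jz zE] := Jfull (phi y).
suff -> : y = z by [].
apply/eqP; rewrite -subr_eq0; apply/eqP/kernel_phi_inj; rewrite rmorphB.
  by rewrite ry (JK z Jz) subrr.
by rewrite zE subrr.
Qed.

Lemma kernel_sub_Ubc_ideal x : rho x = 0 -> Ubc_ideal x.
Proof.
move=> rx; exists [set x : H | rho x = 0]; split=> //; first exact: kernel_simple.
exists phi => //; have [e re pe] := kernel_unit; exists e => //.
by rewrite pe; apply/eqP => /matrixP /(_ 0 0) /eqP; rewrite !mxE oner_eq0.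
Qed.

End KernelConverse.

(** * The action of the braid group *)

Section BraidAction.
Variables (K : fieldType) (N : nat) (l q : K).
Hypothesis q_neq0 : q != 0.
Hypothesis l_neq0 : l != 0.
Hypothesis qV_neq : q + q^-1 != 0.

Let a := - l ^+ 4.
Let b := l ^+ 4 * q ^+ 2.
Let c := l ^+ 4 / q ^+ 4.

Local Notation U := (wedge_index N).
Local Notation rho i := (local (@wbraid K N l q) i).

Let a_neq0 : a != 0. Proof. by rewrite oppr_eq0 expf_neq0. Qed.
Let b_neq0 : b != 0. Proof. by rewrite mulf_neq0 ?expf_neq0. Qed.
Let c_neq0 : c != 0. Proof. by rewrite mulf_neq0 ?invr_eq0 ?expf_neq0. Qed.

(** A polynomial relation with non-zero constant term provides an inverse: M L = x y z. *)
Lemma cubic_unit n (M : 'M[K]_n) (x y z : K) : x * y * z != 0 ->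
  (M - x%:M) *m (M - y%:M) *m (M - z%:M) = 0 -> M \in unitmx.
Proof.
move=> xyz M0; pose L := M *m M - (x + y + z) *: M + (x * y + x * z + y * z)%:M.
have ML : M *m ((x * y * z)^-1 *: L) = 1%:M.
  rewrite -scalemxAr; have -> : M *m L = (x * y * z)%:M.
    apply/eqP; rewrite -subr_eq0 -M0; apply/eqP.
    rewrite !(mulmxBl, mulmxBr) !(mul_scalar_mx, mul_mx_scalar).
    rewrite -?scalemxAl ?(mul_scalar_mx, mul_mx_scalar) /L.
    rewrite mulmxDr mulmxBr -scalemxAr mul_mx_scalar mulmxA.
    apply/matrixP => s s'; rewrite !mxE; set d := s == s'.
    by case: d; rewrite ?mulr1n ?mulr0n; ring.
  by rewrite scale_scalar_mx mulVf.
by have [] := mulmx1_unit ML.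
Qed.

Lemma wbraid_unit (k : nat) (i : 'I_k.-1) : rho i \in unitmx.
Proof.
have := wbraid_cubic N q_neq0 l_neq0 qV_neq i; apply: cubic_unit.
by rewrite !mulf_neq0 // ?invr_eq0 ?oppr_eq0 ?expf_neq0.
Qed.

Definition braid_letter (k : nat) (x : letter k) : Endt K U k :=
  if x.2 then invmx (rho x.1) else rho x.1.

Lemma nceval_sub n (X : Type) (g : X -> 'M[K]_n) x y :
  nceval g (Defs.Sub x y) = nceval g x - nceval g y.
Proof. by rewrite /= raddfN /= mulNmx mul1mx. Qed.

Lemma braid_letter_H (k : nat) r : @H_relator K a b c k r ->
  nceval (@braid_letter k) r = 0.
Proof.
case=> {r} [r [i|i|i j ij|i j ij]|i i0]; rewrite ?nceval_sub /=.
- by rewrite mulmxV ?wbraid_unit// subrr.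
- by rewrite mulVmx ?wbraid_unit// subrr.
- by rewrite /braid_letter /= local_far// subrr.
- by rewrite /braid_letter /= wbraid_braid// subrr.
- have n1 : (- 1)%:M = - 1%:M :> Endt K U k by rewrite raddfN.
  by rewrite n1 !mulNmx !mul1mx; exact: wbraid_cubic.
Qed.

Lemma H_action (k : nat) : exists f : {rmorphism Halg a b c k -> Endt K U k},
  scalable f /\ forall t, f (cls _ t) = nceval (@braid_letter k) t.
Proof. exact: palg_lift (@braid_letter_H k). Qed.

Let full_le3 (k : nat) : (3 <= k)%N -> (0 + 3 <= k)%N. Proof. by []. Qed.

(** Widening the letters amounts to acting on the first three factors. This reduces the relators of
    Q_k that come from [Ubc_ideal] to the case k = 3. *)
Lemma nceval_widen (k : nat) (le3k : (3 <= k)%N) t :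
  nceval (@braid_letter k) (ncmap (widen_letter le3k) t) =
  embed (consecutive (full_le3 le3k)) (nceval (@braid_letter 3) t).
Proof.
have ci := @consecutive_inj 3 k 0 (full_le3 le3k).
have E i : embed (consecutive (full_le3 le3k)) (rho i) =
    rho (widen_ord (pred_leq3 le3k) i) by exact: embed_consecutive.
elim: t => [[i []]|d|t IHt u IHu|t IHt u IHu] /=.
- rewrite /braid_letter /=; set W := rho _; set V := rho _.
  have VV : embed (consecutive (full_le3 le3k)) V *m
      embed (consecutive (full_le3 le3k)) (invmx V) = 1%:M.
    by rewrite -(embedM ci) mulmxV ?wbraid_unit// (embed_scalar _ ci).
  by rewrite -[LHS]mulmx1 -VV mulmxA E mulVmx ?wbraid_unit// mul1mx.
- by rewrite /braid_letter /= -E.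
- by rewrite (embed_scalar _ ci).
- by rewrite (embedD ci) IHt IHu.
- by rewrite (embedM ci) IHt IHu.
Qed.

Section Generic.

Let r0 : 'I_3.-1 := ord0.
Let r1 : 'I_3.-1 := ord_max.

Definition wtwist : Endt K U 3 :=
  (rho r0 *m rho r1 *m rho r0) *m (rho r0 *m rho r1 *m rho r0)
  + ((b * c) ^+ 3)%:M.

Hypothesis twist_unit : wtwist \in unitmx.

Lemma wtwistE (f : {rmorphism Halg a b c 3 -> Endt K U 3}) : scalable f ->
    (forall t, f (cls _ t) = nceval (@braid_letter 3) t) ->
  f (h_twist a b c) = wtwist.
Proof.
move=> fZ fE; rewrite rmorphD !rmorphM fZ rmorph1 /h_s /h_t !fE /= scalemx1.
by [].
Qed.

Lemma braid_letter_Q (k : nat) r : @Q_relator K a b c k r ->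
  nceval (@braid_letter k) r = 0.
Proof.
case=> {r} [r /braid_letter_H //|le3k t tU].
have [f [fZ fE]] := H_action 3.
have : f (cls _ t) = 0.
  by apply: (Ubc_ideal_vanishes b_neq0 c_neq0 _ tU); rewrite (wtwistE fZ fE).
rewrite nceval_widen fE => ->.
by apply: act_inj => h y; rewrite act_embed ?act0 //; exact: consecutive_inj.
Qed.

Lemma Q_action (k : nat) : exists f : {rmorphism Qalg a b c k -> Endt K U k},
  scalable f /\ forall i, f (Q_s a b c i) = rho i.
Proof.
have [f [fZ fE]] := palg_lift (@braid_letter_Q k).
by exists f; split=> // i; rewrite fE.
Qed.

Section Three.
Variable f : {rmorphism Qalg a b c 3 -> Endt K U 3}.
Hypothesis fZ : scalable f.
Hypothesis f_s : forall i, f (Q_s a b c i) = rho i.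

(** The morphism is prescribed on the s_i only; its values on their inverses are forced by
    uniqueness of inverses. *)
Lemma Q_actionE t : f (cls _ t) = nceval (@braid_letter 3) t.
Proof.
rewrite (rmorph_cls fZ); apply: eq_nceval => -[i []]; last exact: f_s.
rewrite /braid_letter /=.
have : f (cls _ (sgV K i)) *m rho i = 1%:M.
  rewrite -f_s -[LHS]rmorphM -cls_mul -[RHS](rmorph1 f); congr (f _).
  apply/eqP; rewrite -[1]/(cls _ (Cst 1)) -subr_eq0 -cls_sub; apply/eqP/cls_rel.
  exact/Q_H/H_braid/braid_invl.
move=> /(congr1 (mulmx^~ (invmx (rho i)))).
by rewrite mulmxK ?wbraid_unit// mul1mx.
Qed.

Hypothesis bc_generic : b ^+ 2 - b * c + c ^+ 2 != 0.
Variable u : 'I_20 -> ncpoly K (letter 3).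
Hypothesis rho_free : forall d : 'I_20 -> K,
  \sum_i d i *: nceval (@braid_letter 3) (u i) = 0 -> forall i, d i = 0.

(** An expression acting by zero has its class in [Ubc_ideal], and for k = 3 the widening of letters
    is the identity, so the expression itself is a relator of Q_3. *)
Lemma Q_action_inj : injective f.
Proof.
suff f0 x : f x = 0 -> x = 0.
  move=> x y /eqP; rewrite -subr_eq0 -rmorphB => /eqP /f0 /eqP.
  by rewrite subr_eq0 => /eqP.
have [t ->] := cls_surj x; rewrite Q_actionE => t0.
have [g [gZ gE]] := H_action 3.
have [phi [Uphi phi_surj]] := Ubc_exists a b_neq0 c_neq0 bc_generic.
have tU : Ubc_ideal (cls (@H_relator K a b c 3) t).
  have gu : g (h_twist a b c) \in unitmx by rewrite (wtwistE gZ gE).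
  apply: (kernel_sub_Ubc_ideal a_neq0 b_neq0 c_neq0 gZ gu
    (u := fun i => cls _ (u i)) _ Uphi phi_surj); last by rewrite gE.
  by move=> d; under eq_bigr do rewrite gE; exact: rho_free.
have := @Q_Ubc K a b c 3 (leqnn 3) t tU.
have -> : ncmap (widen_letter (leqnn 3)) t = t.
  elim: (t) => [[i e]|//|v IHv w IHw|v IHv w IHw] /=; rewrite ?IHv ?IHw //.
  by congr (Gen (_, _)); apply/val_inj.
exact: cls_rel.
Qed.

End Three.
End Generic.

End BraidAction.

(** * Weights and the failure of surjectivity *)

Section Weights.
Variables (K : fieldType) (N : nat) (l q : K).
Hypothesis q_neq0 : q != 0.
Hypothesis l_neq0 : l != 0.
Hypothesis qV_neq : q + q^-1 != 0.

Local Notation U := (wedge_index N).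
Local Notation T i := (local (@vbraid K N l q) i).
Local Notation rho i := (local (@wbraid K N l q) i).

Variable v : 'I_N.

(** One coordinate of the weight of a basis vector, cast to K to serve as a diagonal entry. *)
Definition vcount (m : nat) (y : {ffun 'I_m -> 'I_N}) : K :=
  (\sum_j (y j == v))%N%:R.

Definition ucount (k : nat) (x : {ffun 'I_k -> U}) : K :=
  (\sum_j (((val (x j)).1 == v) + ((val (x j)).2 == v)))%N%:R.

Definition diag_op (I : finType) (d : I -> K) : 'M[K]_#|I| :=
  diag_mx (\row_r d (enum_val r)).

Lemma act_diag_op (I : finType) (d : I -> K) g y :
  act (diag_op d) g y = d y * g y.
Proof.
rewrite /act (bigD1 y)//= big1 ?addr0 => [|x /negPf xy].
  by rewrite !mxE eqxx mulr1n enum_rankK.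
by rewrite !mxE (inj_eq enum_rank_inj) eq_sym xy mulr0n mul0r.
Qed.

Lemma vcount_swap (m : nat) (i : 'I_m.-1) (y : {ffun 'I_m -> 'I_N}) :
  vcount (put2 i y (y (snd_pos i), y (fst_pos i))) = vcount y.
Proof.
rewrite /vcount; congr _%:R.
rewrite [RHS](reindex_inj (h := tperm (fst_pos i) (snd_pos i))); last exact: perm_inj.
apply: eq_bigr => j _; rewrite ffunE; case: tpermP => [->|->|/eqP/negPf -> /eqP/negPf -> //].
  by rewrite eqxx.
by rewrite fst_snd_neq eqxx.
Qed.

Lemma vbraid_weight (m : nat) (i : 'I_m.-1) :
  T i *m diag_op (@vcount m) = diag_op (@vcount m) *m T i.
Proof.
apply: act_inj => g y; rewrite !act_mul act_diag_op !act_vbraid !act_diag_op.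
by rewrite vcount_swap; case: ifP => _; ring.
Qed.

Lemma sum_pairs (k : nat) (F : 'I_k.*2 -> nat) :
  (\sum_j F j = \sum_(j < k) (F (even_pos j) + F (odd_pos j)))%N.
Proof.
rewrite (partition_big (@half_pos k) xpredT) //=; apply: eq_bigr => j _.
rewrite (bigD1 (even_pos j)) /=; last by rewrite -val_eqE /= doubleK.
rewrite (bigD1 (odd_pos j)) /=; last first.
  by rewrite -!val_eqE /= uphalf_double eqxx; lia.
rewrite big1 ?addn0// => s; rewrite -!val_eqE /=; lia.
Qed.

(** A basis vector of the exterior square involves its two letters in either order only, so both
    counts agree wherever [winc] has a non-zero entry. *)
Lemma winc_weight (k : nat) :
  diag_op (@vcount k.*2) *m winc N q k = winc N q k *m diag_op (@ucount k).
Proof.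
apply: act_inj => h y; rewrite !act_mul act_diag_op !act_winc mulr_sumr.
apply: eq_bigr => x _; rewrite act_diag_op.
have [p0|] := eqVneq (\prod_j wvec q (x j) (pair_at y j)) 0.
  by rewrite p0 !mul0r mulr0.
move=> pn0; suff -> : vcount y = ucount x by ring.
rewrite /vcount /ucount sum_pairs; congr _%:R; apply: eq_bigr => j _.
have : wvec q (x j) (pair_at y j) != 0.
  by apply: contraNneq pn0 => e; rewrite (bigD1 j)//= e mul0r.
rewrite /wvec /pair_at.
case: (_ =P val (x j)) => [<- //|_].
case: (_ =P ((val (x j)).2, _)) => [[-> ->] _|_]; first by rewrite addnC.
by rewrite mulr0n subrr eqxx.
Qed.

Lemma wbraid_weight (k : nat) (i : 'I_k.-1) :
  rho i *m diag_op (@ucount k) = diag_op (@ucount k) *m rho i.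
Proof.
apply: (@winc_inj K N q k).
have F : fbraid_at N l q i *m diag_op (@vcount k.*2) =
         diag_op (@vcount k.*2) *m fbraid_at N l q i.
  rewrite (@fbraid_atE K N l q k i (strand0 i) (strand1 i) (strand2 i)) /= ?addn0
    ?addn1 ?addn2 //.
  by rewrite -!mulmxA vbraid_weight [in LHS](mulmxA (T _) _ (T _)) vbraid_weight
    -!mulmxA [in LHS](mulmxA (T _) _ (T _ *m _)) vbraid_weight -!mulmxA
    [in LHS](mulmxA (T _) _ (T _ *m _)) vbraid_weight -!mulmxA.
rewrite !mulmxA -fbraid_winc// -winc_weight -!mulmxA -fbraid_winc//.
by rewrite -winc_weight !mulmxA F.
Qed.

Lemma braid_letter_weight (k : nat) t :
  nceval (@braid_letter K N l q k) t *m diag_op (@ucount k) =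
  diag_op (@ucount k) *m nceval (@braid_letter K N l q k) t.
Proof.
elim: t => [[i []]|d|t IHt u IHu|t IHt u IHu] /=.
- rewrite /braid_letter /=.
  have ru := wbraid_unit N q_neq0 l_neq0 qV_neq i.
  rewrite -[in LHS](mulmxK ru (diag_op _)) -wbraid_weight.
  by rewrite -!mulmxA mulKmx.
- exact: wbraid_weight.
- by rewrite scalar_mxC.
- by rewrite mulmxDl mulmxDr IHt IHu.
- by rewrite -mulmxA IHu !mulmxA IHt.
Qed.

End Weights.

(** The matrix unit from y to x is not in the image: the letter 0 occurs three times in x and twice
    in y, and the commutation with the weight operator would give 3 = 2 in K. *)
Lemma Q_action_not_surj (K : fieldType) (N : nat) (l q : K)
    (f : {rmorphism Qalg (- l ^+ 4) (l ^+ 4 * q ^+ 2) (l ^+ 4 / q ^+ 4) 3 ->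
                    Endt K (wedge_index N) 3}) :
    q != 0 -> l != 0 -> q + q^-1 != 0 -> (3 <= N)%N -> scalable f ->
    (forall i, f (Q_s _ _ _ i) = local (@wbraid K N l q) i) ->
  ~ (forall M, exists x, f x = M).
Proof.
move=> q0 l0 qV N3 fZ f_s surj.
have ltN i : (i < 3)%N -> (i < N)%N by move=> i3; exact: leq_trans N3.
pose p01 : wedge_index N :=
  exist _ (Ordinal (ltN 0 isT), Ordinal (ltN 1 isT)) isT.
pose p12 : wedge_index N :=
  exist _ (Ordinal (ltN 1 isT), Ordinal (ltN 2 isT)) isT.
pose x : {ffun 'I_3 -> wedge_index N} := [ffun=> p01].
pose y : {ffun 'I_3 -> wedge_index N} := [ffun j => if val j == 0 then p12 else p01].
pose v : 'I_N := Ordinal (ltN 0 isT).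
have [z zE] := surj (delta_mx (enum_rank x) (enum_rank y)).
have [t tE] := cls_surj z.
have := braid_letter_weight q0 l0 qV v t.
rewrite -(Q_actionE q0 l0 qV fZ f_s) -tE zE.
move=> /matrixP /(_ (enum_rank x) (enum_rank y)).
rewrite /diag_op mul_mx_diag mul_diag_mx !mxE !enum_rankK !eqxx mul1r mulr1.
rewrite /ucount !big_ord_recl !big_ord0 !ffunE /=.
move=> /eqP; rewrite -subr_eq0 -opprB -natrB // oppr_eq0.
by rewrite oner_eq0.
Qed.

(** * Genericity *)

Section ComplexExponential.
Variable R : realType.
Implicit Types z w : R[i].

Lemma cexpD z w : cexp (z + w) = cexp z * cexp w.
Proof.
case: z w => [x y] [x' y']; rewrite /cexp /= expRD cosD sinD.
by apply/eqP; rewrite eq_complex /=; apply/andP; split; apply/eqP; ring.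
Qed.

Lemma cexp0 : cexp (0 : R[i]) = 1.
Proof. by rewrite /cexp /= expR0 cos0 sin0 mulr0 mulr1. Qed.

Lemma cexpMn z n : cexp (z *+ n) = cexp z ^+ n.
Proof. by elim: n => [|n IHn]; rewrite ?cexp0 // mulrSr exprSr cexpD IHn. Qed.

Lemma cexp_neq0 z : cexp z != 0.
Proof.
apply/eqP => z0; have := cexpD z (- z).
by rewrite subrr cexp0 z0 mul0r => /eqP; rewrite oner_eq0.
Qed.

Lemma cexpN z : cexp (- z) = (cexp z)^-1.
Proof.
apply: (mulfI (cexp_neq0 z)); rewrite -cexpD subrr cexp0 divff//.
exact: cexp_neq0.
Qed.

Lemma cos_periodic (x : R) (n : int) : cos (x + (pi *+ 2) *~ n) = cos x.
Proof.
have step (y : R) : cos (y + pi *+ 2) = cos y by exact: cosD2pi.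
elim/int_rec: n => [|n IHn|n IHn]; first by rewrite mulr0z addr0.
  by rewrite intS mulrzDr mulr1z addrA addrAC step.
by rewrite -step -addrA -{2}[pi *+ 2]mulr1z -mulrzDr intS opprD addrAC addNr add0r.
Qed.

(** After reduction to y in [0, 2 pi), the formula cos y = 1 - 2 sin^2 (y / 2) gives sin (y / 2) =
    0, whereas the sine is positive on (0, pi). *)
Lemma cos_eq1 (x : R) : cos x = 1 -> exists n : int, x = (pi *+ 2) *~ n.
Proof.
move=> cx; have p0 : 0 < (pi : R) *+ 2 by rewrite pmulrn_lgt0// pi_gt0.
pose n := Num.floor (x / (pi *+ 2)); pose y := x - (pi *+ 2) *~ n.
have /andP[n1 n2] := floor_itv (x / (pi *+ 2)).
have y0 : 0 <= y.
  by rewrite subr_ge0 -mulrzl -ler_pdivlMr.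
have y2 : y < pi *+ 2.
  by rewrite ltrBlDr -{1}[pi *+ 2]mulr1z -mulrzDr -mulrzl -ltr_pdivrMr// addrC.
have cy : cos y = 1 by rewrite -cx -(cos_periodic y n) subrK.
exists n; apply/eqP; rewrite -subr_eq0 -/y; apply: contraT => yn0.
have yp : 0 < y by rewrite lt_def yn0.
have : 0 < sin (y / 2) by apply: sin_gt0_pi; rewrite divr_gt0// ltr_pdivrMr// mulr_natr.
have : cos y = 1 - (sin (y / 2)) ^+ 2 *+ 2.
  have e : cos y = cos (y / 2) * cos (y / 2) - sin (y / 2) * sin (y / 2).
    by rewrite -cosD -splitr.
  rewrite e -[X in X - _ *+ 2](cos2Dsin2 (y / 2)).
  by rewrite mulr2n; ring.
rewrite cy => /eqP; rewrite eq_sym subr_eq addrC -subr_eq subrr eq_sym mulrn_eq0 /=.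
by rewrite sqrf_eq0 => /eqP ->; rewrite ltxx.
Qed.

Lemma cexp_fiber z w : cexp z = cexp w ->
  exists n : int, z = w + (0 +i* ((pi *+ 2) *~ n))%C.
Proof.
case: z w => [x y] [x' y'] /eqP; rewrite eq_complex /= => /andP[/eqP re /eqP im].
have ex : expR x = expR x'.
  apply/eqP; rewrite -(eqrXn2 (n := 2)) ?expR_ge0//; apply/eqP.
  rewrite -[LHS]mulr1 -(cos2Dsin2 y) -[RHS]mulr1 -(cos2Dsin2 y').
  by rewrite !mulrDr -!exprMn re im.
have xx : x = x' by exact: expR_inj.
have e0 : expR x' != 0 by rewrite gt_eqF// expR_gt0.
move: re im; rewrite ex => /(mulfI e0) cc /(mulfI e0) ss.
have [n yn] : exists n : int, y - y' = (pi *+ 2) *~ n.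
  apply: cos_eq1; rewrite cosD cosN sinN cc ss -(cos2Dsin2 y').
  by ring.
exists n; rewrite xx -yn; apply/eqP; rewrite eq_complex /=.
by rewrite addr0 eqxx /= addrC subrK.
Qed.

Lemma countable_cexp_fiber (N : nat) (r : R[i]) : (0 < N)%N ->
  countable [set h : R[i] | cexp (h / N%:R) = r].
Proof.
move=> N0; have [[h0 /= h0r]|none] := pselect (exists h : R[i], cexp (h / N%:R) = r).
  pose g (n : int) : R[i] := h0 + (0 +i* ((pi *+ 2) *~ n))%C * N%:R.
  apply: (@sub_countable _ _ _ (range g)); last first.
    by apply: (sub_countable (card_image_le _ _)); exact: countableP.
  apply: subset_card_le => h /= hr.
  have [n hn] := cexp_fiber (etrans hr (esym h0r)).
  exists n => //; rewrite /g; have NR : (N%:R : R[i]) != 0 by rewrite pnatr_eq0 -lt0n.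
  by rewrite -[h in RHS](divfK NR) hn mulrDl divfK.
suff -> : [set h : R[i] | cexp (h / N%:R) = r] = set0 by exact: countable0.
by rewrite eqEsubset; split=> // h /= hr; case: none; exists h.
Qed.

End ComplexExponential.

(** * Laurent polynomial functions and their zeros *)

Section Laurent.
Variable K : fieldType.

(** Only values away from 0 are constrained, so functions written with inverses qualify as they
    stand and closure properties are pointwise. *)
Definition laurent (f : K -> K) : Prop :=
  exists (p : {poly K}) (n : nat), forall t, t != 0 -> f t * t ^+ n = p.[t].

Lemma laurent_ext f g : laurent f -> (forall t, t != 0 -> f t = g t) -> laurent g.
Proof. by move=> [p [n fp]] fg; exists p, n => t t0; rewrite -fg// fp. Qed.

Lemma laurent_cst d : laurent (fun=> d).
Proof. by exists d%:P, 0%N => t _; rewrite expr0 mulr1 hornerC. Qed.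

Lemma laurent_id : laurent id.
Proof. by exists 'X, 0%N => t _; rewrite expr0 mulr1 hornerX. Qed.

Lemma laurentV : laurent (fun t => t^-1).
Proof. by exists 1%:P, 1%N => t t0; rewrite expr1 mulVf// hornerC. Qed.

Lemma laurentM f g : laurent f -> laurent g -> laurent (fun t => f t * g t).
Proof.
move=> [p [n fp]] [p' [n' gp]]; exists (p * p'), (n + n')%N => t t0.
by rewrite exprD mulrACA fp// gp// hornerM.
Qed.

Lemma laurentD f g : laurent f -> laurent g -> laurent (fun t => f t + g t).
Proof.
move=> [p [n fp]] [p' [n' gp]].
exists (p * 'X^n' + p' * 'X^n), (n + n')%N => t t0.
rewrite hornerD !hornerM !hornerXn -fp// -gp// exprD.
by ring.
Qed.

Lemma laurentN f : laurent f -> laurent (fun t => - f t).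
Proof.
move=> lf; apply: laurent_ext (laurentM (laurent_cst (-1)) lf) _ => t _.
by rewrite mulN1r.
Qed.

Lemma laurentX f n : laurent f -> laurent (fun t => f t ^+ n).
Proof.
move=> lf; elim: n => [|n IHn]; first exact: laurent_cst.
by apply: laurent_ext (laurentM lf IHn) _ => t _; rewrite exprS.
Qed.

Lemma laurent_sum (I : finType) (P : pred I) (F : I -> K -> K) :
  (forall i, laurent (F i)) -> laurent (fun t => \sum_(i | P i) F i t).
Proof.
move=> lF; elim: (index_enum I) => [|i s IHs].
  by apply: laurent_ext (laurent_cst 0) _ => t _; rewrite big_nil.
have [Pi|nPi] := boolP (P i).
  by apply: laurent_ext (laurentD (lF i) IHs) _ => t _; rewrite big_cons Pi.
by apply: laurent_ext IHs _ => t _; rewrite big_cons (negPf nPi).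
Qed.

Lemma laurent_prod (I : finType) (P : pred I) (F : I -> K -> K) :
  (forall i, laurent (F i)) -> laurent (fun t => \prod_(i | P i) F i t).
Proof.
move=> lF; elim: (index_enum I) => [|i s IHs].
  by apply: laurent_ext (laurent_cst 1) _ => t _; rewrite big_nil.
have [Pi|nPi] := boolP (P i).
  by apply: laurent_ext (laurentM (lF i) IHs) _ => t _; rewrite big_cons Pi.
by apply: laurent_ext IHs _ => t _; rewrite big_cons (negPf nPi).
Qed.

Definition laurent_mx m n (M : K -> 'M[K]_(m, n)) :=
  forall i j, laurent (fun t => M t i j).

Lemma laurent_mxM m n p (M : K -> 'M[K]_(m, n)) (M' : K -> 'M[K]_(n, p)) :
  laurent_mx M -> laurent_mx M' -> laurent_mx (fun t => M t *m M' t).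
Proof.
move=> lM lM' i j; apply: (@laurent_ext (fun t => \sum_k M t i k * M' t k j)).
  by apply: laurent_sum => k; exact: laurentM.
by move=> t _; rewrite mxE.
Qed.

Lemma laurent_mxD m n (M M' : K -> 'M[K]_(m, n)) :
  laurent_mx M -> laurent_mx M' -> laurent_mx (fun t => M t + M' t).
Proof.
move=> lM lM' i j; apply: (laurent_ext (laurentD (lM i j) (lM' i j))).
by move=> t _; rewrite mxE.
Qed.

Lemma laurent_mx_scalar n f : laurent f -> laurent_mx (fun t => (f t)%:M : 'M[K]_n).
Proof.
move=> lf i j; have [ij|ij] := eqVneq i j.
  by apply: (laurent_ext lf) => t _; rewrite mxE ij eqxx.
by apply: (laurent_ext (laurent_cst 0)) => t _; rewrite mxE (negPf ij).
Qed.

Lemma laurent_det n (M : K -> 'M[K]_n) :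
  laurent_mx M -> laurent (fun t => \det (M t)).
Proof.
move=> lM; apply: laurent_sum => s.
by apply: laurentM; [exact: laurent_cst|exact: laurent_prod].
Qed.

Lemma laurent_roots f t0 : laurent f -> t0 != 0 -> f t0 != 0 ->
  exists2 p : {poly K}, p != 0 & forall t, t != 0 -> f t = 0 -> root p t.
Proof.
move=> [p [n fp]] t00 ft0; exists p; last first.
  by move=> t tn0 ft; rewrite /root -fp// ft mul0r.
apply: contraNneq ft0 => p0; have := fp t0 t00.
by rewrite p0 horner0 => /eqP; rewrite mulf_eq0 expf_eq0 (negPf t00) andbF orbF.
Qed.

End Laurent.

(** A non-zero polynomial has finitely many roots, and each is exp (h / N) for countably many h. *)
Lemma countable_laurent_zeros (R : realType) (N : nat) (f : R[i] -> R[i]) t0 :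
    (0 < N)%N -> laurent f -> t0 != 0 -> f t0 != 0 ->
  countable [set h : R[i] | f (cexp (h / N%:R)) = 0].
Proof.
move=> N0 lf t00 ft0; have [p p0 pr] := laurent_roots lf t00 ft0.
have [r pE] := closed_field_poly_normal p.
apply: (@sub_countable _ _ _ (\bigcup_(z in [set` r]) [set h : R[i] | cexp (h / N%:R) = z])).
  apply: subset_card_le => h /= hf.
  exists (cexp (h / N%:R)) => //=.
  have := pr _ (cexp_neq0 _) hf.
  by rewrite pE rootZ ?lead_coef_eq0// root_prod_XsubC.
apply: bigcup_countable; first exact: finite_set_countable.
by move=> z _; exact: countable_cexp_fiber.
Qed.

(** * Twenty linearly independent braids *)

Section VectorModel.
Variables (K : fieldType) (N : nat) (l q : K).
Hypothesis q_neq0 : q != 0.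
Hypothesis l_neq0 : l != 0.
Hypothesis qV_neq : q + q^-1 != 0.

Local Notation U := (wedge_index N).
Local Notation T i := (local (@vbraid K N l q) i).
Local Notation rho i := (local (@wbraid K N l q) i).

(** The inverse is given by the Hecke relation rather than by [invmx]: in this form its entries are
    Laurent polynomials and can be computed. *)
Definition vbraid_pow (m : nat) (inv : bool) (i : 'I_m.-1) : Endt K 'I_N m :=
  if inv then l^-1 ^+ 2 *: (T i - (l * (q - q^-1))%:M) else T i.

Lemma vbraid_powV (m : nat) (i : 'I_m.-1) :
  vbraid_pow true i *m vbraid_pow false i = 1%:M.
Proof.
rewrite /vbraid_pow /= -scalemxAl mulmxBl mul_scalar_mx vbraid_hecke//.
by rewrite addrC addKr scale_scalar_mx -exprMn mulVf// expr1n.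
Qed.

Definition vletter (k : nat) (x : letter k) : Endt K 'I_N k.*2 :=
  let P (i : 'I_(k.*2).-1) := vbraid_pow x.2 i in
  P (strand1 x.1) *m (P (strand0 x.1) *m (P (strand2 x.1) *m P (strand1 x.1))).

Lemma vletter_winc (k : nat) (x : letter k) :
  vletter x *m winc N q k = winc N q k *m braid_letter N l q x.
Proof.
case: x => i e; have F0 : vletter (i, false) = fbraid_at N l q i.
  by rewrite (@fbraid_atE K N l q k i (strand0 i) (strand1 i) (strand2 i)) /=
    ?addn0 ?addn1 ?addn2.
case: e; last by rewrite F0 fbraid_winc.
have VF : vletter (i, true) *m vletter (i, false) = 1%:M.
  rewrite /vletter /=; set a := strand0 i; set b := strand1 i; set c := strand2 i.
  have ac : vbraid_pow false a *m vbraid_pow false c =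
            vbraid_pow false c *m vbraid_pow false a.
    by apply: local_far; rewrite /= addn0 addn2.
  rewrite -!mulmxA (mulmxA _ _ (vbraid_pow false a *m _)) vbraid_powV mul1mx.
  rewrite (mulmxA (vbraid_pow false a)) ac -(mulmxA (vbraid_pow false c)).
  rewrite (mulmxA (vbraid_pow true c)) vbraid_powV mul1mx.
  by rewrite (mulmxA (vbraid_pow true a)) vbraid_powV mul1mx vbraid_powV.
have ru := wbraid_unit N q_neq0 l_neq0 qV_neq i.
have e : vletter (i, true) *m (winc N q k *m rho i) = winc N q k.
  by rewrite -fbraid_winc// -F0 mulmxA VF mul1mx.
by rewrite -{2}e /braid_letter /= -!mulmxA mulmxV// mulmx1.
Qed.

Lemma nceval_winc (k : nat) t :
  nceval (@vletter k) t *m winc N q k =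
  winc N q k *m nceval (@braid_letter K N l q k) t.
Proof.
elim: t => [x|d|t IHt u IHu|t IHt u IHu] /=.
- exact: vletter_winc.
- by rewrite mul_scalar_mx mul_mx_scalar.
- by rewrite mulmxDl mulmxDr IHt IHu.
- by rewrite -mulmxA IHu !mulmxA IHt.
Qed.

End VectorModel.

(** * Integer model of the action at q = 2 *)

Local Notation Z := BinInt.Z.

Definition swap_at (i : nat) (s : seq nat) : seq nat :=
  mkseq (fun j => nth 0%N s (if j == i then i.+1 else if j == i.+1 then i else j)) 6.

(* For q = 2, twice the action of a braid generator (up to a power of l). *)
Definition zbraid (inv : bool) (i : nat) (G : seq nat -> Z) (s : seq nat) : Z :=
  if (nth 0 s i.+1 < nth 0 s i)%N
  then if inv then 2 * G (swap_at i s) else 2 * G (swap_at i s) + 3 * G s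
  else if inv then 2 * G (swap_at i s) - 3 * G s else 2 * G (swap_at i s).

Definition zletter (x : nat * bool) (G : seq nat -> Z) : seq nat -> Z :=
  let i := x.1.*2 in
  zbraid x.2 i.+1 (zbraid x.2 i (zbraid x.2 i.+2 (zbraid x.2 i.+1 G))).

(** Twice the coordinates of the j-th wedge factor of the starting vector, the coefficient - q^-1
    being - 1/2. *)
Definition zwedge (s : seq nat) (j : nat) : Z :=
  let p := (nth 0%N s j.*2, nth 0%N s j.*2.+1) in
  (p == (j.*2, j.*2.+1))%:R *+ 2 - (p == (j.*2.+1, j.*2))%:R.

Definition zstart (s : seq nat) : Z := zwedge s 0 * (zwedge s 1 * zwedge s 2).

(* The matrix of the coordinates on the words of the second column of the images
   of the vector (e_0 ^ e_1)(e_2 ^ e_3)(e_4 ^ e_5) by the braids of the first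
   column is lower triangular. *)
Definition braid_table : seq (seq (nat * bool) * seq nat) := [::
  ([::], [:: 0; 1; 2; 3; 4; 5]);
  ([:: (0,false); (1,false)], [:: 4; 5; 0; 1; 2; 3]);
  ([:: (0,false)], [:: 2; 3; 0; 1; 4; 5]);
  ([:: (1,false)], [:: 0; 1; 4; 5; 2; 3]);
  ([:: (1,true)], [:: 0; 1; 2; 4; 3; 5]);
  ([:: (0,false); (1,false); (0,false)], [:: 4; 5; 2; 3; 0; 1]);
  ([:: (0,false); (1,false); (0,true)], [:: 4; 5; 0; 2; 1; 3]);
  ([:: (0,false); (1,true)], [:: 2; 4; 0; 1; 3; 5]);
  ([:: (1,false); (0,false)], [:: 2; 3; 4; 5; 0; 1]);
  ([:: (1,true); (0,false)], [:: 2; 3; 0; 4; 1; 5]);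
  ([:: (0,true)], [:: 1; 2; 0; 3; 4; 5]);
  ([:: (1,false); (0,true); (1,false)], [:: 0; 4; 2; 3; 1; 5]);
  ([:: (0,true); (1,false)], [:: 0; 4; 1; 5; 2; 3]);
  ([:: (0,false); (1,true); (0,true)], [:: 0; 4; 1; 2; 3; 5]);
  ([:: (0,true); (1,true)], [:: 0; 3; 1; 4; 2; 5]);
  ([:: (1,false); (0,true)], [:: 0; 2; 4; 5; 1; 3]);
  ([:: (1,true); (0,true)], [:: 0; 2; 3; 4; 1; 5]);
  ([:: (0,true); (1,false); (0,false)], [:: 2; 4; 3; 5; 0; 1]);
  ([:: (0,true); (1,false); (0,true)], [:: 2; 4; 0; 5; 1; 3]);
  ([:: (0,true); (1,true); (0,true)], [:: 2; 4; 0; 3; 1; 5])]%N.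

Definition table_braid (i : nat) := (nth ([::], [::]) braid_table i).1.
Definition table_word (i : nat) := (nth ([::], [::]) braid_table i).2.

Definition zcoord (i j : nat) : Z := foldr zletter zstart (table_braid i) (table_word j).

Lemma zcoord_trig :
  all (fun i => (zcoord i i != 0) &&
    all (fun j => zcoord i j == 0) (iota i.+1 (19 - i))) (iota 0 20).
Proof. by vm_compute. Qed.

(** Distinct letters exclude the equal-letter case of the braiding, which is absent from [zbraid],
    and the property survives swaps. *)
Definition good_word (s : seq nat) : bool :=
  [&& size s == 6, uniq s & all (ltn^~ 6) s].

Lemma table_word_good : all (fun j => good_word (table_word j)) (iota 0 20).
Proof. by vm_compute. Qed.

Definition table_poly (K : fieldType) (i : nat) : ncpoly K (letter 3) :=
  foldr (fun x t => Mul (Gen (inord x.1 : 'I_3.-1, x.2)) t) (Cst 1) (table_braid i).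

(** * The coordinate matrix of the twenty braids *)

Section Table.
Variables (K : fieldType) (N : nat) (N6 : (6 <= N)%N).

Let v0 : 'I_N := Ordinal (leq_trans (isT : 0 < 6)%N N6).

Definition letter_of (n : nat) : 'I_N := insubd v0 n.

Lemma val_letter_of n : (n < 6)%N -> letter_of n = n :> nat.
Proof. by move=> n6; rewrite insubdK// unfold_in /= (leq_trans n6). Qed.

Definition word_of (s : seq nat) : {ffun 'I_3.*2 -> 'I_N} :=
  [ffun j => letter_of (nth 0%N s (j : 'I_3.*2))].

Let p_proof (j : 'I_3) : (letter_of j.*2 < letter_of j.*2.+1)%N.
Proof. by rewrite !val_letter_of; case: j => [[|[|[|]]]]. Qed.

Definition start_word : {ffun 'I_3 -> wedge_index N} :=
  [ffun j => exist _ (letter_of (j : 'I_3).*2, letter_of (j : 'I_3).*2.+1) (p_proof j)].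

Definition start_vec (q : K) : {ffun 'I_3.*2 -> 'I_N} -> K :=
  act (winc N q 3) (fun x => (x == start_word)%:R).

Definition table_mx (l q : K) : 'M[K]_20 :=
  \matrix_(i, j) act (nceval (@vletter K N l q 3) (table_poly K i)) (start_vec q)
                     (word_of (table_word j)).

(** A linear relation between the braids, applied to the starting vector, carried to the sixth
    tensor power of V by [winc] and read on the chosen words, is a linear relation between the rows
    of the matrix. *)
Lemma table_free (l q : K) : q != 0 -> l != 0 -> q + q^-1 != 0 ->
    \det (table_mx l q) != 0 ->
  forall d : 'I_20 -> K,
    \sum_i d i *: nceval (@braid_letter K N l q 3) (table_poly K i) = 0 ->
  forall i, d i = 0.
Proof.
move=> q0 l0 qV det0 d d0 i.
have u : table_mx l q \in unitmx by rewrite unitmxE unitfE.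
suff : (\row_j d j) *m table_mx l q = 0.
  move=> /(congr1 (mulmx^~ (invmx (table_mx l q)))); rewrite mulmxK// mul0mx.
  by move=> /matrixP /(_ 0 i); rewrite !mxE.
apply/rowP => j; rewrite !mxE.
transitivity (act (winc N q 3 *m
    \sum_k d k *: nceval (@braid_letter K N l q 3) (table_poly K k))
    (fun x => (x == start_word)%:R) (word_of (table_word j))); last first.
  by rewrite d0 mulmx0 act0.
rewrite mulmx_sumr {1}/act.
under [RHS]eq_bigr => x _ do rewrite summxE mulr_suml.
rewrite exchange_big /=; apply: eq_bigr => k _.
rewrite !mxE -act_mul nceval_winc// /act mulr_sumr; apply: eq_bigr => x _.
by rewrite -scalemxAr [in RHS]mxE mulrA.
Qed.

End Table.

(** * Comparison with the integer model *)

Section TableAtTwo.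
Variables (K : numFieldType) (N : nat) (N6 : (6 <= N)%N) (l : K).
Hypothesis l_neq0 : l != 0.
Local Notation T i := (local (@vbraid K N l 2) i).
Local Notation ww := (word_of N6).

Definition zK (z : Z) : K := (int_of_Z z)%:~R.

Let zKD x y : zK (x + y) = zK x + zK y. Proof. by rewrite /zK !rmorphD. Qed.
Let zKB x y : zK (x - y) = zK x - zK y. Proof. by rewrite /zK !rmorphB. Qed.
Let zKM x y : zK (x * y) = zK x * zK y. Proof. by rewrite /zK !rmorphM. Qed.
Let zKn n : zK n%:R = n%:R. Proof. by rewrite /zK !rmorph_nat. Qed.

(** The scalar absorbs powers of l and denominators. Agreement on good words is enough, since their
    values under a crossing involve good words only. *)
Definition models (sc : K) (g : {ffun 'I_3.*2 -> 'I_N} -> K) (G : seq nat -> Z) :=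
  forall s, good_word s -> g (ww s) = sc * zK (G s).

Lemma good_nth s i : good_word s -> (i < 6)%N -> (nth 0%N s i < 6)%N.
Proof.
by move=> /and3P[/eqP s6 _ /all_nthP sl] i6; apply: sl; rewrite s6.
Qed.

Lemma good_nth_eq s i j : good_word s -> (i < 6)%N -> (j < 6)%N ->
  (nth 0%N s i == nth 0%N s j) = (i == j).
Proof. by move=> /and3P[/eqP s6 us _] i6 j6; rewrite nth_uniq ?s6. Qed.

Lemma swap_good i s : (i < 5)%N -> good_word s -> good_word (swap_at i s).
Proof.
move=> i5 gs; pose sg j := if j == i then i.+1 else if j == i.+1 then i else j.
have sg6 j : (j < 6)%N -> (sg j < 6)%N by rewrite /sg; do 2 case: eqP => //; lia.
apply/and3P; split; first by rewrite size_mkseq.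
  apply/mkseq_uniqP => j j'; rewrite !inE => j6 j'6 /eqP.
  rewrite -/(sg j) -/(sg j') good_nth_eq// ?sg6// => /eqP.
  rewrite /sg; case: (j =P i); case: (j =P i.+1); case: (j' =P i);
    by case: (j' =P i.+1); lia.
apply/(all_nthP 0%N) => j; rewrite size_mkseq => j6.
by rewrite nth_mkseq//; apply: good_nth => //; exact: sg6.
Qed.

Lemma models_vbraid sc g G inv (i : 'I_(3.*2).-1) : models sc g G ->
  models (sc * (if inv then l^-1 else l) / 2)
    (act (vbraid_pow N l 2 inv i) g) (zbraid inv i G).
Proof.
move=> gG s gs; have i5 := ltn_ord i; rewrite /= in i5.
(* The letters of a good word differ, so only the branch of distinct letters remains; 2 - 2^-1 is q
   - q^-1. *)
have E : act (T i) g (ww s) = l * (sc * zK (G (swap_at i s))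
    + (2 - 2^-1) *+ (nth 0 s i.+1 < nth 0 s i)%N * (sc * zK (G s))).
  rewrite act_vbraid -!(gG _)//; last exact: swap_good.
  rewrite -!val_eqE /= !ffunE /= !val_letter_of ?good_nth//; last by lia.
  rewrite good_nth_eq//; try lia.
  have -> : (nat_of_ord i == i.+1) = false by lia.
  congr (_ * (g _ + _)); apply/ffunP => j; rewrite !ffunE -!val_eqE /=.
  rewrite nth_mkseq; last exact: (ltn_ord j).
  case: (nat_of_ord j =P nat_of_ord i) => _ //.
  by case: (nat_of_ord j =P (nat_of_ord i).+1) => _.
have n2 : (2 : K) != 0 by rewrite pnatr_eq0.
rewrite /zbraid /vbraid_pow.
case: inv; last first.
  rewrite E; case: ifP => _ /=; rewrite ?zKD !zKM !zKn ?mulr0n ?mulr1n; by field.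
rewrite actZ actD E -raddfN /= act_scalar (gG s gs).
by case: ifP => _ /=; rewrite ?zKB !zKM !zKn ?mulr0n ?mulr1n; field; rewrite ?l_neq0 ?n2.
Qed.

Lemma models_letter sc g G (x : nat * bool) : sc != 0 -> (x.1 < 2)%N ->
    models sc g G ->
  exists2 sc', sc' != 0 & models sc'
    (act (vletter N l 2 (inord x.1 : 'I_3.-1, x.2)) g) (zletter x G).
Proof.
case: x => n inv sc0 /= n2 gG.
set lam := if inv then l^-1 else l.
have lam0 : lam != 0 by rewrite /lam; case: (inv); rewrite ?invr_eq0.
have e0 : strand0 (inord n : 'I_3.-1) = n.*2 :> nat by rewrite /= inordK// addn0.
have e1 : strand1 (inord n : 'I_3.-1) = n.*2.+1 :> nat by rewrite /= inordK// addn1.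
have e2 : strand2 (inord n : 'I_3.-1) = n.*2.+2 :> nat by rewrite /= inordK// addn2.
have m1 := models_vbraid inv (strand1 (inord n : 'I_3.-1)) gG.
have m2 := models_vbraid inv (strand2 (inord n : 'I_3.-1)) m1.
have m3 := models_vbraid inv (strand0 (inord n : 'I_3.-1)) m2.
have m4 := models_vbraid inv (strand1 (inord n : 'I_3.-1)) m3.
rewrite e0 e1 e2 in m4.
exists (sc * lam / 2 * lam / 2 * lam / 2 * lam / 2).
  by rewrite !mulf_neq0 // ?invr_eq0 ?pnatr_eq0.
move=> s gs; rewrite /vletter /= -[RHS](m4 s gs) act_mul.
by apply: eq_act => y; rewrite act_mul; apply: eq_act => {}y; rewrite act_mul.
Qed.

Lemma models_word sc g G (w : seq (nat * bool)) : sc != 0 ->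
    all (fun x => x.1 < 2)%N w -> models sc g G ->
  exists2 sc', sc' != 0 & models sc'
    (act (nceval (@vletter K N l 2 3)
      (foldr (fun x t => Mul (Gen (inord x.1 : 'I_3.-1, x.2)) t) (Cst 1) w)) g)
    (foldr zletter G w).
Proof.
move=> sc0 + gG; elim: w => [_|x w IHw /= /andP[x2 w2]] /=.
  by exists sc => // s gs; rewrite act_scalar mul1r gG.
have [sc1 sc10 m1] := IHw w2; have [sc2 sc20 m2] := models_letter sc10 x2 m1.
by exists sc2 => // s gs; rewrite act_mul m2.
Qed.

Lemma models_start : models (8^-1) (start_vec N6 2) zstart.
Proof.
move=> s gs; have s6 i : (i < 6)%N -> (nth 0%N s i < 6)%N by exact: good_nth.
rewrite /start_vec act_winc (bigD1 (start_word N6)) //= eqxx mulr1.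
rewrite [X in _ + X]big1 ?addr0 => [|x /negPf ->]; last by rewrite mulr0.
have E (j : 'I_3) : wvec 2 (start_word N6 j) (pair_at (ww s) j) =
    2^-1 * zK (zwedge s j).
  have jlt : ((j : nat).*2.+1 < 6)%N by case: j => [[|[|[|]]]].
  rewrite /wvec /zwedge /pair_at !ffunE /= !xpair_eqE -!val_eqE /=.
  rewrite !val_letter_of ?s6 ?(ltnW jlt)//.
  by rewrite zKB -[X in zK X]mulr_natr zKM !zKn -[_ *+ (_ && _)]mulr_natr; field.
rewrite !big_ord_recl big_ord0 mulr1 !E /zstart !zKM /=.
by field.
Qed.

(** Each row is a non-zero multiple of a row of the integer matrix, which is lower triangular with
    non-zero diagonal. *)
Lemma det_table_neq0 : \det (table_mx N6 l 2) != 0.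
Proof.
have row (i : 'I_20) : exists sc : K, sc != 0 /\
    forall j, table_mx N6 l 2 i j = sc * zK (zcoord i j).
  have all2 : all (fun i => all (fun x => x.1 < 2)%N (table_braid i)) (iota 0 20).
    by vm_compute.
  have table_i : all (fun x => x.1 < 2)%N (table_braid i).
    by apply: (allP all2 i); rewrite mem_iota ltn_ord.
  have n8 : (8^-1 : K) != 0 by rewrite invr_eq0 pnatr_eq0.
  have [sc sc0 m] := models_word n8 table_i models_start.
  exists sc; split=> // j; rewrite mxE m//.
  by apply: (allP table_word_good j); rewrite mem_iota ltn_ord.
have zK0 (z : Z) : (zK z == 0) = (z == 0).
  by rewrite /zK intr_eq0 -(inj_eq (can_inj int_of_ZK)) rmorph0.
have [trig diag] : (forall i j : 'I_20, (i < j)%N -> zcoord i j = 0) /\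
    (forall i : 'I_20, zcoord i i != 0).
  split=> [i j ij|i]; have /allP/(_ i) := zcoord_trig; rewrite mem_iota ltn_ord => /(_ isT).
    move=> /andP[_ /allP/(_ j)]; rewrite mem_iota ij /= => h; apply/eqP/h.
    by have := ltn_ord j; have := ltn_ord i; lia.
  by case/andP.
rewrite det_trig; last first.
  by apply/is_trig_mxP => i j ij; have [sc [_ ->]] := row i; rewrite trig// /zK rmorph0 mulr0.
by apply/prodf_neq0 => i _; have [sc [sc0 ->]] := row i; rewrite mulf_neq0// zK0.
Qed.

End TableAtTwo.

(** * Generic values of the parameter *)

Section LaurentFamilies.
Variables (K : fieldType) (N : nat) (l q : K -> K).
Hypotheses (l_laurent : laurent l) (lV_laurent : laurent (fun t => (l t)^-1)).
Hypotheses (q_laurent : laurent q) (qV_laurent : laurent (fun t => (q t)^-1)).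

Lemma laurent_if (f : K -> K) (e : bool) : laurent f -> laurent (fun t => f t *+ e).
Proof.
case: e => // _.
by apply: laurent_ext (laurent_cst 0) _ => t _; rewrite mulr0n.
Qed.

Let qB_laurent : laurent (fun t => q t - (q t)^-1).
Proof. by apply: laurentD => //; exact: laurentN. Qed.

Lemma laurent_vbraid y x : laurent (fun t => @vbraid K N (l t) (q t) y x).
Proof.
apply: laurentM => //; case: (x.1 == x.2); first exact: laurent_if.
apply: laurentD; first exact: laurent_cst.
exact: laurent_if.
Qed.

Lemma laurent_local (T : finType) (M : K -> T * T -> T * T -> K) (k : nat)
    (i : 'I_k.-1) :
  (forall y x, laurent (fun t => M t y x)) -> laurent_mx (fun t => local (M t) i).
Proof.
move=> lM r s; apply: laurent_ext; last first.
  by move=> t _; rewrite mxE.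
apply: laurent_sum => p; apply: laurentM => //; exact: laurent_cst.
Qed.

Lemma laurent_mxZ m n f (M : K -> 'M[K]_(m, n)) :
  laurent f -> laurent_mx M -> laurent_mx (fun t => f t *: M t).
Proof.
move=> lf lM i j; apply: laurent_ext (laurentM lf (lM i j)) _ => t _.
by rewrite mxE.
Qed.

Lemma laurent_wvec p ij : laurent (fun t => @wvec K N (q t) p ij).
Proof.
apply: laurentD; first exact: laurent_cst.
exact/laurentN/laurent_if.
Qed.

Lemma laurent_wbraid y x : laurent (fun t => @wbraid K N (l t) (q t) y x).
Proof.
have lf : laurent_mx (fun t => fbraid N (l t) (q t)).
  by do ! apply: laurent_mxM; apply: laurent_local; exact: laurent_vbraid.
apply: laurent_sum => u; apply: laurent_sum => v; apply: laurentM; first exact: lf.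
by apply: laurentM; exact: laurent_wvec.
Qed.

Lemma laurent_winc k : laurent_mx (fun t => winc N (q t) k).
Proof.
move=> r s; apply: laurent_ext; last by move=> t _; rewrite mxE.
by apply: laurent_prod => j; exact: laurent_wvec.
Qed.

Lemma laurent_wtwist : laurent_mx (fun t => wtwist N (l t) (q t)).
Proof.
have lr i : laurent_mx (fun t => local (@wbraid K N (l t) (q t)) i : Endt K _ 3).
  by apply: laurent_local; exact: laurent_wbraid.
apply: laurent_mxD; first by do ! apply: laurent_mxM.
apply/laurent_mx_scalar/laurentX/laurentM; apply: laurentM; try exact: laurentX.
apply: laurent_ext (laurentX 4 qV_laurent) _ => t _.
by rewrite exprVn.
Qed.

Lemma laurent_nceval (X : Type) n (g : K -> X -> 'M[K]_n) u :
  (forall x, laurent_mx (fun t => g t x)) -> laurent_mx (fun t => nceval (g t) u).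
Proof.
move=> lg; elim: u => [x|d|u IHu v IHv|u IHu v IHv] /=.
- exact: lg.
- exact/laurent_mx_scalar/laurent_cst.
- exact: laurent_mxD.
- exact: laurent_mxM.
Qed.

Lemma laurent_vletter k (x : letter k) : laurent_mx (fun t => vletter N (l t) (q t) x).
Proof.
have lp (i : 'I_(k.*2).-1) e : laurent_mx (fun t => vbraid_pow N (l t) (q t) e i).
  have lT : laurent_mx (fun t => local (@vbraid K N (l t) (q t)) i).
    by apply: laurent_local; exact: laurent_vbraid.
  case: e => //; apply: laurent_mxZ; first exact: laurentX.
  apply: laurent_mxD => // r s; apply: laurent_ext; last first.
    by move=> t _; rewrite mxE.
  by apply/laurentN/laurent_mx_scalar/laurentM.
by do ! apply: laurent_mxM.
Qed.

Lemma laurent_act (I J : finType) (M : K -> 'M[K]_(#|I|, #|J|)) (g : K -> J -> K) y :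
    laurent_mx M -> (forall x, laurent (fun t => g t x)) ->
  laurent (fun t => act (M t) (g t) y).
Proof.
by move=> lM lg; apply: laurent_sum => x; apply: laurentM; [exact: lM|exact: lg].
Qed.

Lemma laurent_table (N6 : (6 <= N)%N) : laurent_mx (fun t => table_mx N6 (l t) (q t)).
Proof.
move=> i j; apply: laurent_ext; last by move=> t _; rewrite mxE.
apply: laurent_act => [|x].
  by apply: laurent_nceval => x; exact: laurent_vletter.
by apply: laurent_act => [|x']; [exact: laurent_winc|exact: laurent_cst].
Qed.

End LaurentFamilies.

Lemma wtwist_at_one (K : fieldType) N : (2 : K) != 0 -> @wtwist K N 1 1 = 2%:M.
Proof.
move=> n2; have q0 : (1 : K) != 0 := oner_neq0 K.
have qV : (1 : K) + 1^-1 != 0 by rewrite invr1.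
rewrite /wtwist /=; set r0 := local _ (ord0 : 'I_3.-1);
  set r1 := local _ (ord_max : 'I_3.-1).
have r00 : r0 *m r0 = 1%:M by exact: wbraid_involutive.
have r11 : r1 *m r1 = 1%:M by exact: wbraid_involutive.
rewrite -!mulmxA (mulmxA r0 r0) r00 mul1mx (mulmxA r1 r1) r11 mul1mx r00.
have -> : (1 ^+ 4 * 1 ^+ 2 * (1 ^+ 4 / 1 ^+ 4)) ^+ 3 = 1 :> K by field.
by rewrite -raddfD.
Qed.

Lemma countable_setU (X : Type) (A B : set X) :
  countable A -> countable B -> countable (A `|` B).
Proof.
move=> cA cB; have -> : A `|` B = \bigcup_(i in [set: bool]) (if i then A else B).
  rewrite eqEsubset; split=> x; last by move=> [[] _ ?]; [left|right].
  by move=> [Ax|Bx]; [exists true|exists false].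
by apply: bigcup_countable => [|[]].
Qed.

Lemma cexp_real (R : realType) (x : R) : cexp x%:C%C = (expR x)%:C%C.
Proof. by rewrite /cexp /= cos0 sin0 mulr1 mulr0. Qed.

Theorem proposition2p4 (R : realType) (N : nat) (hN : (7 <= N)%N) :
  exists S : set R[i], countable S /\
  forall h : R[i], ~ S h ->
  let a : R[i] := - cexp (- (4%:R * h) / N%:R) in
  let b : R[i] := cexp (2%:R * (N%:R - 2%:R) * h / N%:R) in
  let c : R[i] := cexp (- (4%:R * (N%:R + 1) * h) / N%:R) in
  (forall k : nat,
     exists f : {rmorphism Qalg a b c k -> EndU R N k},
       scalable f /\ forall i : 'I_k.-1, f (Q_s a b c i) = braid_action N h i)
  /\
  (forall f : {rmorphism Qalg a b c 3 -> EndU R N 3},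
     scalable f ->
     (forall i : 'I_(3.-1), f (Q_s a b c i) = braid_action N h i) ->
     injective f /\ ~ (forall M : EndU R N 3, exists x, f x = M)).
Proof.
have N6 : (6 <= N)%N by exact: leq_trans hN.
have N3 : (3 <= N)%N by exact: leq_trans hN.
have N0 : (0 < N)%N by exact: leq_trans hN.
have NR : (N%:R : R[i]) != 0 by rewrite pnatr_eq0 -lt0n.
have n2 : (2 : R[i]) != 0 by rewrite pnatr_eq0.
(* With t = exp (h / N), these are exp (- h / N) and exp h. *)
pose l (t : R[i]) := t^-1; pose q (t : R[i]) := t ^+ N.
have ll : laurent l by exact: laurentV.
have lV : laurent (fun t => (l t)^-1).
  by apply: laurent_ext (laurent_id _) _ => t _; rewrite /l invrK.
have lq : laurent q by exact/laurentX/laurent_id.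
have qV : laurent (fun t => (q t)^-1).
  by apply: laurent_ext (laurentX N ll) _ => t _; rewrite /l /q exprVn.
(* In turn: the two eigenvalues of [vbraid] differ, the model of U_(b,c) is onto the matrices, the
   twist element acts invertibly, and the twenty braids are independent. *)
pose f1 t := q t + (q t)^-1.
pose f2 t := (l t ^+ 4 * q t ^+ 2) ^+ 2
  - (l t ^+ 4 * q t ^+ 2) * (l t ^+ 4 / q t ^+ 4) + (l t ^+ 4 / q t ^+ 4) ^+ 2.
pose f3 t := \det (wtwist N (l t) (q t)).
pose f4 t := \det (table_mx N6 (l t) (q t)).
have lf1 : laurent f1 by exact: laurentD.
have lf2 : laurent f2.
  have lb : laurent (fun t => l t ^+ 4 * q t ^+ 2) by apply: laurentM; exact: laurentX.
  have lc : laurent (fun t => l t ^+ 4 / q t ^+ 4).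
    apply: laurentM; first exact: laurentX.
    by apply: laurent_ext (laurentX 4 qV) _ => t _; rewrite exprVn.
  apply: laurentD; last exact: laurentX.
  by apply: laurentD; [exact: laurentX|apply/laurentN/laurentM].
have lf3 : laurent f3 by apply/laurent_det/laurent_wtwist.
have lf4 : laurent f4 by apply/laurent_det/laurent_table.
have l1 : l 1 = 1 by rewrite /l invr1.
have q1 : q 1 = 1 by rewrite /q expr1n.
have f1_1 : f1 1 != 0 by rewrite /f1 q1 invr1.
have f2_1 : f2 1 != 0.
  have -> : f2 1 = 1 by rewrite /f2 l1 q1; field.
  exact: oner_neq0.
have f3_1 : f3 1 != 0.
  by rewrite /f3 l1 q1 wtwist_at_one// det_scalar expf_neq0.
(* The witness is the real number 2^(1/N), for which q = 2. The value t = 1 would fail: the rows of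
   a generator and of its inverse coincide there. *)
have [t0 t00 f4_0] : exists2 t0, t0 != 0 & f4 t0 != 0.
  exists (cexp (ln 2 / N%:R)%:C%C); first exact: cexp_neq0.
  rewrite /f4; have -> : q (cexp (ln 2 / N%:R)%:C%C) = 2.
    rewrite /q -cexpMn -rmorphMn -mulr_natr divfK; last by rewrite pnatr_eq0 -lt0n.
    by rewrite cexp_real lnK ?posrE// rmorph_nat.
  by apply: det_table_neq0; rewrite /l invr_eq0; exact: cexp_neq0.
pose Z (f : R[i] -> R[i]) := [set h : R[i] | f (cexp (h / N%:R)) = 0].
exists (Z f1 `|` Z f2 `|` Z f3 `|` Z f4); split.
  do ! apply: countable_setU; [
    exact: (countable_laurent_zeros N0 lf1 (oner_neq0 _) f1_1)
  | exact: (countable_laurent_zeros N0 lf2 (oner_neq0 _) f2_1)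
  | exact: (countable_laurent_zeros N0 lf3 (oner_neq0 _) f3_1)
  | exact: (countable_laurent_zeros N0 lf4 t00 f4_0)].
move=> h hZ; pose t := cexp (h / N%:R).
have [h1 h2 h3 h4] : [/\ f1 t != 0, f2 t != 0, f3 t != 0 & f4 t != 0].
  by split; apply/eqP => e; apply: hZ; [do 3 left|do 2 left; right|left; right|right].
have lE : l t = cexp (- h / N%:R) by rewrite /l -cexpN mulNr.
have qE : q t = cexp h by rewrite /q -cexpMn -[X in cexp X]mulr_natr divfK.
rewrite /f1 /f2 /f3 /f4 lE qE in h1 h2 h3 h4.
set L := cexp (- h / N%:R) in h2 h3 h4; set Q := cexp h in h1 h2 h3 h4.
have L0 : L != 0 by exact: cexp_neq0.
have Q0 : Q != 0 by exact: cexp_neq0.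
have h3u : wtwist N L Q \in unitmx by rewrite unitmxE unitfE.
(* The constants a, b, c become - L^4, L^4 Q^2 and L^4 / Q^4; for the last, - 4 h / N - 4 h = - 4 (N
   + 1) h / N. *)
have -> : cexp (- (4%:R * h) / N%:R) = L ^+ 4.
  by rewrite -cexpMn; congr cexp; field.
have -> : cexp (2%:R * (N%:R - 2%:R) * h / N%:R) = L ^+ 4 * Q ^+ 2.
  by rewrite -!cexpMn -cexpD; congr cexp; field.
have -> : cexp (- (4%:R * (N%:R + 1) * h) / N%:R) = L ^+ 4 / Q ^+ 4.
  by rewrite -!cexpMn -cexpN -cexpD; congr cexp; field.
have aE k (i : 'I_k.-1) : braid_action N h i = local (@wbraid _ N L Q) i by [].
move=> a b c; split=> [k|f fZ fs].
  exact: (Q_action Q0 L0 h1 h3u k).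
split; last exact: (Q_action_not_surj Q0 L0 h1 N3 fZ fs).
exact: (Q_action_inj Q0 L0 h1 h3u fZ fs h2 (table_free Q0 L0 h1 h4)).
Qed.
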